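(* For every $n\ge 0$, the $n$th Askey–Wilson moment satisfies $$\mu_n(a,b,c,d\,|\,q)=\frac{(1-q)^n}{2^n i^n\prod_{j=0}^{n-1}(\alpha\beta-\gamma\delta q^j)}\,Z_n(-1;\alpha,\beta,\gamma,\delta;q),$$ where $i^2=-1$ and $$\alpha=\frac{1-q}{1-ac+ai+ci},\quad \beta=\frac{1-q}{1-bd-bi-di},\quad \gamma=\frac{(1-q)ac}{1-ac+ai+ci},\quad \delta=\frac{(1-q)bd}{1-bd-bi-di}.$$
   Context: Staircase tableaux: a staircase tableau of size $n$ is a filling of the Young diagram of staircase shape $(n,n-1,\dots,1)$ (English convention: row $r$ consists of columns $1,\dots,n+1-r$; the diagonal boxes are the last boxes of the rows) in which each box is empty or labeled by one of $\alpha,\beta,\gamma,\delta$, such that: no diagonal box is empty; every box in the same row and to the left of a $\beta$ or a $\delta$ is empty; every box in the same column and above an $\alpha$ or a $\gamma$ is empty. The type of $T$ is the word in $\{\bullet,\circ\}^n$ obtained by reading the diagonal boxes from northeast to southwest, writing $\bullet$ for $\alpha$ or $\delta$ and $\circ$ for $\beta$ or $\gamma$. Each empty box is assigned $q$ or $1$ according to the nearest labeled box to its right in its row and the nearest labeled box below it in its column: it gets $1$ if it sees a $\beta$ to its right; $q$ if it sees a $\delta$ to its right; $1$ if it sees an $\alpha$ or $\gamma$ to its right and an $\alpha$ or $\delta$ below it; $q$ if it sees an $\alpha$ or $\gamma$ to its right and a $\beta$ or $\gamma$ below it. The weight $\mathrm{wt}(T)$ is the product of all labels $\alpha,\beta,\gamma,\delta$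 in $T$ and all assigned $q$'s. Let $t(T)$ be the number of $\bullet$'s in the type of $T$, and $Z_n(y;\alpha,\beta,\gamma,\delta;q)=\sum_T \mathrm{wt}(T)\,y^{t(T)}$, summed over all staircase tableaux of size $n$ (a polynomial in $y,\alpha,\beta,\gamma,\delta,q$). Askey–Wilson moments: $(x;q)_n=\prod_{k=0}^{n-1}(1-xq^k)$ (also for $n=\infty$), $(a_1,\dots,a_s;q)_n=\prod_{r=1}^s(a_r;q)_n$. With $x=\cos\theta=(z+z^{-1})/2$, $z=e^{i\theta}$, let $h_0(a,b,c,d,q)=\frac{(abcd;q)_\infty}{(q,ab,ac,ad,bc,bd,cd;q)_\infty}$ and $w(x)=w(x,a,b,c,d|q)=\frac{(z^2,z^{-2};q)_\infty}{h_0(a,b,c,d,q)\,(az,a/z,bz,b/z,cz,c/z,dz,d/z;q)_\infty}$. For $|a|,|b|,|c|,|d|<1$, the moments are $\mu_n(a,b,c,d|q)=\oint_C \frac{dz}{4\pi i z}\,w\big(\tfrac{z+z^{-1}}{2}\big)\big(\tfrac{z+z^{-1}}{2}\big)^n$, where $C$ is a closed contour enclosing the poles $aq^k,bq^k,cq^k,dq^k$ ($k\ge 0$) and excluding $(aq^k)^{-1},(bq^k)^{-1},(cq^k)^{-1},(dq^k)^{-1}$; for other parameter values they are defined by analytic continuation. *)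

(* Defs.v *)
From HB Require Import structures.
From mathcomp Require Import all_boot all_order all_algebra.
From mathcomp Require Import complex.
From mathcomp Require Import all_classical all_reals all_analysis.

Set Implicit Arguments.
Unset Strict Implicit.
Unset Printing Implicit Defensive.

Import Order.TTheory GRing.Theory Num.Theory.
Import numFieldNormedType.Exports.

Local Open Scope ring_scope.
Local Open Scope classical_set_scope.

Inductive label := Alpha | Beta | Gamma | Delta.

Definition nat_of_label (x : label) : nat :=
  match x with Alpha => 0 | Beta => 1 | Gamma => 2 | Delta => 3 end.

Definition label_of_nat (k : nat) : label :=
  match k with 0 => Alpha | 1 => Beta | 2 => Gamma | _ => Delta end.

Lemma nat_of_labelK : cancel nat_of_label label_of_nat.
Proof. by case. Qed.

HB.instance Definition _ := Countable.copy label (can_type nat_of_labelK).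

Lemma label_enumP : Finite.axiom [:: Alpha; Beta; Gamma; Delta].
Proof. by case. Qed.

HB.instance Definition _ := fintype.isFinite.Build label label_enumP.

(* Rows and columns are numbered from 0, from top to bottom and from left to
   right: row [i] consists of the columns [j] with [j < n - i]. *)
Definition box (n : nat) := {c : 'I_n * 'I_n | (c.1 + c.2 < n)%N}.

Definition box_row n (c : box n) : nat := (sval c).1.
Definition box_col n (c : box n) : nat := (sval c).2.

Definition on_diagonal n (c : box n) : bool := (box_row c + box_col c).+1 == n.

(* [None] is the empty box. *)
Definition filling (n : nat) := {ffun box n -> option label}.

Definition left_of n (c' c : box n) : bool :=
  (box_row c' == box_row c) && (box_col c' < box_col c)%N.

Definition above n (c' c : box n) : bool :=
  (box_col c' == box_col c) && (box_row c' < box_row c)%N.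

Definition is_staircase_tableau n (T : filling n) : bool :=
  [&& [forall c, on_diagonal c ==> (T c != None)],
      [forall c, forall c',
        (T c \in [:: Some Beta; Some Delta]) && left_of c' c ==>
        (T c' == None)] &
      [forall c, forall c',
        (T c \in [:: Some Alpha; Some Gamma]) && above c' c ==>
        (T c' == None)]].

(* [x] labels the nearest labeled box to the right of [c] in its row. *)
Definition sees_right n (T : filling n) (c : box n) (x : label) : bool :=
  [exists c', [&& left_of c c', T c' == Some x &
    [forall c'', left_of c c'' && left_of c'' c' ==> (T c'' == None)]]].

(* [x] labels the nearest labeled box below [c] in its column. *)
Definition sees_below n (T : filling n) (c : box n) (x : label) : bool :=
  [exists c', [&& above c c', T c' == Some x &
    [forall c'', above c c'' && above c'' c' ==> (T c'' == None)]]].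

(* Whether the empty box [c] is assigned [q]; otherwise it is assigned [1].
   In a staircase tableau every empty box sees exactly one label on its right
   and exactly one below, since the diagonal is completely filled. *)
Definition assigned_q n (T : filling n) (c : box n) : bool :=
  sees_right T c Delta ||
  ((sees_right T c Alpha || sees_right T c Gamma) &&
   (sees_below T c Beta || sees_below T c Gamma)).

Section GeneratingPolynomial.
Context {K : comNzRingType}.

Definition tableau_weight n (T : filling n) (al be ga de q : K) : K :=
  \prod_(c : box n)
    match T c with
    | Some Alpha => al
    | Some Beta => be
    | Some Gamma => ga
    | Some Delta => de
    | None => if assigned_q T c then q else 1
    end.

(* The bullets of the type word are its diagonal labels alpha and delta. *)
Definition num_bullets n (T : filling n) : nat :=
  #|[set c | on_diagonal c && (T c \in [:: Some Alpha; Some Delta])]%SET|.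

Definition Z (n : nat) (y al be ga de q : K) : K :=
  \sum_(T : filling n | is_staircase_tableau T)
    tableau_weight T al be ga de q * y ^+ num_bullets T.

End GeneratingPolynomial.

(* Giving [R[i]] the structure of a [numClosedFieldType] explicitly makes
   MathComp-Analysis' topology on numeric fields available on it. *)
Definition Cplx (R : realType) : numClosedFieldType := R[i].

Section AskeyWilson.
Context {R : realType}.
Local Notation C := (Cplx R).

Definition qpoch (n : nat) (x q : C) : C := \prod_(k < n) (1 - x * q ^+ k).

Definition qpoch_inf (x q : C) : C := limn (fun n => qpoch n x q).

Definition qpochs_inf (xs : seq C) (q : C) : C :=
  \prod_(x <- xs) qpoch_inf x q.

Definition aw_h0 (a b c d q : C) : C :=
  qpoch_inf (a * b * c * d) q /
  qpochs_inf [:: q; a * b; a * c; a * d; b * c; b * d; c * d] q.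

(* [w (x, a, b, c, d | q)] for [x = (z + z^-1) / 2], as a function of [z]; it
   is invariant under [z |-> z^-1]. *)
Definition aw_w (a b c d q z : C) : C :=
  qpochs_inf [:: z ^+ 2; z ^- 2] q /
  (aw_h0 a b c d q *
   qpochs_inf [:: a * z; a / z; b * z; b / z; c * z; c / z; d * z; d / z] q).

Definition cis (t : R) : C := (cos t +i* sin t)%C.

Definition cintegral (s t : R) (F : R -> C) : C :=
  ((\int[lebesgue_measure]_(x in `[s, t]) complex.Re (F x))%R +i*
   (\int[lebesgue_measure]_(x in `[s, t]) complex.Im (F x))%R)%C.

(* [z = cis t], [dz = 'i * cis t * dt] *)
Definition unit_circle_integral (f : C -> C) : C :=
  cintegral 0 (2 * pi) (fun t => f (cis t) * ('i * cis t)).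

(* For parameters in the open unit disc (and [`|q| < 1]) the unit circle
   encloses all [a q^k, b q^k, c q^k, d q^k] and excludes their inverses. *)
Definition aw_moment_integral (n : nat) (a b c d q : C) : C :=
  unit_circle_integral (fun z =>
    (4 * pi%:C%C * 'i * z)^-1 * aw_w a b c d q z * ((z + z^-1) / 2) ^+ n).

Definition monomial k (h : 'rV[C]_k) (m : {ffun 'I_k -> nat}) : C :=
  \prod_(i < k) h 0 i ^+ m i.

Definition multi_index k N (m : {ffun 'I_k -> 'I_N}) : {ffun 'I_k -> nat} :=
  [ffun i => m i : nat].

(* [f] is the sum of an absolutely convergent power series in the coordinates
   on some polydisc around [p]; the partial sums are over the multi-indices
   with all entries smaller than [N]. *)
Definition analytic_at k (f : 'rV[C]_k -> C) (p : 'rV[C]_k) : Prop :=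
  exists (coef : {ffun 'I_k -> nat} -> C) (r : C), 0 < r /\
    forall h : 'rV[C]_k, (forall i, `|h 0 i| < r) ->
      let term m := coef m * monomial h m in
      cvgn (fun N => \sum_(m : {ffun 'I_k -> 'I_N}) `|term (multi_index m)|) /\
      (fun N => \sum_(m : {ffun 'I_k -> 'I_N}) term (multi_index m)) @ \oo
        --> f (p + h).

Definition aw_params (a b c d q : C) : 'rV[C]_5 :=
  \row_(i < 5) [:: a; b; c; d; q]`_i.

Definition polydisc (k : nat) : set 'rV[C]_k :=
  [set p | forall i, `|p 0 i| < 1].
Arguments polydisc : clear implicits.

(* [f] is an analytic continuation, jointly in the five parameters, of the
   integral moment to the connected open set [U]. *)
Definition aw_moment_continuation (n : nat) (U : set 'rV[C]_5)
    (f : 'rV[C]_5 -> C) : Prop :=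
  [/\ open U, connected U, polydisc 5 `<=` U,
      (forall p, U p -> analytic_at f p) &
      (forall a b c d q : C, polydisc 5 (aw_params a b c d q) ->
         f (aw_params a b c d q) = aw_moment_integral n a b c d q)].

(* The common value at the given parameters of the analytic continuations of
   the integral moment; the default [0] is only taken if there is none. *)
Definition aw_moment (n : nat) (a b c d q : C) : C :=
  xget 0 [set v | exists U f,
    [/\ aw_moment_continuation n U f, U (aw_params a b c d q) &
        f (aw_params a b c d q) = v]].

End AskeyWilson.

(* Main.v *)
(* Removing the first column of a tableau, with the number of rows starting by
   alpha or gamma as the only memory, writes Z_n as a sum over words in letters
   D and E; the column operators satisfy the relations of the matrix ansatz up
   to the operator [opL], which acts at 0 as alpha beta - gamma delta q^j. After
   dividing by these scalars, dd = i((1-q)D-1) and ee = -i((1-q)E-1) satisfy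
   ee dd - q dd ee = 1-q, and 2x = dd + ee, so the resulting functional is known
   on prod_j (1 + a^2 q^2j - 2 a q^j x).
   On the integral side, with P(z) = (z^2)_oo / (az,bz,cz,dz)_oo, the identity
   int P(qz) P(1/z) (1/z - qz) = 0, clear for polynomials P by orthogonality of
   the powers of z, gives the first moment, hence the effect of a -> aq on the
   total mass: this is the same functional, and the mass itself follows from
   a q^n -> 0 and the parameters (q, -q, s, -s), s^2 = q, where P(z) = 1 - z^2.
   Thus the formula holds on the unit polydisc. Its right-hand side is rational
   with denominator D, {D != 0} is open and connected (a curve from 0 to p along
   the complex line Cp avoids the finitely many zeros), and analytic
   continuations are unique. *)
Require Import Defs.
From mathcomp Require Import all_boot all_order all_algebra.
From mathcomp Require Import complex.
From mathcomp Require Import all_classical all_reals all_analysis.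
From mathcomp Require Import ring lra zify.

Set Implicit Arguments.
Unset Strict Implicit.
Unset Printing Implicit Defensive.

Import Order.TTheory GRing.Theory Num.Theory.
Import numFieldNormedType.Exports.
Local Open Scope ring_scope.
Local Open Scope classical_set_scope.

(** * Column operators and the matrix ansatz *)

(** The polynomials prod_j (1 + a^2 q^2j - 2 a q^j x) have degree n only when a and q are nonzero,
    so they determine the moments only there. The points of the polydisc with a = 0 or q = 0 are
    reached by a limit in a and q, and for this reason every estimate on infinite products is
    uniform in x and q. No contour is deformed and no Cauchy formula enters. All integrals run over
    the unit circle, where the functions of z involved are built from uniform limits of polynomials,
    and analyticity is handled as absolute convergence of power series. Uniqueness of continuations
    is proved along complex lines, on which the partial sums of a power series are polynomials in
    one variable. To stay among polynomials, the equality of f with the quotient of N by a power of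
    D is carried as an equality without denominators; it also makes sense at zeros of D, which the
    domain of a given continuation may contain. *)

Section Ansatz.
Variables (K : comNzRingType) (al be ga de q : K).
Implicit Types (phi psi : nat -> K) (v : K).

Definition shift_seq phi : nat -> K := fun k => phi k.+1.

(** Here [phi j] stands for the weight of everything to the left of a column when [j] rows start
    with alpha or gamma. The two components sum over the fillings of a column that meets [k] such
    rows, with a bullet or a circle on the diagonal; [v] is the weight of a row that starts with
    delta, one [q] for each column further left. The recursion has the form in which the ansatz
    relations follow by induction on [k]; [col_opsE] compares it with the combinatorial one. *)
Fixpoint col_ops v phi k : K * K :=
  if k is k'.+1 then
    let x := col_ops v (shift_seq phi) k' in
    let y := col_ops v phi k' in
    (x.1 + de * v * (y.1 + y.2), q * x.2 + be * (y.1 + y.2))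
  else (al * phi 1%N + de * v * phi 0%N, ga * phi 1%N + be * phi 0%N).

Definition opD v phi k := (col_ops v phi k).1.
Definition opE v phi k := (col_ops v phi k).2.

(** It takes the place of the scalar on the right of the matrix ansatz. Shifting after it gives
    [be D - de q v E], shifting before it gives [be D - de v E] ([opL_shift]). *)
Definition opL v phi k : K :=
  if k is k'.+1 then be * opD v phi k' - de * q * v * opE v phi k'
  else (al * be - ga * de * v) * phi 0%N.

Lemma opD0 v phi : opD v phi 0 = al * phi 1%N + de * v * phi 0%N.
Proof. by []. Qed.

Lemma opE0 v phi : opE v phi 0 = ga * phi 1%N + be * phi 0%N.
Proof. by []. Qed.

Lemma opDS v phi k : opD v phi k.+1 =
  opD v (shift_seq phi) k + de * v * (opD v phi k + opE v phi k).
Proof. by []. Qed.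

Lemma opES v phi k : opE v phi k.+1 =
  q * opE v (shift_seq phi) k + be * (opD v phi k + opE v phi k).
Proof. by []. Qed.

Lemma eq_col_ops v phi psi : phi =1 psi -> col_ops v phi =1 col_ops v psi.
Proof.
move=> e k; elim: k phi psi e => [|k IH] phi psi e /=; first by rewrite !e.
by rewrite (IH _ _ e) (IH (shift_seq phi) (shift_seq psi)) // => j; exact: e.
Qed.

Lemma eq_opD v phi psi : phi =1 psi -> opD v phi =1 opD v psi.
Proof. by move=> e k; rewrite /opD (eq_col_ops v e). Qed.

Lemma eq_opE v phi psi : phi =1 psi -> opE v phi =1 opE v psi.
Proof. by move=> e k; rewrite /opE (eq_col_ops v e). Qed.

Lemma col_ops_lin v x y phi psi k :
  let chi := fun j => x * phi j + y * psi j in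
  opD v chi k = x * opD v phi k + y * opD v psi k /\
  opE v chi k = x * opE v phi k + y * opE v psi k.
Proof.
elim: k phi psi => [|k IH] phi psi chi.
  by rewrite !opD0 !opE0 /chi; split; ring.
rewrite !opDS !opES; have [-> ->] := IH phi psi.
by have [-> ->] := IH (shift_seq phi) (shift_seq psi); split; ring.
Qed.

Lemma opD_lin v x y phi psi k : opD v (fun j => x * phi j + y * psi j) k =
  x * opD v phi k + y * opD v psi k.
Proof. by have [] := col_ops_lin v x y phi psi k. Qed.

Lemma opE_lin v x y phi psi k : opE v (fun j => x * phi j + y * psi j) k =
  x * opE v phi k + y * opE v psi k.
Proof. by have [] := col_ops_lin v x y phi psi k. Qed.

Lemma eq_opL v phi psi : phi =1 psi -> opL v phi =1 opL v psi.
Proof. by move=> e [|k] /=; rewrite ?e // (eq_opD v e) (eq_opE v e). Qed.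

Lemma opL_lin v x y phi psi k : opL v (fun j => x * phi j + y * psi j) k =
  x * opL v phi k + y * opL v psi k.
Proof. by case: k => [|k] /=; rewrite ?opD_lin ?opE_lin; ring. Qed.

Lemma opL_shift v phi k :
  opL v (shift_seq phi) k = be * opD v phi k - de * v * opE v phi k.
Proof.
case: k => [|k] /=; first by rewrite opD0 opE0 /shift_seq; ring.
by rewrite opDS opES; ring.
Qed.

(** The three identities need each other: a step of the recursion produces products of two column
    operators in both orders, which the third identity reorders, and terms in the shifted sequence,
    which are the induction hypothesis at [shift_seq phi]. The outer operators carry [q * v] because
    their column has one more column on its left. *)
Lemma opL_comm v phi k :
  [/\ opD (q * v) (opL v phi) k = opL (q * v) (opD v phi) k,
      opE (q * v) (opL v phi) k = opL (q * v) (opE v phi) k &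
      opD (q * v) (opE v phi) k - q * opE (q * v) (opD v phi) k =
      opL (q * v) (opD v phi) k + opL (q * v) (opE v phi) k].
Proof.
elim: k phi => [|k IH] phi.
  rewrite !opD0 !opE0 /= !opDS !opES !opD0 !opE0 /shift_seq.
  by split; ring.
have eqL : shift_seq (opL v phi) =1
    fun j => be * opD v phi j + (- (de * q * v)) * opE v phi j.
  by move=> j; rewrite /shift_seq /= mulNr.
have eqE : shift_seq (opE v phi) =1 fun j => q * opE v (shift_seq phi) j +
    be * (1 * opD v phi j + 1 * opE v phi j).
  by move=> j; rewrite /shift_seq /= opES !mul1r.
have eqD : shift_seq (opD v phi) =1 fun j => 1 * opD v (shift_seq phi) j +
    de * v * (1 * opD v phi j + 1 * opE v phi j).
  by move=> j; rewrite /shift_seq /= opDS !mul1r.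
have [IH1 IH2 IH3] := IH phi.
have [IH1' IH2' IH3'] := IH (shift_seq phi).
have eqLs : opL v (shift_seq phi) =1
    fun j => be * opD v phi j + (- (de * v)) * opE v phi j.
  by move=> j; rewrite opL_shift mulNr.
(* Since [L] of the shifted sequence is a combination of D and E, these two instances express [L D]
   and [L E] of the shifted sequence by products of two column operators. *)
have H1 := esym IH1'; have H2 := esym IH2'.
rewrite (eq_opE _ eqLs) opE_lin in H2.
rewrite (eq_opD _ eqLs) opD_lin in H1.
rewrite ![opD _ _ k.+1]opDS ![opE _ _ k.+1]opES.
rewrite (eq_opD _ eqL) (eq_opE _ eqL) (eq_opD _ eqE) (eq_opE _ eqD).
rewrite !opD_lin !opE_lin !IH1 !IH2 /=.
have e3 : opD (q * v) (opE v phi) k = q * opE (q * v) (opD v phi) k +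
   opL (q * v) (opD v phi) k + opL (q * v) (opE v phi) k.
  by rewrite -addrA -IH3; ring.
have e3' : opD (q * v) (opE v (shift_seq phi)) k =
   q * opE (q * v) (opD v (shift_seq phi)) k +
   opL (q * v) (opD v (shift_seq phi)) k + opL (q * v) (opE v (shift_seq phi)) k.
  by rewrite -addrA -IH3'; ring.
split.
- by rewrite e3; ring.
- by rewrite e3; ring.
- rewrite e3' H1 H2 e3; ring.
Qed.

End Ansatz.

Section WordWeight.
Variables (K : comNzRingType) (al be ga de q : K).
Local Notation DD := (opD al be ga de q).
Local Notation EE := (opE al be ga de q).
Local Notation LL := (opL al be ga de q).

(* [true] is the letter D of the matrix ansatz, [false] the letter E. *)
Fixpoint word_wt (w : seq bool) : nat -> K :=
  if w is x :: w' then
    if x then DD (q ^+ size w') (word_wt w')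
    else EE (q ^+ size w') (word_wt w')
  else fun => 1.

(** For empty [X] this is the third identity of [opL_comm]. Each letter put in front commutes with
    [L] and multiplies its argument by [q], which accounts for the exponent. *)
Lemma word_wt_commutation X Y k :
  word_wt (X ++ [:: true, false & Y]) k - q * word_wt (X ++ [:: false, true & Y]) k =
  LL (q ^+ (size X + size Y).+1)
    (fun j => word_wt (X ++ true :: Y) j + word_wt (X ++ false :: Y) j) k.
Proof.
have lin1 phi psi v j : LL v (fun j => phi j + psi j) j =
    LL v phi j + LL v psi j.
  rewrite -[LL _ phi j]mul1r -[LL _ psi j]mul1r -opL_lin.
  by apply: eq_opL => i; rewrite !mul1r.
elim: X k => [|x X IH] k /=.
  rewrite lin1 add0n exprS.
  by have [_ _ ->] := opL_comm al be ga de q (q ^+ size Y) (word_wt Y) k.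
rewrite !size_cat /= !addnS addSn.
set N := (size X + size Y)%N in IH *; set W := fun j => _ in IH.
have [cD cE _] := opL_comm al be ga de q (q ^+ N.+1) W k.
have IHe : (fun j => 1 * word_wt (X ++ [:: true, false & Y]) j +
    (- q) * word_wt (X ++ [:: false, true & Y]) j) =1
    LL (q ^+ N.+1) W.
  by move=> j; rewrite -IH; ring.
have W1 : W =1 fun j => 1 * word_wt (X ++ true :: Y) j + 1 * word_wt (X ++ false :: Y) j.
  by move=> j; rewrite /W !mul1r.
case: x; [rewrite exprS (eq_opL _ _ _ _ _ _ (_ : _ =1 DD (q ^+ N.+1) W))|
  rewrite exprS (eq_opL _ _ _ _ _ _ (_ : _ =1 EE (q ^+ N.+1) W))].
- by rewrite -cD -(eq_opD _ _ _ _ _ _ IHe) opD_lin exprS; ring.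
- by move=> j; rewrite (eq_opD _ _ _ _ _ _ W1) opD_lin; ring.
- by rewrite -cE -(eq_opE _ _ _ _ _ _ IHe) opE_lin exprS; ring.
- by move=> j; rewrite (eq_opE _ _ _ _ _ _ W1) opE_lin; ring.
Qed.

(** The constant function 1 is its own shift, so [opL_shift] at [v = 1] settles the empty word; the
    letters in front then commute with [L]. *)
Lemma word_wt_last X k :
  be * word_wt (rcons X true) k - de * word_wt (rcons X false) k =
  LL (q ^+ size X) (word_wt X) k.
Proof.
elim: X k => [|x X IH] k /=.
  by have := opL_shift al be ga de q 1 (fun => 1) k; rewrite expr0 mulr1 => <-.
rewrite !size_rcons.
have [cD cE _] := opL_comm al be ga de q (q ^+ size X) (word_wt X) k.
have IHe : (fun j => be * word_wt (rcons X true) j +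
    (- de) * word_wt (rcons X false) j) =1
    LL (q ^+ size X) (word_wt X).
  by move=> j; rewrite -IH; ring.
case: x; rewrite exprS.
- by rewrite -cD -(eq_opD _ _ _ _ _ _ IHe) opD_lin; ring.
- by rewrite -cE -(eq_opE _ _ _ _ _ _ IHe) opE_lin; ring.
Qed.

Lemma word_wt_first w :
  al * word_wt (false :: w) 0 - ga * word_wt (true :: w) 0 =
  (al * be - ga * de * q ^+ size w) * word_wt w 0.
Proof. by rewrite /= opD0 opE0; ring. Qed.

Fixpoint words_wt y n (w : seq bool) : K :=
  if n is n'.+1 then y * words_wt y n' (true :: w) + words_wt y n' (false :: w)
  else word_wt w 0.

End WordWeight.

(** * Functionals on polynomials and the moments of the ansatz *)

Definition moment_functional (K : nzRingType) (m : nat -> K) (p : {poly K}) : K :=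
  \sum_(i < size p) p`_i * m i.

(** At [x = (z + z^-1) / 2] the factor is [(1 - a q^j z) (1 - a q^j / z)], so multiplying an
    Askey-Wilson weight by this polynomial replaces [a] by [a q^n]. *)
Definition aw_basis (K : nzRingType) (a q : K) n : {poly K} :=
  \prod_(j < n) ((1 + a ^+ 2 * q ^+ j.*2)%:P - (2 * a * q ^+ j) *: 'X).

Section MomentFunctional.
Variable K : fieldType.
Implicit Types (m : nat -> K) (p : {poly K}).

Lemma moment_functional_widen m p N : (size p <= N)%N ->
  moment_functional m p = \sum_(i < N) p`_i * m i.
Proof.
move=> h; rewrite /moment_functional (big_ord_widen N (fun i => p`_i * m i) h).
rewrite big_mkcond; apply: eq_bigr => i _; case: ltnP => // hi.
by rewrite nth_default ?mul0r.
Qed.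

Lemma moment_functionalM m p c0 c1 :
  moment_functional m ((c0%:P - c1 *: 'X) * p) =
  c0 * moment_functional m p - c1 * moment_functional (fun i => m i.+1) p.
Proof.
have hs : (size ((c0%:P - c1 *: 'X) * p)%R <= (size p).+1)%N.
  apply/leq_sizeP => j hj.
  rewrite mulrBl mul_polyC -scalerAl coefB !coefZ coefXM.
  rewrite [p`_j]nth_default ?(leq_trans _ hj) //.
  case: j hj => [//|j] hj /=.
  by rewrite nth_default ?mulr0 ?subr0.
rewrite (moment_functional_widen m hs) (moment_functional_widen m (leqnSn (size p))).
rewrite mulr_sumr (eq_bigr (fun i : 'I_(size p).+1 => c0 * (p`_i * m i) -
   c1 * (('X * p)`_i * m i))) => [|i _]; last first.
  by rewrite mulrBl mul_polyC -scalerAl coefB !coefZ; ring.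
rewrite sumrB; congr (_ - _); rewrite -mulr_sumr; congr (_ * _).
rewrite big_ord_recl coefXM eqxx mul0r add0r /moment_functional.
by apply: eq_bigr => i _; rewrite coefXM.
Qed.

(** With one polynomial in each degree the system is triangular with nonzero diagonal, so the values
    determine the moments one after another. *)
Lemma moment_functional_basis_inj (P : nat -> {poly K}) m1 m2 :
  (forall n, size (P n) = n.+1) ->
  (forall n, moment_functional m1 (P n) = moment_functional m2 (P n)) ->
  m1 =1 m2.
Proof.
move=> sP eP n; elim/ltn_ind: n => n IH.
have := eP n; rewrite /moment_functional sP !big_ord_recr /=.
under eq_bigr => i _ do rewrite IH //.
move/addrI; apply: mulfI.
by have := lead_coef_eq0 (P n); rewrite lead_coefE sP /= -size_poly_eq0 sP => ->.
Qed.

Lemma size_aw_basis (a q : K) n : (2 : K) != 0 -> a != 0 -> q != 0 ->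
  size (aw_basis a q n) = n.+1.
Proof.
move=> n2 a0 q0; elim: n => [|n IH]; first by rewrite /aw_basis big_ord0 size_poly1.
rewrite /aw_basis big_ord_recr /= -/(aw_basis a q n).
have n0 : 2 * a * q ^+ n != 0 by rewrite !mulf_neq0 // expf_neq0.
set t := (X in _ * X).
have st : size t = 2%N.
  rewrite /t addrC -scaleNr size_polyDl size_scale ?oppr_eq0 ?size_polyX //.
  by rewrite size_polyC; case: (_ == _).
rewrite size_mul ?st ?IH ?addn2 //.
  by rewrite -size_poly_eq0 IH.
by rewrite -size_poly_eq0 st.
Qed.

End MomentFunctional.

Section AlgebraicMoments.
Variables (K : fieldType) (I a b c d q : K).
Hypotheses (I2 : I ^+ 2 = -1) (two : (2 : K) != 0).
Let A := 1 - a * c + a * I + c * I.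
Let B := 1 - b * d - b * I - d * I.
Hypotheses (A0 : A != 0) (B0 : B != 0) (q1 : 1 - q != 0).
Let al := (1 - q) / A.
Let be := (1 - q) / B.
Let ga := (1 - q) * a * c / A.
Let de := (1 - q) * b * d / B.
Let lam j := al * be - ga * de * q ^+ j.
Hypothesis abcd : forall j, 1 - a * b * c * d * q ^+ j != 0.

Lemma lamE j : lam j = (1 - q) ^+ 2 * (1 - a * b * c * d * q ^+ j) / (A * B).
Proof. by rewrite /lam /al /be /ga /de; field; rewrite A0 B0. Qed.

Lemma lam_neq0 j : lam j != 0.
Proof. by rewrite lamE !mulf_neq0 ?invr_neq0 ?mulf_neq0 ?expf_neq0 ?abcd. Qed.

Let F := word_wt al be ga de q.
Let f w := F w 0 / \prod_(j < size w) lam j.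

Lemma prod_lam_neq0 n : \prod_(j < n) lam j != 0.
Proof. by apply/prodf_neq0 => j _; exact: lam_neq0. Qed.

(** The left boundary relation [f_first] is kept apart: [dd] and [ee] act by prepending letters,
    which preserves the bulk and the right boundary relations but in general not that one. *)
Let ansatz (g : seq bool -> K) :=
  (forall X Y, g (X ++ [:: true, false & Y]) - q * g (X ++ [:: false, true & Y]) =
     g (X ++ true :: Y) + g (X ++ false :: Y)) /\
  (forall X, be * g (rcons X true) - de * g (rcons X false) = g X).

Let fE w : F w 0 = f w * \prod_(j < size w) lam j.
Proof. by rewrite /f divfK ?prod_lam_neq0. Qed.

Let f_ansatz : ansatz f.
Proof.
split=> [X Y|X].
  have e := word_wt_commutation al be ga de q X Y 0.
  rewrite /opL -/F -/(lam _) !fE !size_cat /= !addnS big_ord_recr /= in e.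
  apply: (mulIf (prod_lam_neq0 (size X + size Y).+2)).
  by rewrite big_ord_recr /= mulrBl -[q * _ * _]mulrA e; ring.
have e := word_wt_last al be ga de q X 0.
rewrite /opL -/F -/(lam _) !fE !size_rcons in e.
apply: (mulIf (prod_lam_neq0 (size X).+1)).
by rewrite mulrBl -[be * _ * _]mulrA -[de * _ * _]mulrA e big_ord_recr /=; ring.
Qed.

Let f_first w : al * f (false :: w) - ga * f (true :: w) = f w.
Proof.
have e := word_wt_first al be ga de q w; rewrite -/F -/(lam _) !fE in e.
apply: (mulIf (prod_lam_neq0 (size w).+1)).
by rewrite mulrBl -[al * _ * _]mulrA -[ga * _ * _]mulrA e big_ord_recr /=; ring.
Qed.

Let dd (g : seq bool -> K) w := I * ((1 - q) * g (true :: w) - g w).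
Let ee (g : seq bool -> K) w := - I * ((1 - q) * g (false :: w) - g w).

Let ansatz_dd g x y : ansatz g -> ansatz (fun w => x * g w + y * dd g w).
Proof.
move=> [h1 h2]; split=> [X Y|X]; rewrite /dd.
  have e1 := h1 X Y; have e2 := h1 (true :: X) Y; rewrite /= in e2.
  move/eqP: e1; rewrite subr_eq => /eqP ->.
  by move/eqP: e2; rewrite subr_eq => /eqP ->; ring.
have e1 := h2 X; have e2 := h2 (true :: X); rewrite /= in e2.
by rewrite -[in RHS]e1 -e2; ring.
Qed.

Let ansatz_rel g w : ansatz g -> ee (dd g) w = q * dd (ee g) w + (1 - q) * g w.
Proof.
move=> [h1 _]; have := h1 [::] w; rewrite /ee /dd /=.
move/eqP; rewrite subr_eq => /eqP ->.
transitivity (- (I ^+ 2) * ((1 - q) * ((1 - q) * ((g (true :: w) + g (false :: w)) +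
   q * g [:: false, true & w]) - g (false :: w)) - ((1 - q) * g (true :: w) - g w))).
  by ring.
transitivity (- (I ^+ 2) * (q * ((1 - q) * ((1 - q) * g [:: false, true & w] - g (true :: w))
   - ((1 - q) * g (false :: w) - g w))) + (1 - q) * g w).
  by rewrite I2; ring.
by ring.
Qed.

Let f_left w : ee f w + a * c * dd f w = (a + c) * f w.
Proof.
have e : (1 - q) * (f (false :: w) - a * c * f (true :: w)) = A * f w.
  by rewrite -(f_first w) /al /ga; field.
transitivity (- I * ((1 - q) * (f (false :: w) - a * c * f (true :: w)) - (1 - a * c) * f w)).
  by rewrite /ee /dd; ring.
rewrite e; transitivity (- (I ^+ 2) * (a + c) * f w); first by rewrite /A; ring.
by rewrite I2; ring.
Qed.

Let g_right g : ansatz g -> dd g [::] + b * d * ee g [::] = (b + d) * g [::].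
Proof.
move=> [_ /(_ [::])]; rewrite /= => h.
have e : (1 - q) * (g [:: true] - b * d * g [:: false]) = B * g [::].
  by rewrite -h /be /de; field.
transitivity (I * ((1 - q) * (g [:: true] - b * d * g [:: false]) - (1 - b * d) * g [::])).
  by rewrite /ee /dd; ring.
rewrite e; transitivity (- (I ^+ 2) * (b + d) * g [::]); first by rewrite /B; ring.
by rewrite I2; ring.
Qed.

(* [pn n] is [f] acted upon by [(a dd; q)_n]. *)
Let pn := fix pn n := if n is n'.+1 then
  fun w => 1 * pn n' w + (- (a * q ^+ n')) * dd (pn n') w else f.

Let pn_ansatz n : ansatz (pn n).
Proof. by elim: n => [|n IH] //; exact: ansatz_dd. Qed.

Let pnS n w : pn n.+1 w = pn n w - a * q ^+ n * dd (pn n) w.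
Proof. by rewrite /= mul1r mulNr. Qed.

(** The induction starts from the left boundary relation, [ee f = (a + c) f - a c dd f = c (f - a dd
    f) + a f]; the q-commutation of [ee] with [dd] carries it through each factor [1 - a q^n dd]. *)
Let ee_pn n w : ee (pn n) w = c * pn n.+1 w + a * q ^+ n * pn n w.
Proof.
elim: n w => [|n IH] w.
  rewrite pnS /=; apply: (addIr (a * c * dd f w)).
  by rewrite f_left; ring.
have e1 : ee (pn n.+1) w = ee (pn n) w - a * q ^+ n * ee (dd (pn n)) w.
  by rewrite {1}/ee !pnS /ee; ring.
have e2 : dd (ee (pn n)) w = c * dd (pn n.+1) w + a * q ^+ n * dd (pn n) w.
  by rewrite {1}/dd !IH /dd; ring.
rewrite e1 ansatz_rel ?e2 ?IH; last exact: pn_ansatz.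
by rewrite (pnS n.+1) !pnS !exprS; ring.
Qed.

(** The right boundary relation holds at the empty word. Multiplied by [a q^n], with
    [a q^n dd (pn n) = pn n - pn n.+1] and [ee (pn n)] from [ee_pn], it becomes a first-order
    recursion. *)
Let pn_eps n : (1 - a * b * c * d * q ^+ n) * pn n.+1 [::] =
  (1 - a * b * q ^+ n) * (1 - a * d * q ^+ n) * pn n [::].
Proof.
have /eqP := g_right (pn_ansatz n); rewrite -subr_eq0 ee_pn => /eqP e.
apply/eqP; rewrite -subr_eq0; apply/eqP.
transitivity (- (a * q ^+ n) * (dd (pn n) [::] +
  b * d * (c * pn n.+1 [::] + a * q ^+ n * pn n [::]) - (b + d) * pn n [::])).
  by rewrite pnS; ring.
by rewrite e mulr0.
Qed.

(** All words counted have length [i + size w], hence the range of the product of scalars. *)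
Let mom w i := (1 - q) ^+ i * words_wt al be ga de q (-1) i w /
  (2 ^+ i * I ^+ i * \prod_(j < i + size w) lam j).

Let I0 : I != 0.
Proof. by rewrite -sqrf_eq0 I2 oppr_eq0 oner_neq0. Qed.

Let mom0 w : mom w 0 = f w.
Proof. by rewrite /mom /f /= !expr0 !mul1r. Qed.

(** This is [2 x = dd + ee]: the two terms [-1] cancel, and the sign between D and E comes from
    [y = -1] together with [I^-1 = - I]. *)
Let momS w i : 2 * mom w i.+1 = I * (1 - q) * (mom (true :: w) i - mom (false :: w) i).
Proof.
rewrite /mom /= addnS addSn; have h := prod_lam_neq0 (i + size w).+1.
move: h; set P := \prod_(_ < _) _ => h.
have := I2; rewrite !exprS; move: (2 ^+ i) (expf_neq0 i two) => t t0.
move: (I ^+ i) (expf_neq0 i I0) => s s0.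
rewrite expr0 mulr1 => II.
transitivity (((1 - q) * (1 - q) ^+ i *
  (words_wt al be ga de q (-1) i (false :: w) - words_wt al be ga de q (-1) i (true :: w)))
   / (t * (I * s) * P)).
  by field; rewrite I0 s0 t0 two h.
have IV : I^-1 = - I by apply: (mulfI I0); rewrite divff // mulrN II opprK.
have -> : t * (I * s) * P = I * (t * s * P) by ring.
rewrite [(I * _)^-1]invfM IV.
by field; rewrite s0 t0 h.
Qed.

Let act p w := moment_functional (mom w) p.

(** By [ee_pn], the operator [1 + a^2 q^2n - a q^n (dd + ee)] sends [pn n] to
    [(1 - a c q^n) pn n.+1]. *)
Let act_basis n w : act (aw_basis a q n) w = (\prod_(j < n) (1 - a * c * q ^+ j)) * pn n w.
Proof.
elim: n w => [|n IH] w.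
  rewrite /act /aw_basis !big_ord0 mul1r /moment_functional size_poly1 big_ord1.
  by rewrite coef1 mul1r mom0.
rewrite /aw_basis !big_ord_recr /= [_ * (_ - _)]mulrC -/(aw_basis a q n).
rewrite /act moment_functionalM -/(act _ _) IH.
have -> : 2 * a * q ^+ n * moment_functional (fun i => mom w i.+1) (aw_basis a q n) =
  a * q ^+ n * (I * (1 - q)) * (act (aw_basis a q n) (true :: w) - act (aw_basis a q n) (false :: w)).
  rewrite /act /moment_functional -sumrB -!mulrA !mulr_sumr; apply: eq_bigr => i _.
  transitivity (a * (q ^+ n * ((aw_basis a q n)`_i * (2 * mom w i.+1)))); first by ring.
  by rewrite momS; ring.
rewrite !IH; set P := \prod_(_ < _) _.
have -> : a * q ^+ n * (I * (1 - q)) * (P * pn n (true :: w) - P * pn n (false :: w)) =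
   a * q ^+ n * P * (dd (pn n) w + ee (pn n) w) by rewrite /dd /ee; ring.
rewrite ee_pn -[1 * pn n w + _]/(pn n.+1 w) pnS -addnn exprD.
by ring.
Qed.

Lemma words_moment_basis n :
  moment_functional (fun i => (1 - q) ^+ i / (2 ^+ i * I ^+ i * \prod_(j < i) lam j) *
      words_wt al be ga de q (-1) i [::]) (aw_basis a q n)
    * \prod_(j < n) (1 - a * b * c * d * q ^+ j) =
  \prod_(j < n) ((1 - a * b * q ^+ j) * (1 - a * c * q ^+ j) * (1 - a * d * q ^+ j)).
Proof.
rewrite (_ : moment_functional _ _ = act (aw_basis a q n) [::]); last first.
  by apply: eq_bigr => i _; rewrite /mom addn0; congr (_ * _); rewrite mulrAC.
rewrite act_basis.
rewrite [RHS](_ : _ = (\prod_(j < n) (1 - a * c * q ^+ j)) *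
  \prod_(j < n) ((1 - a * b * q ^+ j) * (1 - a * d * q ^+ j))); last first.
  by rewrite -big_split; apply: eq_bigr => i _ /=; ring.
rewrite -[LHS]mulrA; congr (_ * _).
elim: n => [|n IH]; first by rewrite !big_ord0 /= /f /= big_ord0 divr1 mul1r.
have e := pn_eps n; move: e; set p1 := pn n.+1 [::] => e.
rewrite !big_ord_recr /= -IH.
transitivity ((\prod_(j < n) (1 - a * b * c * d * q ^+ j)) *
   ((1 - a * b * c * d * q ^+ n) * p1)); first by ring.
by rewrite e; ring.
Qed.

End AlgebraicMoments.

(** * From tableaux to words *)

Section Columns.
Variables (K : comNzRingType) (al be ga de q : K).

Definition label_wt (x : label) : K :=
  match x with Alpha => al | Beta => be | Gamma => ga | Delta => de end.

Definition free_row (l : option label) : bool := l \in [:: Some Alpha; Some Gamma].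

Definition cell_wt (s l c : option label) : K :=
  if c is Some x then label_wt x else
  if (l == Some Delta) || free_row l && (s \in [:: Some Beta; Some Gamma])
  then q else 1.

Definition next_below (s c : option label) := if c is Some _ then c else s.

(* A column is read from bottom to top; [l] lists the leftmost labels of the
   rows to its right, and [s] is the nearest label below. *)
Fixpoint column_ok s (l c : seq (option label)) : bool :=
  match l, c with
  | l0 :: l', c0 :: c' =>
      [&& (c0 != None) ==> free_row l0 && ~~ free_row s &
          column_ok (next_below s c0) l' c']
  | _, _ => true
  end.

Fixpoint column_wt s (l c : seq (option label)) : K :=
  match l, c with
  | l0 :: l', c0 :: c' => cell_wt s l0 c0 * column_wt (next_below s c0) l' c'
  | _, _ => 1
  end.

Fixpoint new_rows (l c : seq (option label)) : seq (option label) :=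
  match l, c with
  | l0 :: l', c0 :: c' => next_below l0 c0 :: new_rows l' c'
  | _, _ => [::]
  end.

(** Nested sums let a column be summed box by box; [sum_ffun_seq] returns to sums over functions. *)
Fixpoint seq_sum (A : finType) n (G : seq A -> K) : K :=
  if n is n'.+1 then \sum_a seq_sum n' (fun s => G (a :: s)) else G [::].

Lemma eq_seq_sum (A : finType) n (G G2 : seq A -> K) : G =1 G2 ->
  seq_sum n G = seq_sum n G2.
Proof.
elim: n G G2 => [|n IH] G G2 e /=; first exact: e.
by apply: eq_bigr => a _; apply: IH => s; exact: e.
Qed.

Lemma seq_sumZ (A : finType) n x (G : seq A -> K) :
  seq_sum n (fun s => x * G s) = x * seq_sum n G.
Proof.
elim: n G => [|n IH] G //=; rewrite mulr_sumr; apply: eq_bigr => a _.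
exact: (IH (fun s => G (a :: s))).
Qed.

Lemma seq_sum0 (A : finType) n : seq_sum n (fun _ : seq A => 0) = 0.
Proof. by rewrite (@eq_seq_sum A n _ (fun s => 0 * 1)) => [|s]; rewrite ?seq_sumZ mul0r. Qed.

Lemma big_ffun_cons (A : finType) n (G : {ffun 'I_n.+1 -> A} -> K) :
  \sum_f G f = \sum_a \sum_(f : {ffun 'I_n -> A})
     G [ffun i => oapp f a (unlift ord0 i)].
Proof.
rewrite pair_big /= (reindex (fun p : A * {ffun 'I_n -> A} =>
  [ffun i => oapp p.2 p.1 (unlift ord0 i)])) //=.
exists (fun f : {ffun 'I_n.+1 -> A} => (f ord0, [ffun i => f (lift ord0 i)])).
  move=> [a f] _ /=; rewrite ffunE unlift_none /=; congr (_, _).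
  by apply/ffunP => i; rewrite !ffunE liftK.
move=> f _; apply/ffunP => i; rewrite ffunE /=.
by case: unliftP => [j ->|->] /=; rewrite ?ffunE.
Qed.

Lemma sum_ffun_seq (A : finType) n (G : seq A -> K) :
  \sum_(f : {ffun 'I_n -> A}) G [seq f i | i <- enum 'I_n] = seq_sum n G.
Proof.
elim: n G => [|n IH] G /=.
  rewrite (eq_bigr (fun=> G [::])) => [|f _].
    by rewrite sumr_const card_ffun card_ord expn0.
  by rewrite (size0nil (size_enum_ord 0)).
rewrite big_ffun_cons; apply: eq_bigr => a _; rewrite -IH.
apply: eq_bigr => f _; congr (G _).
rewrite enum_ordSl /= ffunE unlift_none /= -map_comp; congr (_ :: _).
by apply: eq_map => i /=; rewrite ffunE liftK.
Qed.

Lemma big_olabel (G : option label -> K) :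
  \sum_c G c = G None + (G (Some Alpha) + G (Some Beta) + G (Some Gamma) + G (Some Delta)).
Proof.
rewrite (bigD1 None) //=; congr (_ + _).
rewrite (bigD1 (Some Alpha)) //= (bigD1 (Some Beta)) //= (bigD1 (Some Gamma)) //=.
rewrite (bigD1 (Some Delta)) //= big1 ?addr0 ?addrA // => -[[]|] //.
Qed.

(** The part of a column above a beta (first component) or a delta (second one), meeting [k] free
    rows. In the lowest of them the box stays empty, with weight [q] above beta and 1 above delta,
    or it gets a label. Alpha and gamma empty the rest of the column, which then weighs 1 or
    [q ^+ k']; beta and delta make the row no longer free. *)
Fixpoint col_above (v : K) (phi : nat -> K) k : K * K :=
  if k is k'.+1 then
    let x := col_above v (shift_seq phi) k' in
    let y := col_above v phi k' in
    let s := (al + ga * q ^+ k') * phi k'.+1 + be * y.1 + de * v * y.2 in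
    (q * x.1 + s, x.2 + s)
  else (phi 0%N, phi 0%N).

(** Alpha or gamma on the diagonal empties the column above it; beta or delta leaves the sums of
    [col_above]. *)
Lemma col_opsE v phi k :
  opD al be ga de q v phi k = al * phi k.+1 + de * v * (col_above v phi k).2 /\
  opE al be ga de q v phi k = ga * q ^+ k * phi k.+1 + be * (col_above v phi k).1.
Proof.
elim: k phi => [|k IH] phi; first by rewrite opD0 opE0 /= expr0 mulr1.
rewrite opDS opES /=; have [-> ->] := IH phi.
have [-> ->] := IH (shift_seq phi); rewrite /shift_seq exprS.
by split; ring.
Qed.

Definition column_sum v (phi : nat -> K) s l :=
  seq_sum (size l) (fun c => (column_ok s l c)%:R * column_wt s l c *
    v ^+ count_mem (Some Delta) (new_rows l c) * phi (count free_row (new_rows l c))).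

(** Rows that start with beta or delta stay empty in the new column. A beta row contributes 1, a
    delta row [q] for its new box and [v] for the columns still to come, hence the power of [q * v];
    otherwise only the number of free rows matters. *)
Lemma column_sumE v phi s l : all (fun x => x != None) l ->
  let k := count free_row l in
  column_sum v phi (Some s) l = (q * v) ^+ count_mem (Some Delta) l *
  match s with
  | Alpha => phi k
  | Gamma => q ^+ k * phi k
  | Beta => (col_above v phi k).1
  | Delta => (col_above v phi k).2
  end.
Proof.
elim: l phi s => [|l0 l IH] phi s //=.
  by rewrite /column_sum /= !expr0; case: s; rewrite /= ?expr0 !mul1r.
case/andP => l0N /IH {}IH; rewrite /column_sum /= big_olabel /=.
have red c0 : seq_sum (size l) (fun c =>
   ((((c0 != None) ==> free_row l0 && ~~ free_row (Some s)) &&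
     column_ok (next_below (Some s) c0) l c)%:R *
    (cell_wt (Some s) l0 c0 * column_wt (next_below (Some s) c0) l c) *
    v ^+ ((next_below l0 c0 == Some Delta) +
       count_mem (Some Delta) (new_rows l c))%N *
    phi (free_row (next_below l0 c0) + count free_row (new_rows l c))%N)) =
   ((c0 != None) ==> free_row l0 && ~~ free_row (Some s))%:R * cell_wt (Some s) l0 c0 *
   v ^+ (next_below l0 c0 == Some Delta) *
   column_sum v (fun k => phi (free_row (next_below l0 c0) + k)%N) (next_below (Some s) c0) l.
  rewrite /column_sum -seq_sumZ; apply: eq_seq_sum => c.
  by rewrite exprD -mulnb natrM; ring.
rewrite (red None) (red (Some Alpha)) (red (Some Beta)) (red (Some Gamma)) (red (Some Delta)).
rewrite /= !IH; set m := count_mem _ l; set k := count _ l.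
case: l0 l0N red => [[]|] // _ _; rewrite /cell_wt /free_row /= ?inE /=;
  case: s; rewrite /= ?add0n ?add1n ?exprS ?expr0 ?mul1r ?mulr1; try ring.
Qed.

(** The bottom row is new and has nothing to the right of its diagonal box. The fictitious
    [Some Alpha] there makes the row free, and it is always overwritten because the diagonal box is
    not empty. *)
Lemma new_column_sum v phi l y : all (fun x => x != None) l ->
  let k := count free_row l in
  seq_sum (size l).+1 (fun c => if c is c0 :: _ then
    ((c0 != None) && column_ok None (Some Alpha :: l) c)%:R *
    column_wt None (Some Alpha :: l) c *
    y ^+ (c0 \in [:: Some Alpha; Some Delta]) *
    v ^+ count_mem (Some Delta) (new_rows (Some Alpha :: l) c) *
    phi (count free_row (new_rows (Some Alpha :: l) c)) else 0) =
  (q * v) ^+ count_mem (Some Delta) l *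
  (y * opD al be ga de q v phi k + opE al be ga de q v phi k).
Proof.
move=> lN k /=; rewrite big_olabel /=.
rewrite (@eq_seq_sum _ _ _ (fun=> 0)) => [|c]; last by rewrite !mul0r.
rewrite seq_sum0 add0r.
have red x : seq_sum (size l) (fun c =>
   (column_ok (Some x) l c)%:R *
    (cell_wt None (Some Alpha) (Some x) * column_wt (Some x) l c) *
    y ^+ (Some x \in [:: Some Alpha; Some Delta]) *
    v ^+ ((Some x == Some Delta) + count_mem (Some Delta) (new_rows l c))%N *
    phi (free_row (Some x) + count free_row (new_rows l c))%N) =
   label_wt x * y ^+ (Some x \in [:: Some Alpha; Some Delta]) * v ^+ (Some x == Some Delta) *
   column_sum v (fun k => phi (free_row (Some x) + k)%N) (Some x) l.
  rewrite /column_sum -seq_sumZ; apply: eq_seq_sum => c.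
  by rewrite exprD /cell_wt; ring.
rewrite (red Alpha) (red Beta) (red Gamma) (red Delta) !column_sumE //.
have [-> ->] := col_opsE v phi k.
rewrite /free_row /= ?inE /= -/k ?add0n ?add1n ?expr0 ?expr1.
by ring.
Qed.

End Columns.

(** * Adding a first column to a tableau *)

Local Notation column n := {ffun 'I_n -> option label}.

Section FirstColumn.
Variable n : nat.

Lemma column_box_subproof (j : 'I_n.+1) : (rev_ord j + (ord0 : 'I_n.+1) < n.+1)%N.
Proof. by rewrite addn0. Qed.

(* The boxes of the first column are numbered from bottom to top. *)
Definition column_box (j : 'I_n.+1) : box n.+1 :=
  exist (fun c : 'I_n.+1 * 'I_n.+1 => (c.1 + c.2 < n.+1)%N) (rev_ord j, ord0)
    (column_box_subproof j).

Lemma shift_box_subproof (b : box n) :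
  (widen_ord (leqnSn n) (sval b).1 + lift ord0 (sval b).2 < n.+1)%N.
Proof. by case: b => -[i j] /= h; rewrite /bump /= add1n addnS ltnS. Qed.

Definition shift_box (b : box n) : box n.+1 :=
  exist (fun c : 'I_n.+1 * 'I_n.+1 => (c.1 + c.2 < n.+1)%N)
    (widen_ord (leqnSn n) (sval b).1, lift ord0 (sval b).2) (shift_box_subproof b).

Definition box_of_sum (u : 'I_n.+1 + box n) : box n.+1 :=
  match u with inl j => column_box j | inr b => shift_box b end.

Lemma box_of_sum_inj : injective box_of_sum.
Proof.
move=> [j|b] [j'|b'] /(congr1 sval) /= e.
- by congr inl; exact: rev_ord_inj (congr1 fst e).
- by have := congr1 (fun p => val p.2) e.
- by have := congr1 (fun p => val p.2) e.
- congr inr; have e1 := congr1 (fun p => val p.1) e; have /lift_inj e2 := congr1 snd e.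
  apply: val_inj; case: b b' e1 e2 {e} => -[i1 j1] h1 [[i2 j2] h2] /= e1 ->.
  by congr (_, _); exact: val_inj.
Qed.

Lemma box_of_sum_surj b : exists u, box_of_sum u == b.
Proof.
case: b => -[i j] /= h; case: (unliftP ord0 j) => [j' ej|ej].
  have hi : (i < n)%N by move: h; rewrite ej /= /bump /= add1n addnS ltnS; lia.
  have h' : (Ordinal hi + j' < n)%N by move: h; rewrite ej /= /bump /=; lia.
  exists (inr (exist (fun c : 'I_n * 'I_n => (c.1 + c.2 < n)%N) (Ordinal hi, j') h')).
  by apply/eqP/val_inj; rewrite /= ej; congr (_, _); exact: val_inj.
exists (inl (rev_ord i)); apply/eqP/val_inj; rewrite /= ej rev_ordK //.
Qed.

Definition sum_of_box b := xchoose (box_of_sum_surj b).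

Lemma sum_of_boxK : cancel sum_of_box box_of_sum.
Proof. by move=> b; apply/eqP; exact: (xchooseP (box_of_sum_surj b)). Qed.

Lemma box_of_sumK : cancel box_of_sum sum_of_box.
Proof. by move=> u; apply: box_of_sum_inj; rewrite sum_of_boxK. Qed.

Lemma big_box (R : Type) (idx : R) (op : Monoid.com_law idx) (P : pred (box n.+1)) F :
  \big[op/idx]_(b | P b) F b =
  op (\big[op/idx]_(j | P (column_box j)) F (column_box j))
     (\big[op/idx]_(b | P (shift_box b)) F (shift_box b)).
Proof.
rewrite (reindex box_of_sum); first by rewrite big_sumType.
by exists sum_of_box => u _; rewrite ?sum_of_boxK ?box_of_sumK.
Qed.

Lemma forall_box (P : box n.+1 -> Prop) :
  (forall b, P b) <-> (forall j, P (column_box j)) /\ (forall b, P (shift_box b)).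
Proof.
split=> [h|[h1 h2] b]; first by split.
by rewrite -(sum_of_boxK b); case: (sum_of_box b).
Qed.

Lemma exists_box (P : box n.+1 -> Prop) :
  (exists b, P b) <-> (exists j, P (column_box j)) \/ (exists b, P (shift_box b)).
Proof.
split=> [[b]|[[j h]|[b h]]]; [|by exists (column_box j)|by exists (shift_box b)].
rewrite -(sum_of_boxK b); case: (sum_of_box b) => [j|b'] h; first by left; exists j.
by right; exists b'.
Qed.

Definition add_column (c : column n.+1) (T : filling n) :
    filling n.+1 :=
  [ffun b => match sum_of_box b with inl j => c j | inr b' => T b' end].

Lemma add_column_column c T j : add_column c T (column_box j) = c j.
Proof. by rewrite ffunE -[column_box j]/(box_of_sum (inl j)) box_of_sumK. Qed.

Lemma add_column_shift c T b : add_column c T (shift_box b) = T b.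
Proof. by rewrite ffunE -[shift_box b]/(box_of_sum (inr b)) box_of_sumK. Qed.

Lemma sum_fillings (K : nmodType) (G : filling n.+1 -> K) :
  \sum_T G T = \sum_(T : filling n) \sum_c G (add_column c T).
Proof.
rewrite pair_big /= (reindex (fun p : filling n * _ => add_column p.2 p.1)) //=.
exists (fun T : filling n.+1 => ([ffun b => T (shift_box b)], [ffun j => T (column_box j)])).
  by move=> [T c] _ /=; congr (_, _); apply/ffunP => i;
    rewrite ffunE ?add_column_shift ?add_column_column.
move=> T _; apply/ffunP => b; rewrite -(sum_of_boxK b).
by case: (sum_of_box b) => u /=; rewrite ?add_column_shift ?add_column_column ffunE.
Qed.

Lemma box_row_column j : box_row (column_box j) = (n - j)%N.
Proof. by rewrite /box_row /= subSS. Qed.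
Lemma box_col_column j : box_col (column_box j) = 0%N. Proof. by []. Qed.
Lemma box_row_shift b : box_row (shift_box b) = box_row b. Proof. by []. Qed.
Lemma box_col_shift b : box_col (shift_box b) = (box_col b).+1. Proof. by []. Qed.
Definition boxE := (box_row_column, box_col_column, box_row_shift, box_col_shift).

End FirstColumn.

Lemma box_bound n (b : box n) : (box_row b + box_col b < n)%N.
Proof. by case: b => -[i j]. Qed.

Definition leftmost n (T : filling n) i x := exists b, [/\ box_row b = i, T b = Some x &
  forall b', box_row b' = i -> (box_col b' < box_col b)%N -> T b' = None].

Definition leftmost_label n (T : filling n) i : option label :=
  [pick x | `[< leftmost T i x >]].

(** At [j = 0] the row is the new bottom one, where [T] has no box; then [leftmost T] is false and
    the formula remains right. *)
Lemma leftmost_add_column n (c : column n.+1) (T : filling n) (j : 'I_n.+1) x :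
  leftmost (add_column c T) (n - j)%N x <->
  if c j is Some y then x = y else leftmost T (n - j)%N x.
Proof.
have col0 (j' : 'I_n.+1) : (n - j')%N = (n - j)%N -> j' = j.
  by move=> e; apply: val_inj => /=; have := ltn_ord j; have := ltn_ord j'; lia.
split.
  rewrite /leftmost => /exists_box[[j']|[b]]; rewrite !boxE.
    by rewrite add_column_column => -[/col0 -> -> _].
  rewrite add_column_shift => -[eb Tb h]; case ec : (c j) => [y|].
    have := h (column_box j); rewrite !boxE add_column_column => /(_ erefl).
    by rewrite ltn0Sn ec => /(_ isT).
  exists b; split=> // b' eb' lb.
  by have := h (shift_box b'); rewrite !boxE add_column_shift => /(_ eb'); apply.
case ec : (c j) => [y|].
  move=> ->; exists (column_box j); rewrite boxE add_column_column; split=> //.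
move=> [b [eb Tb h]]; exists (shift_box b); rewrite boxE add_column_shift; split=> //.
apply/forall_box; split=> [j'|b']; rewrite !boxE.
  by rewrite add_column_column => /col0 ->.
by rewrite add_column_shift ltnS; exact: h.
Qed.

Lemma leftmost_uniq n (T : filling n) i x y : leftmost T i x -> leftmost T i y -> x = y.
Proof.
move=> [b [eb Tb hb]] [b' [eb' Tb' hb']].
case: (ltngtP (box_col b) (box_col b')) => [l|l|l].
- by rewrite hb' in Tb.
- by rewrite hb in Tb'.
have e : b = b'.
  apply: val_inj; move: eb eb' l; case: b {Tb hb} => -[i1 j1] /= h1.
  case: b' {Tb' hb'} => -[i2 j2] /= h2; rewrite /box_row /box_col /= => e1 e2 e3.
  by congr (_, _); apply: val_inj => //=; rewrite e1.
by move: Tb'; rewrite -e Tb => -[].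
Qed.

Lemma leftmost_labelP n (T : filling n) i x :
  leftmost_label T i = Some x <-> leftmost T i x.
Proof.
rewrite /leftmost_label; case: pickP => [y /asboolP hy|h].
  split=> [[<-] //|hx]; by rewrite (leftmost_uniq hx hy).
by split=> // hx; have := h x; move/asboolP: hx => ->.
Qed.

Lemma leftmost_label_add_column n (c : column n.+1) (T : filling n) (j : 'I_n.+1) :
  leftmost_label (add_column c T) (n - j)%N =
  next_below (leftmost_label T (n - j)%N) (c j).
Proof.
have P x := leftmost_add_column c T j x.
case ec : (c j) P => [y|] P /=; first by apply/leftmost_labelP/P.
case e : (leftmost_label (add_column c T) _) => [x|].
  by move/leftmost_labelP: e => /P /leftmost_labelP ->.
case e' : (leftmost_label T _) => [x|//].
by move/leftmost_labelP: e' => /P /leftmost_labelP; rewrite e.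
Qed.

(* The leftmost labels of the rows, from bottom to top. *)
Definition rows n (T : filling n) : seq (option label) :=
  mkseq (fun j => leftmost_label T (n.-1 - j)%N) n.

Lemma nth_rows n (T : filling n) x0 j : (j < n)%N ->
  nth x0 (rows T) j = leftmost_label T (n.-1 - j)%N.
Proof. by move=> h; rewrite nth_mkseq. Qed.

Definition column_seq n (c : column n) := [seq c i | i <- enum 'I_n].

Lemma size_column_seq n (c : column n) : size (column_seq c) = n.
Proof. by rewrite size_map size_enum_ord. Qed.

Lemma nth_column_seq n (c : column n) x0 (j : 'I_n) :
  nth x0 (column_seq c) j = c j.
Proof. by rewrite (nth_map j) ?size_enum_ord // nth_ord_enum. Qed.

Lemma size_new_rows l c : size l = size c -> size (new_rows l c) = size l.
Proof. by elim: l c => [|l0 l IH] [|c0 c] //= [/IH ->]. Qed.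

Lemma nth_new_rows l c j : size l = size c -> (j < size l)%N ->
  nth None (new_rows l c) j = next_below (nth None l j) (nth None c j).
Proof. by elim: l c j => [|l0 l IH] [|c0 c] [|j] //= [/IH]; exact. Qed.

Lemma nth_rowsS n (T : filling n) (j : 'I_n.+1) : j != ord0 ->
  nth None (Some Alpha :: rows T) j = leftmost_label T (n - j)%N.
Proof.
case: j => -[//|j] /= h _; rewrite nth_rows //; congr leftmost_label; lia.
Qed.

(** At position 0 the two sides see [None] and the fictitious [Some Alpha] on the right of the
    diagonal box; its label overrides both. *)
Lemma rows_add_column n (c : column n.+1) (T : filling n) : c ord0 != None ->
  rows (add_column c T) = new_rows (Some Alpha :: rows T) (column_seq c).
Proof.
move=> c0; have hs : size (Some Alpha :: rows T) = size (column_seq c).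
  by rewrite size_column_seq /= size_mkseq.
apply: (@eq_from_nth _ None); first by rewrite size_new_rows // size_mkseq /= size_mkseq.
move=> j; rewrite size_mkseq => hj; rewrite nth_rows // nth_new_rows //; last first.
  by rewrite hs size_column_seq.
rewrite -[j]/(nat_of_ord (Ordinal hj)) leftmost_label_add_column nth_column_seq.
have [e|/nth_rowsS -> //] := eqVneq (Ordinal hj) ord0.
by rewrite e; case: (c ord0) c0.
Qed.

Record staircase_axioms n (T : filling n) : Prop := StaircaseAxioms {
  diag_filled : forall b, on_diagonal b -> T b <> None;
  left_empty : forall b b', T b \in [:: Some Beta; Some Delta] -> left_of b' b -> T b' = None;
  above_empty : forall b b', T b \in [:: Some Alpha; Some Gamma] -> above b' b -> T b' = None }.

Lemma staircaseP n (T : filling n) : reflect (staircase_axioms T) (is_staircase_tableau T).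
Proof.
apply: (iffP and3P) => [[/forallP h1 /forallP h2 /forallP h3]|[h1 h2 h3]]; split.
- by move=> b hb; have /implyP /(_ hb) /eqP := h1 b.
- by move=> b b' h h'; have /forallP /(_ b') /implyP := h2 b; rewrite h h' => /(_ isT) /eqP.
- by move=> b b' h h'; have /forallP /(_ b') /implyP := h3 b; rewrite h h' => /(_ isT) /eqP.
- by apply/forallP => b; apply/implyP => hb; apply/eqP/h1.
- apply/forallP => b; apply/forallP => b'; apply/implyP => /andP[h h'].
  by apply/eqP; exact: h2 h h'.
- apply/forallP => b; apply/forallP => b'; apply/implyP => /andP[h h'].
  by apply/eqP; exact: h3 h h'.
Qed.

Lemma rows_filled n (T : filling n) i : staircase_axioms T -> (i < n)%N ->
  exists x, leftmost T i x.
Proof.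
move=> hT hi.
have hd : (Ordinal hi + rev_ord (Ordinal hi) < n)%N by rewrite /=; lia.
pose b0 : box n := exist _ (Ordinal hi, rev_ord (Ordinal hi)) hd.
have h0 : (box_row b0 == i) && (T b0 != None).
  rewrite /box_row /= eqxx /=; apply/eqP/(diag_filled hT).
  by rewrite /on_diagonal /box_row /box_col /=; lia.
pose P (b : box n) := (box_row b == i) && (T b != None).
case: (@arg_minnP _ b0 P (@box_col n) h0) => b /andP[/eqP eb Tb] hmin.
case e : (T b) Tb => [x|//] _; exists x, b; split=> // b' eb' lb.
apply/eqP/negPn/negP => Tb'; have := hmin b'.
by rewrite /P eb' eqxx Tb' => /(_ isT); rewrite leqNgt lb.
Qed.

Lemma leftmost_bd n (T : filling n) b : staircase_axioms T ->
  T b \in [:: Some Beta; Some Delta] -> leftmost_label T (box_row b) = T b.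
Proof.
move=> hT hb; case e : (T b) (hb) => [x|//] _; apply/leftmost_labelP.
exists b; split=> // b' eb' lb; apply: (left_empty hT hb).
by rewrite /left_of eb' eqxx.
Qed.

Lemma leftmost_in n (T : filling n) i x : leftmost_label T i = Some x ->
  exists2 b, box_row b = i & T b = Some x.
Proof. by move/leftmost_labelP => [b [? ? _]]; exists b. Qed.

Lemma free_rowN x : free_row (Some x) = (Some x \notin [:: Some Beta; Some Delta]).
Proof. by case: x. Qed.

(** The recursive test compares a label only with the nearest one below. This is enough: above alpha
    or gamma every box has to be empty, so that label remains the nearest. *)
Lemma column_okP s l (c : seq (option label)) : size l = size c -> column_ok s l c <->
  [/\ forall j, (j < size l)%N -> nth None c j <> None -> free_row (nth None l j),
      free_row s -> forall j, (j < size l)%N -> nth None c j = None &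
      forall i j, (i < j)%N -> (j < size l)%N -> free_row (nth None c i) -> nth None c j = None].
Proof.
elim: l s c => [|l0 l IH] s [|c0 c] //= [sl]; split.
  case/andP => h0 /(IH _ _ sl)[h1 h2 h3]; split.
  - by case=> [_|j] /=; [move/eqP => hc; move: h0; rewrite hc => /andP[]|exact: h1].
  - move=> fs; have c0N : c0 = None.
      by apply/eqP; move: h0; rewrite fs andbF implybF negbK.
    by case=> [_|j] //=; apply: h2; rewrite c0N.
  - move=> [|i] [|j] //= ij hj; last exact: h3.
    by move=> fc; apply: h2 => //; case: (c0) fc.
move=> [h1 h2 h3]; apply/andP; split.
  apply/implyP => hc; rewrite (h1 0%N) //=; last exact/eqP.
  by apply/negP => fs; move/eqP: hc; apply; exact: (h2 fs 0%N).
apply/IH => //; split.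
- by move=> j hj; exact: (h1 j.+1).
- move=> fs j hj; case e : c0 fs => [y|] /= fs; last exact: (h2 fs j.+1).
  by apply: (h3 0%N j.+1) => //=; rewrite e.
- by move=> i j ij hj; exact: (h3 i.+1 j.+1).
Qed.

(** Nothing lies to the left of the new column, so its labels constrain only each other. The old
    tableau constrains them only through leftmost labels, since a beta or delta is always leftmost
    in its row ([leftmost_bd]). *)
Lemma staircase_add_column n (c : column n.+1) (T : filling n) :
  is_staircase_tableau (add_column c T) =
  [&& is_staircase_tableau T, c ord0 != None &
      column_ok None (Some Alpha :: rows T) (column_seq c)].
Proof.
have hs : size (Some Alpha :: rows T) = size (column_seq c).
  by rewrite size_column_seq /= size_mkseq.
have ltj (j : 'I_n.+1) : (j < size (Some Alpha :: rows T))%N by rewrite /= size_mkseq.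
apply/staircaseP/and3P => [[h1 h2 h3]|[/staircaseP hT c0 /(column_okP _ hs)[k1 _ k3]]].
  have hT : staircase_axioms T.
    split=> [b hb|b b' hb lb|b b' hb lb].
    - have := h1 (shift_box b); rewrite add_column_shift; apply.
      by rewrite /on_diagonal !boxE addnS eqSS.
    - rewrite -(add_column_shift c T b'); apply: (h2 (shift_box b)).
        by rewrite add_column_shift.
      by rewrite /left_of !boxE ?ltnS ?eqSS.
    - rewrite -(add_column_shift c T b'); apply: (h3 (shift_box b)).
        by rewrite add_column_shift.
      by rewrite /above !boxE ?ltnS ?eqSS.
  split; first exact/staircaseP.
    apply/eqP; have := h1 (column_box ord0); rewrite add_column_column; apply.
    by rewrite /on_diagonal !boxE subn0 addn0.
  apply/(column_okP _ hs); split=> //.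
    move=> j; rewrite /= size_mkseq => hj; rewrite -[j]/(nat_of_ord (Ordinal hj)).
    rewrite nth_column_seq => cj.
    have [-> //|jN] := eqVneq (Ordinal hj) ord0.
    rewrite nth_rowsS //.
    have hr : (n - Ordinal hj < n)%N by move: jN; rewrite -val_eqE /=; lia.
    have [x /leftmost_labelP hx] := rows_filled hT hr.
    rewrite hx free_rowN; apply/negP => xb; apply: cj.
    have [b rb Tb] := leftmost_in hx.
    rewrite -(add_column_column c T); apply: (h2 (shift_box b)).
      by rewrite add_column_shift Tb.
    by rewrite /left_of !boxE rb eqxx.
  move=> i j ij; rewrite /= size_mkseq => hj.
  have hi : (i < n.+1)%N by exact: ltn_trans hj.
  rewrite -[ i ]/(nat_of_ord (Ordinal hi)) -[j]/(nat_of_ord (Ordinal hj)) !nth_column_seq => fc.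
  rewrite -(add_column_column c T (Ordinal hj)); apply: (h3 (column_box (Ordinal hi))).
    by rewrite add_column_column.
  by rewrite /above !boxE /=; move: (hi) (hj) ij; lia.
split.
- apply/forall_box; split=> [j|b]; rewrite ?add_column_shift ?add_column_column /on_diagonal !boxE.
    rewrite addn0 => /eqP e; have -> : j = ord0 by apply: val_inj => /=; have := ltn_ord j; lia.
    exact/eqP.
  by rewrite addnS eqSS; exact: (diag_filled hT).
- apply/forall_box; split=> [j|b]; apply/forall_box; split=> [j'|b'];
    rewrite ?add_column_shift ?add_column_column /left_of !boxE ?ltnn ?andbF //.
    move=> Tb /andP[/eqP rb _]; apply/eqP/negPn/negP => /eqP cj.
    have jN : j' != ord0 by apply/eqP => e; move: rb; rewrite e subn0; have := box_bound b; lia.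
    have := k1 j' (ltj _); rewrite nth_column_seq => /(_ cj).
    rewrite nth_rowsS // rb (leftmost_bd hT Tb).
    by case: (T b) Tb => // x; rewrite free_rowN => ->.
  by rewrite ltnS => Tb lb; exact: (left_empty hT Tb).
- apply/forall_box; split=> [j|b]; apply/forall_box; split=> [j'|b'];
    rewrite ?add_column_shift ?add_column_column /above !boxE // ?andbF //.
    move=> fc /andP[_ lj]; have := k3 j j'; rewrite !nth_column_seq; apply=> //.
    by have := ltn_ord j; have := ltn_ord j'; move: lj; lia.
  by move=> Tb lb; exact: (above_empty hT Tb).
Qed.

(** * The weight of a tableau, column by column *)

Section Weight.
Variables (K : comNzRingType) (al be ga de q : K).

Lemma sees_shift n (c : column n.+1) (T : filling n) (r : rel (box n)) (r' : rel (box n.+1)) b x :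
  (forall b b', r' (shift_box b) (shift_box b') = r b b') ->
  (forall b j, r' (shift_box b) (column_box j) = false) ->
  [exists c', [&& r' (shift_box b) c', add_column c T c' == Some x &
    [forall c'', r' (shift_box b) c'' && r' c'' c' ==> (add_column c T c'' == None)]]] =
  [exists c', [&& r b c', T c' == Some x &
    [forall c'', r b c'' && r c'' c' ==> (T c'' == None)]]].
Proof.
move=> hr h0; apply/existsP/existsP.
  move/exists_box => [[j]|[b']]; rewrite ?h0 // hr add_column_shift.
  move=> /and3P[h1 h2 /forallP h3]; exists b'; rewrite h1 h2 /=.
  by apply/forallP => b''; have := h3 (shift_box b''); rewrite add_column_shift !hr.
move=> [b' /and3P[h1 h2 /forallP h3]]; exists (shift_box b').
rewrite hr add_column_shift h1 h2 /=; apply/forallP/forall_box; split=> [j|b''].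
  by rewrite h0.
by have := h3 b''; rewrite add_column_shift !hr.
Qed.

Lemma sees_right_shift n (c : column n.+1) (T : filling n) b x :
  sees_right (add_column c T) (shift_box b) x = sees_right T b x.
Proof. by apply: sees_shift => [b1 b2|b1 j]; rewrite /left_of !boxE ?ltnS // ltn0 andbF. Qed.

Lemma sees_below_shift n (c : column n.+1) (T : filling n) b x :
  sees_below (add_column c T) (shift_box b) x = sees_below T b x.
Proof. by apply: sees_shift => [b1 b2|b1 j]; rewrite /above !boxE ?eqSS. Qed.

Lemma sees_right_column n (c : column n.+1) (T : filling n) j x :
  sees_right (add_column c T) (column_box j) x = (leftmost_label T (n - j)%N == Some x).
Proof.
apply/existsP/eqP.
  move/exists_box => [[j']|[b']]; rewrite ?add_column_shift ?add_column_column /left_of !boxE.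
    by rewrite ltn0 andbF.
  rewrite ltn0Sn andbT => /and3P[/eqP h1 /eqP h2 /forallP h3].
  apply/leftmost_labelP; exists b'; split=> // b'' e l.
  have := h3 (shift_box b''); rewrite add_column_shift !boxE -h1 e eqxx ltn0Sn ltnS l /=.
  by move=> /eqP.
move/leftmost_labelP => [b [e Tb h]]; exists (shift_box b).
rewrite add_column_shift /left_of !boxE e Tb !eqxx ltn0Sn /=.
apply/forallP/forall_box; split=> [j'|b']; rewrite ?add_column_shift ?add_column_column !boxE.
  by rewrite ltn0 andbF.
rewrite ltnS; apply/implyP => /andP[/andP[/eqP e1 _] /andP[_ l]].
by apply/eqP/h.
Qed.

Fixpoint nearest_below s (c : seq (option label)) j : option label :=
  match j, c with
  | j'.+1, c0 :: c' => nearest_below (next_below s c0) c' j'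
  | _, _ => s
  end.

Lemma nearest_belowP c j x : (j <= size c)%N ->
  nearest_below None c j = Some x <->
  exists i, [/\ (i < j)%N, nth None c i = Some x &
    forall k, (i < k)%N -> (k < j)%N -> nth None c k = None].
Proof.
move=> hj.
suff H s : nearest_below s c j = Some x <->
    (exists i, [/\ (i < j)%N, nth None c i = Some x &
    forall k, (i < k)%N -> (k < j)%N -> nth None c k = None]) \/
    (s = Some x /\ forall k, (k < j)%N -> nth None c k = None).
  by rewrite H; split; [case=> // -[]|left].
elim: j c hj s => [|j IH] [|c0 c] //= hj s.
- by split=> [->|[[i []]|[]]] //; right.
- by split=> [->|[[i []]|[]]] //; right.
rewrite (IH c) //; split.
  case=> [[i [h1 h2 h3]]|[h1 h2]].
    by left; exists i.+1; split=> // -[|k] //=; rewrite !ltnS; exact: h3.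
  case: c0 h1 => [y|] /= h1.
    by left; exists 0%N; split=> // -[|k] //= _; rewrite ltnS; exact: h2.
  by right; split=> // -[|k] //=; rewrite ltnS; exact: h2.
case=> [[[|i] [h1 h2 h3]]|[h1 h2]].
- right; rewrite /= in h2; rewrite h2; split=> // k hk.
  exact: (h3 k.+1).
- by left; exists i; split=> // k h h'; exact: (h3 k.+1).
- right; rewrite h1; have := h2 0%N isT; rewrite /= => ->; split=> // k hk.
  exact: (h2 k.+1).
Qed.

Lemma sees_below_column n (c : column n.+1) (T : filling n) (j : 'I_n.+1) x :
  sees_below (add_column c T) (column_box j) x =
  (nearest_below None (column_seq c) j == Some x).
Proof.
have hj : (j <= size (column_seq c))%N by rewrite size_column_seq ltnW.
apply/existsP/eqP.
  move/exists_box => [[j']|[b']]; rewrite ?add_column_shift ?add_column_column /above !boxE //.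
  move=> /and3P[h1 /eqP h2 /forallP h3].
  have lj : (j' < j)%N by move: h1; have := ltn_ord j; have := ltn_ord j'; lia.
  apply/nearest_belowP => //; exists j'; rewrite nth_column_seq; split=> // k h h'.
  have hk : (k < n.+1)%N by apply: ltn_trans h' _.
  have := h3 (column_box (Ordinal hk)).
  rewrite add_column_column !boxE /= -[k]/(nat_of_ord (Ordinal hk)) nth_column_seq.
  move/implyP => H; apply/eqP/H; rewrite /= !ltn_sub2l //; have := ltn_ord j; lia.
move/(nearest_belowP _ hj) => [i [h1 h2 h3]].
have hi : (i < n.+1)%N by apply: ltn_trans h1 _.
exists (column_box (Ordinal hi)); rewrite add_column_column.
rewrite -[ i ]/(nat_of_ord (Ordinal hi)) nth_column_seq in h2.
rewrite h2 /above !boxE !eqxx /=; apply/andP; split; first by move: h1; have := ltn_ord j; lia.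
apply/forallP/forall_box; split=> [k|b]; rewrite ?add_column_shift ?add_column_column !boxE //.
apply/implyP => /andP[/andP[_ l1] /andP[_ l2]]; rewrite -(nth_column_seq c None k).
by apply/eqP/h3; move: l1 l2; have := ltn_ord k; have := ltn_ord j; lia.
Qed.

Lemma column_wtE s l c : size l = size c -> column_wt al be ga de q s l c =
  \prod_(j < size l) cell_wt al be ga de q (nearest_below s c j) (nth None l j) (nth None c j).
Proof.
elim: l s c => [|l0 l IH] s [|c0 c] //=; first by rewrite big_ord0.
case=> sl.
by rewrite big_ord_recl /= IH.
Qed.

Lemma tableau_weight_add_column n (c : column n.+1) (T : filling n) : c ord0 != None ->
  tableau_weight (add_column c T) al be ga de q =
  column_wt al be ga de q None (Some Alpha :: rows T) (column_seq c) *
  tableau_weight T al be ga de q.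
Proof.
move=> c0; rewrite /tableau_weight big_box; congr (_ * _); last first.
  apply: eq_bigr => b _; rewrite add_column_shift /assigned_q.
  by rewrite !sees_right_shift !sees_below_shift.
rewrite column_wtE; last by rewrite size_column_seq /= size_mkseq.
rewrite [size _]/= size_mkseq; apply: eq_bigr => j _.
rewrite add_column_column nth_column_seq /assigned_q.
rewrite !sees_right_column !sees_below_column.
have [->|jN] := eqVneq j ord0; first by case: (c ord0) c0 => [[]|].
rewrite nth_rowsS //; case: (c j) => [[]|] //=.
by rewrite /free_row !inE.
Qed.

Lemma num_bullets_add_column n (c : column n.+1) (T : filling n) :
  num_bullets (add_column c T) =
  ((c ord0 \in [:: Some Alpha; Some Delta]) + num_bullets T)%N.
Proof.
rewrite /num_bullets -!sum1dep_card [LHS]big_box; congr (_ + _)%N; last first.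
  by apply: eq_bigl => b; rewrite add_column_shift /on_diagonal !boxE addnS eqSS.
rewrite big_mkcond (bigD1 ord0) //= add_column_column /on_diagonal !boxE subn0 addn0 eqxx.
rewrite big1 ?addn0 /=; last first.
  move=> j jN; rewrite !boxE addn0 eqSS.
  rewrite (_ : (_ == n) = false) //; move: jN; rewrite -val_eqE /=.
  by have := ltn_ord j; lia.
by case: ifP.
Qed.

Local Notation DD := (opD al be ga de q).
Local Notation EE := (opE al be ga de q).
Local Notation ww := (word_wt al be ga de q).
Local Notation WW := (words_wt al be ga de q).
Local Notation wt T := (tableau_weight T al be ga de q).

(** The letters of [w] are columns already split off on the left. A row of [T] starting with delta
    has [size w] boxes there, all empty and of weight [q], which explains the power of
    [q ^+ size w]. With [w] arbitrary, the induction can move the first column of [T] to the head of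
    [w]. *)
Lemma sum_tableaux n y w :
  \sum_(T : filling n | is_staircase_tableau T)
    wt T * y ^+ num_bullets T *
    (q ^+ size w) ^+ count_mem (Some Delta) (rows T) *
    ww w (count free_row (rows T)) =
  WW y n w.
Proof.
elim: n w => [|n IH] w.
  (* Without boxes the three conditions are void, so the unique filling of size 0 is a tableau. *)
  have noT (T : filling 0) : is_staircase_tableau T by apply/staircaseP; split=> b; have := box_bound b.
  have nobox (b : box 0) : False by have := box_bound b.
  rewrite (eq_bigr (fun=> ww w 0)) => [|T _].
    rewrite (eq_bigl predT) // sumr_const card_ffun.
    have -> : #|{: box 0}| = 0%N by apply: eq_card0 => b; case: (nobox b).
    by rewrite expn0.
  rewrite /tableau_weight big1 => [|b]; last by case: (nobox b).
  have -> : num_bullets T = 0%N by apply: eq_card0 => b; case: (nobox b).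
  by rewrite /rows /= !expr0 !mulr1 mul1r.
rewrite big_mkcond sum_fillings.
rewrite -[RHS]/(y * WW y n (true :: w) + WW y n (false :: w)).
rewrite -!IH mulr_sumr -big_split [RHS]big_mkcond.
apply: eq_bigr => T _; cbv beta; case: ifP => sT; last first.
  by apply: big1 => c _; rewrite staircase_add_column sT.
have rN : all (fun x => x != None) (rows T).
  apply/(all_nthP None) => j; rewrite size_mkseq => hj; rewrite nth_rows //.
  have /(rows_filled (staircaseP _ sT)) [x /leftmost_labelP -> //] : (n.-1 - j < n)%N by lia.
have sz : size (rows T) = n by rewrite size_mkseq.
have E := new_column_sum al be ga de q (q ^+ size w) (ww w) y rN.
rewrite sz -[seq_sum _ _](@sum_ffun_seq K (option label) n.+1) in E.
have wD k : ww (true :: w) k =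
  DD (q ^+ size w) (ww w) k by [].
have wE k : ww (false :: w) k =
  EE (q ^+ size w) (ww w) k by [].
transitivity (wt T * y ^+ num_bullets T *
  ((q * q ^+ size w) ^+ count_mem (Some Delta) (rows T) *
   (y * DD (q ^+ size w) (ww w) (count free_row (rows T)) +
   EE (q ^+ size w) (ww w) (count free_row (rows T))))); last first.
  rewrite wD wE [size (true :: w)]/= [size (false :: w)]/= exprS.
  move: (DD _ _ _) (EE _ _ _) (_ ^+ count_mem _ _) (wt T) (y ^+ _) => x1 x2 x3 x4 x5.
  by rewrite /=; ring.
rewrite -E mulr_sumr; apply: eq_bigr => c _.
rewrite staircase_add_column sT.
have ec : [seq c i | i <- enum 'I_n.+1] = c ord0 :: behead (column_seq c).
  by rewrite /column_seq enum_ordSl.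
(* Exposing the head reduces the match inside the column sum; the sequence is then folded back. *)
rewrite ec -ec -/(column_seq c).
have [c0|c0] := eqVneq (c ord0) None; first by rewrite !mul0r mulr0.
rewrite andTb; case: ifP => ok; last by rewrite !mul0r mulr0.
rewrite tableau_weight_add_column // num_bullets_add_column rows_add_column // exprD.
set x1 := column_wt _ _ _ _ _ _ _ _; set x2 := wt T.
set x3 := _ ^+ count_mem _ _; set x4 := ww _ _.
set x5 := y ^+ _; set x6 := y ^+ _.
by rewrite mul1r; ring.
Qed.

Theorem tableaux_words n y :
  Z n y al be ga de q = WW y n [::].
Proof.
by rewrite -sum_tableaux /Z; apply: eq_bigr => T _; rewrite expr0 expr1n !mulr1.
Qed.

End Weight.

(** * Convergence of complex sequences *)

Section ComplexNorm.
Variable R : realType.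
Local Notation C := (Cplx R).
Implicit Types (z w : C) (u v : nat -> C).

(** The norm of [Cplx R] is itself a complex number; estimates are made in the totally ordered field
    [R]. *)
Definition cn z : R := complex.Re `|z|.

Lemma cnE z : `|z| = (cn z)%:C%C.
Proof. by rewrite /cn RRe_real // normr_real. Qed.

Lemma cn_ge0 z : 0 <= cn z.
Proof. by rewrite -lecR -cnE normr_ge0. Qed.

Lemma cnM z w : cn (z * w) = cn z * cn w.
Proof. by apply: complexI; rewrite rmorphM /= -!cnE normrM. Qed.

Lemma cnD z w : cn (z + w) <= cn z + cn w.
Proof. by rewrite -lecR rmorphD /= -!cnE ler_normD. Qed.

Lemma cnN z : cn (- z) = cn z.
Proof. by rewrite /cn normrN. Qed.

Lemma cnB z w : cn (z - w) <= cn z + cn w.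
Proof. by rewrite -(cnN w) cnD. Qed.

Lemma cn_sub z w : cn (z - w) = cn (w - z).
Proof. by rewrite -cnN opprB. Qed.

Lemma cn0 : cn 0 = 0.
Proof. by rewrite /cn normr0. Qed.

Lemma cn1 : cn 1 = 1.
Proof. by rewrite /cn normr1. Qed.

Lemma cn_real (x : R) : cn (x%:C%C : C) = `|x|.
Proof. by apply: complexI; rewrite -cnE normc_def /= expr0n addr0 sqrtr_sqr. Qed.

Lemma cnX z n : cn (z ^+ n) = cn z ^+ n.
Proof. by apply: complexI; rewrite rmorphXn /= -!cnE normrX. Qed.

Lemma cn_eq0 z : (cn z == 0) = (z == 0).
Proof. by rewrite -[RHS]normr_eq0 cnE -[0 in RHS]/((0 : R)%:C%C) (inj_eq (@complexI _)). Qed.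

Lemma cn_gt0 z : (0 < cn z) = (z != 0).
Proof. by rewrite lt_neqAle cn_ge0 eq_sym cn_eq0 andbT. Qed.

Lemma cnV z : cn z^-1 = (cn z)^-1.
Proof.
have [->|z0] := eqVneq z 0; first by rewrite invr0 cn0 invr0.
have c0 : cn z != 0 by rewrite cn_eq0.
by apply: (mulfI c0); rewrite -cnM !divff // cn1.
Qed.

Lemma cn_prod (I : Type) (r : seq I) (P : pred I) (F : I -> C) :
  cn (\prod_(i <- r | P i) F i) = \prod_(i <- r | P i) cn (F i).
Proof. by apply: (big_morph cn) => [x y|]; rewrite ?cnM ?cn1. Qed.

Lemma cn_sum (I : Type) (r : seq I) (P : pred I) (F : I -> C) :
  cn (\sum_(i <- r | P i) F i) <= \sum_(i <- r | P i) cn (F i).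
Proof.
elim/big_rec2: _ => [|i x y _ h]; first by rewrite cn0.
by apply: le_trans (cnD _ _) _; rewrite lerD2l.
Qed.

Lemma cn_dist z w x : cn (z - w) <= cn (z - x) + cn (x - w).
Proof. by rewrite -[z - w](subrKA x) cnD. Qed.

Lemma ReB z w : complex.Re (z - w) = complex.Re z - complex.Re w.
Proof. by case: z; case: w. Qed.

Lemma ImB z w : complex.Im (z - w) = complex.Im z - complex.Im w.
Proof. by case: z; case: w. Qed.

Lemma Re_cn z : `|complex.Re z| <= cn z.
Proof. by rewrite -lecR -cnE; exact: normc_ge_Re. Qed.

Lemma cn_i : cn ('i%C : C) = 1.
Proof. by apply: complexI; rewrite -cnE normc_def /= expr0n expr1n add0r sqrtr1. Qed.

Lemma Im_cn z : `|complex.Im z| <= cn z.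
Proof.
have -> : cn z = cn (z * 'i%C) by rewrite cnM cn_i mulr1.
by rewrite -[complex.Im z]opprK -ReiNIm normrN Re_cn.
Qed.

Lemma cn_ReIm z : cn z <= `|complex.Re z| + `|complex.Im z|.
Proof.
rewrite {1}[z]complexE; apply: le_trans (cnD _ _) _.
by rewrite cnM !cn_real cn_i mul1r.
Qed.

Lemma cn_lt_real (z : C) (e : C) : 0 < e -> (`|z| < e) = (cn z < complex.Re e).
Proof.
move=> e0; have er : (complex.Re e)%:C%C = e by rewrite RRe_real // gtr0_real.
by rewrite cnE -{1}er ltcR.
Qed.

Lemma cvgC_P u (l : C) : u @ \oo --> l <->
  forall e : R, 0 < e -> exists N, forall n, (N <= n)%N -> cn (u n - l) < e.
Proof.
split=> [/cvgrPdist_lt h e e0|h].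
  have e0' : (0 : C) < e%:C%C by rewrite -[0]/((0 : R)%:C%C) ltcR.
  have [N _ hN] := h _ e0'; exists N => n /hN /=.
  by rewrite cn_lt_real //= cn_sub.
apply/cvgrPdist_lt => e e0.
have e0' : 0 < complex.Re e by rewrite -ltcR RRe_real // gtr0_real.
have [N hN] := h _ e0'; exists N => // n /= /hN.
by rewrite cn_lt_real //= cn_sub.
Qed.

Lemma cvgC_unique u (l l' : C) : u @ \oo --> l -> u @ \oo --> l' -> l = l'.
Proof. by move=> h h'; apply: cvg_unique h h'; exact: norm_hausdorff. Qed.

Lemma cvgC_lim u (l : C) : u @ \oo --> l -> limn u = l.
Proof. by move=> h; apply: (cvg_lim _ h); exact: norm_hausdorff. Qed.

Lemma cvgC_ext u v (l : C) : u =1 v -> u @ \oo --> l -> v @ \oo --> l.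
Proof. by move=> /funext ->. Qed.

Lemma cvgC_le u (l : C) (M : R) : u @ \oo --> l -> (forall n, cn (u n) <= M) -> cn l <= M.
Proof.
move=> /cvgC_P h hM; apply/ler_addgt0Pr => e /h[N /(_ _ (leqnn N)) hN].
have := cnD (u N) (l - u N); rewrite [u N + _]addrC subrK [cn (l - _)]cn_sub.
by move=> h'; apply: le_trans h' _; apply: lerD => //; exact: ltW.
Qed.

Lemma cvgC_ReIm u (x y : R) : (@complex.Re R \o u) @ \oo --> x -> (@complex.Im R \o u) @ \oo --> y ->
  u @ \oo --> ((x +i* y)%C : C).
Proof.
move=> /cvgrPdist_lt hx /cvgrPdist_lt hy; apply/cvgC_P => e e0.
have e2 : 0 < e / 2 by rewrite divr_gt0.
have [N _ hN] := hx _ e2; have [N' _ hN'] := hy _ e2; exists (maxn N N') => n.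
rewrite geq_max => /andP[/hN /= h /hN' /= h']; apply: le_lt_trans (cn_ReIm _) _.
rewrite [e]splitr; move: h h'; rewrite distrC => h; rewrite distrC => h'.
by case: (u n) h h' => a b /= h h'; exact: ltrD.
Qed.

Lemma real_increments_cvg (u : nat -> R) (A r : R) : 0 <= r -> r < 1 ->
  (forall n, `|u n.+1 - u n| <= A * r ^+ n) -> cvgn u.
Proof.
move=> r0 r1 h; pose v n := u n.+1 - u n.
have E n : u n = u 0%N + series v n by rewrite /series /= telescope_sumr // addrC subrK.
have -> : u = (fun=> u 0%N) + series v by apply/funext => n; rewrite {1}E.
apply: is_cvgD; first exact: is_cvg_cst.
apply: normed_cvg; apply: (@series_le_cvg _ _ (geometric A r)) => [n|n|n|].
- exact: normr_ge0.
- exact: le_trans (normr_ge0 _) (h n).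
- exact: h.
- by apply: is_cvg_geometric_series; rewrite ger0_norm.
Qed.

Lemma sum_geo_le (r : R) n : 0 <= r -> r < 1 -> \sum_(k < n) r ^+ k <= (1 - r)^-1.
Proof.
move=> r0 r1; rewrite -[leRHS]mul1r ler_pdivlMr ?subr_gt0 //.
have -> : (\sum_(i < n) r ^+ i) * (1 - r) = 1 - r ^+ n.
  by rewrite -opprB mulrN mulrC -subrX1 opprB.
by rewrite gerBl exprn_ge0.
Qed.

(** The explicit error term later makes the convergence of infinite products uniform in their
    arguments. *)
Lemma cvgn_increments u (A r : R) : 0 <= r -> r < 1 ->
  (forall n, cn (u n.+1 - u n) <= A * r ^+ n) ->
  u @ \oo --> limn u /\ forall n, cn (u n - limn u) <= A * r ^+ n / (1 - r).
Proof.
move=> r0 r1 h; have rn0 : 0 < 1 - r by rewrite subr_gt0.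
have A0 : 0 <= A by have := h 0%N; rewrite expr0 mulr1; apply: le_trans; exact: cn_ge0.
have /cvg_ex [x hx] : cvgn (@complex.Re R \o u).
  apply: (real_increments_cvg r0 r1) => n; apply: le_trans (h n).
  by rewrite /= -ReB Re_cn.
have /cvg_ex [y hy] : cvgn (@complex.Im R \o u).
  apply: (real_increments_cvg r0 r1) => n; apply: le_trans (h n).
  by rewrite /= -ImB Im_cn.
have hu := cvgC_ReIm hx hy; rewrite (cvgC_lim hu); split=> // n.
rewrite cn_sub; have hn : (fun k => u (k + n)%N - u n) @ \oo --> (((x +i* y)%C : C) - u n : C).
  apply: cvgB; last exact: cvg_cst.
  by rewrite (cvg_shiftn n u).
apply: (cvgC_le hn) => k.
have H m : cn (u (m + n)%N - u n) <= \sum_(j < m) A * r ^+ (j + n).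
  elim: m => [|m IH]; first by rewrite big_ord0 add0n subrr cn0.
  rewrite big_ord_recr /= addSn; apply: le_trans (cn_dist _ _ (u (m + n)%N)) _.
  by rewrite addrC; apply: lerD.
apply: le_trans (H k) _.
under eq_bigr => j _ do rewrite exprD mulrCA.
rewrite -mulr_suml mulrC; apply: ler_wpM2l.
  by rewrite mulr_ge0 ?exprn_ge0.
exact: sum_geo_le.
Qed.

End ComplexNorm.

(** * Infinite q-Pochhammer products, with bounds uniform in x and q *)

Section QPochhammer.
Variable R : realType.
Local Notation C := (Cplx R).
Implicit Types (x y z q : C) (r s : R).

Lemma qpoch0 x q : qpoch 0 x q = 1. Proof. by rewrite /qpoch big_ord0. Qed.

Lemma qpochSr n x q : qpoch n.+1 x q = qpoch n x q * (1 - x * q ^+ n).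
Proof. by rewrite /qpoch big_ord_recr. Qed.

Lemma qpochS n x q : qpoch n.+1 x q = (1 - x) * qpoch n (x * q) q.
Proof.
rewrite /qpoch big_ord_recl expr0 mulr1; congr (_ * _).
by apply: eq_bigr => i _; rewrite lift0 exprS mulrA.
Qed.

(** From [1 + s r^k <= exp (s r^k)] and the geometric series. *)
Definition qbound s r : R := expR (s / (1 - r)).

Lemma qpoch_bound n x q s r : cn x <= s -> cn q <= r -> r < 1 ->
  cn (qpoch n x q) <= qbound s r.
Proof.
move=> xs qr r1; have r0 : 0 <= r := le_trans (cn_ge0 q) qr.
have s0 : 0 <= s := le_trans (cn_ge0 x) xs.
apply: (@le_trans _ _ (\prod_(k < n) expR (s * r ^+ k))).
  rewrite /qpoch cn_prod; apply: ler_prod => k _; rewrite cn_ge0 /=.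
  apply: le_trans (cnB _ _) _; rewrite cn1 cnM cnX.
  apply: le_trans (expR_ge1Dx _); rewrite lerD2l; apply: ler_pM => //.
  - exact: cn_ge0.
  - by rewrite exprn_ge0 ?cn_ge0.
  - by apply: lerXn2r => //; rewrite nnegrE ?cn_ge0.
rewrite -expR_sum ler_expR -mulr_sumr ler_wpM2l //.
exact: sum_geo_le.
Qed.

(** For [0 <= t <= s < 1] one has [1 / (1 - t) = 1 + t / (1 - t) <= exp (t / (1 - s))]; the product
    over [t = s r^k] gives this constant. *)
Definition qbound_inv s r : R := expR (s / (1 - s) / (1 - r)).

Lemma qpoch_inv_bound n x q s r : cn x <= s -> s < 1 -> cn q <= r -> r < 1 ->
  cn (qpoch n x q)^-1 <= qbound_inv s r.
Proof.
move=> xs s1 qr r1; have r0 : 0 <= r := le_trans (cn_ge0 q) qr.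
have s0 : 0 <= s := le_trans (cn_ge0 x) xs.
have s1' : 0 < 1 - s by rewrite subr_gt0.
apply: (@le_trans _ _ (\prod_(k < n) expR (s / (1 - s) * r ^+ k))).
  rewrite cnV /qpoch cn_prod -prodfV; apply: ler_prod => k _.
  rewrite invr_ge0 cn_ge0 /=.
  have t0 : 0 <= s * r ^+ k by rewrite mulr_ge0 ?exprn_ge0.
  have t1 : s * r ^+ k <= s by rewrite ler_piMr // exprn_ile1 // ltW.
  have t1' : 0 < 1 - s * r ^+ k by lra.
  have lo : 1 - s * r ^+ k <= cn (1 - x * q ^+ k).
    have : cn (x * q ^+ k) <= s * r ^+ k.
      rewrite cnM cnX; apply: ler_pM => //; rewrite ?cn_ge0 ?exprn_ge0 ?cn_ge0 //.
      by apply: lerXn2r => //; rewrite nnegrE ?cn_ge0.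
    have := cnD (1 - x * q ^+ k) (x * q ^+ k); rewrite subrK cn1; lra.
  apply: (@le_trans _ _ (1 - s * r ^+ k)^-1).
    by rewrite lef_pV2 // posrE //; exact: lt_le_trans lo.
  apply: le_trans (expR_ge1Dx _); rewrite -(ler_pM2r t1') mulVf ?gt_eqF //.
  set t := s * r ^+ k in t0 t1 t1' *.
  have -> : s / (1 - s) * r ^+ k = t / (1 - s) by rewrite /t mulrAC.
  have : t / (1 - s) * (1 - t) >= t.
    rewrite mulrAC ler_pdivlMr //; apply: ler_wpM2l => //; lra.
  rewrite mulrDl; lra.
rewrite -expR_sum ler_expR -mulr_sumr ler_wpM2l //; last exact: sum_geo_le.
by rewrite divr_ge0 // ltW.
Qed.

Lemma qpoch_increment n x q s r : cn x <= s -> cn q <= r -> r < 1 ->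
  cn (qpoch n.+1 x q - qpoch n x q) <= qbound s r * s * r ^+ n.
Proof.
move=> xs qr r1; rewrite qpochSr mulrBr mulr1 addrC addrA addNr sub0r cnN !cnM -mulrA.
have r0 : 0 <= r := le_trans (cn_ge0 q) qr.
apply: ler_pM; rewrite ?mulr_ge0 ?cn_ge0 //; first exact: qpoch_bound.
apply: ler_pM; rewrite ?cn_ge0 // cnX.
by apply: lerXn2r => //; rewrite nnegrE ?cn_ge0.
Qed.

Lemma qpoch_cvg_err x q s r : cn x <= s -> cn q <= r -> r < 1 ->
  (fun n => qpoch n x q) @ \oo --> qpoch_inf x q /\
  forall n, cn (qpoch n x q - qpoch_inf x q) <= qbound s r * s * r ^+ n / (1 - r).
Proof.
move=> xs qr r1; apply: cvgn_increments => //.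
  exact: le_trans (cn_ge0 q) qr.
by move=> n; exact: qpoch_increment.
Qed.

Lemma qpoch_cvg x q : cn q < 1 -> (fun n => qpoch n x q) @ \oo --> qpoch_inf x q.
Proof. by move=> q1; have [] := @qpoch_cvg_err x q _ _ (lexx _) (lexx _) q1. Qed.
Arguments qpoch_cvg x {q}.

Lemma qpoch_infS x q : cn q < 1 -> qpoch_inf x q = (1 - x) * qpoch_inf (x * q) q.
Proof.
move=> q1; have h := qpoch_cvg x q1.
have h2 : (fun n => (1 - x) * qpoch n (x * q) q) @ \oo --> (1 - x) * qpoch_inf (x * q) q.
  by apply: cvgM; [exact: cvg_cst|exact: qpoch_cvg].
apply: cvgC_unique h2; have := h; rewrite -cvg_shiftS => h1.
by apply: cvgC_ext h1 => n; rewrite /= qpochS.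
Qed.

Lemma qpoch_inf0 q : cn q < 1 -> qpoch_inf 0 q = 1.
Proof.
move=> q1; apply: (cvgC_unique (qpoch_cvg 0 q1)).
apply: (@cvgC_ext _ (fun=> 1)); last exact: cvg_cst.
by move=> n; rewrite /qpoch big1 // => k _; rewrite mul0r subr0.
Qed.

Lemma one_sub_neq0 x : cn x < 1 -> 1 - x != 0.
Proof.
move=> x1; rewrite subr_eq0; apply/eqP => e.
by move: x1; rewrite -e cn1 ltxx.
Qed.

Lemma qpoch_neq0 n x q : cn x < 1 -> cn q < 1 -> qpoch n x q != 0.
Proof.
move=> x1 q1; apply/prodf_neq0 => k _; apply: one_sub_neq0.
rewrite cnM cnX; apply: le_lt_trans x1; rewrite ler_piMr ?cn_ge0 //.
by rewrite exprn_ile1 ?cn_ge0 // ltW.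
Qed.

(** The inverses of the partial products are bounded, so the partial products stay away from 0. *)
Lemma qpoch_inf_neq0 x q : cn x < 1 -> cn q < 1 -> qpoch_inf x q != 0.
Proof.
move=> x1 q1; apply/negP => /eqP e0.
pose B := qbound_inv (cn x) (cn q); have B0 : 0 < B by exact: expR_gt0.
have /cvgC_P /(_ B^-1) := qpoch_cvg x q1; rewrite invr_gt0 => /(_ B0) [N /(_ N (leqnn N))].
rewrite e0 subr0 => h.
have := @qpoch_inv_bound N x q _ _ (lexx _) x1 (lexx _) q1; rewrite -/B cnV.
rewrite -ler_pV2; last 2 first.
- by rewrite inE unitfE gt_eqF.
- rewrite inE unitfE invr_eq0 invr_gt0 cn_gt0 cn_eq0 qpoch_neq0 //.
by rewrite invrK leNgt h.
Qed.

Lemma qpoch_inf_inv_bound x q s r : cn x <= s -> s < 1 -> cn q <= r -> r < 1 ->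
  cn (qpoch_inf x q)^-1 <= qbound_inv s r.
Proof.
move=> xs s1 qr r1.
have x1 : cn x < 1 by exact: le_lt_trans s1.
have q1 : cn q < 1 by exact: le_lt_trans r1.
have h : (fun n => (qpoch n x q)^-1) @ \oo --> (qpoch_inf x q)^-1.
  by apply: cvgV; [exact: qpoch_inf_neq0|exact: qpoch_cvg].
by apply: (cvgC_le h) => n; exact: qpoch_inv_bound.
Qed.

Lemma qpoch_inf_bound x q s r : cn x <= s -> cn q <= r -> r < 1 ->
  cn (qpoch_inf x q) <= qbound s r.
Proof.
move=> xs qr r1; apply: (cvgC_le (qpoch_cvg x (le_lt_trans qr r1))) => n.
exact: qpoch_bound.
Qed.

End QPochhammer.

(** * Means over the unit circle *)

Section RealPeriodIntegral.
Variable R : realType.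
Implicit Types f g : R -> R.

Definition period_integral f : R := (\int[lebesgue_measure]_(x in `[0%R, (2 * pi)%R]) f x)%R.

Lemma period_gt0 : 0 < 2 * pi :> R.
Proof. by rewrite mulr_gt0 ?pi_gt0. Qed.

Lemma period_integrable f : continuous f ->
  lebesgue_measure.-integrable `[0, 2 * pi] (EFin \o f).
Proof.
move=> cf; apply: continuous_compact_integrable; first exact: segment_compact.
exact: continuous_subspaceT.
Qed.

Lemma period_integralD f g : continuous f -> continuous g ->
  period_integral (fun x => f x + g x) = period_integral f + period_integral g.
Proof. by move=> cf cg; apply: RintegralD => //; exact: period_integrable. Qed.

Lemma period_integralZ f a : continuous f ->
  period_integral (fun x => a * f x) = a * period_integral f.
Proof. by move=> cf; apply: RintegralZl => //; exact: period_integrable. Qed.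

Lemma period_integral_cst a : period_integral (fun=> a) = a * (2 * pi).
Proof.
rewrite /period_integral Rintegral_cst //; congr (_ * _).
by rewrite /= lebesgue_measure_itv /= lte_fin period_gt0 /= oppr0 addr0.
Qed.

Lemma period_integral_le f M : continuous f -> (forall x, `|f x| <= M) ->
  `|period_integral f| <= M * (2 * pi).
Proof.
move=> cf hM; rewrite -period_integral_cst.
have cn : continuous (fun x => `|f x|).
  by move=> x; apply: continuous_comp; [exact: cf|exact: norm_continuous].
apply: le_trans (le_normr_Rintegral _ _) _ => //; first exact: period_integrable.
apply: le_Rintegral => //; first exact: period_integrable.
by apply: period_integrable => x; exact: cvg_cst.
Qed.

Lemma period_integral_derive f F : continuous f -> continuous F ->
  (forall x : R, is_derive x (1 : R) F (f x)) -> F (2 * pi) = F 0 ->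
  period_integral f = 0.
Proof.
move=> cf cF dF e; rewrite /period_integral /Rintegral.
rewrite (@continuous_FTC2 _ f F 0 (2 * pi)) ?period_gt0 //.
- by rewrite e -EFinB subrr.
- exact: continuous_subspaceT.
- split=> [x _||].
  + exact: ex_derive.
  + by apply: cvg_at_right_filter; exact: cF.
  + by apply: cvg_at_left_filter; exact: cF.
- by move=> x _; rewrite derive1E derive_val.
Qed.

Lemma continuous_mulkx (k : R) : continuous (fun x : R => k * x).
Proof. by move=> x; apply: cvgM; [exact: cvg_cst|exact: cvg_id]. Qed.

Lemma sin_period k : sin (k.+1%:R * (2 * pi)) = 0 :> R.
Proof.
have := periodicn (@sinD2pi R) k.+1 0; rewrite add0r sin0.
by rewrite -[pi *+ 2]mulr_natl -[_ *+ k.+1]mulr_natl.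
Qed.

Lemma cos_period k : cos (k.+1%:R * (2 * pi)) = 1 :> R.
Proof.
have := periodicn (@cosD2pi R) k.+1 0; rewrite add0r cos0.
by rewrite -[pi *+ 2]mulr_natl -[_ *+ k.+1]mulr_natl.
Qed.

Lemma continuous_cosM (k : R) : continuous (fun x : R => cos (k * x)).
Proof.
by move=> x; apply: continuous_comp; [exact: continuous_mulkx|exact: continuous_cos].
Qed.

Lemma continuous_sinM (k : R) : continuous (fun x : R => sin (k * x)).
Proof.
by move=> x; apply: continuous_comp; [exact: continuous_mulkx|exact: continuous_sin].
Qed.

Lemma period_integral_cos k : period_integral (fun x => cos (k.+1%:R * x)) = 0.
Proof.
have k0 : k.+1%:R != 0 :> R by rewrite pnatr_eq0.
apply: (@period_integral_derive _ (fun x : R => k.+1%:R^-1 * sin (k.+1%:R * x))).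
- exact: continuous_cosM.
- by move=> x; apply: cvgM; [exact: cvg_cst|exact: continuous_sinM].
- move=> x; apply: is_derive_eq.
  by rewrite /GRing.scale /= mulr1 mulrCA mulVf // mulr1.
- by rewrite sin_period !mulr0 sin0 mulr0.
Qed.

Lemma period_integral_sin k : period_integral (fun x => sin (k.+1%:R * x)) = 0.
Proof.
have k0 : k.+1%:R != 0 :> R by rewrite pnatr_eq0.
apply: (@period_integral_derive _ (fun x : R => - k.+1%:R^-1 * cos (k.+1%:R * x))).
- exact: continuous_sinM.
- by move=> x; apply: cvgM; [exact: cvg_cst|exact: continuous_cosM].
- move=> x; apply: is_derive_eq.
  by rewrite /GRing.scale /= mulr1 !mulNr mulrN opprK mulrCA mulVf // mulr1.
- by rewrite cos_period !mulr0 cos0.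
Qed.

End RealPeriodIntegral.

Section Circle.
Variable R : realType.
Local Notation C := (Cplx R).
Implicit Types (f g h : C -> C) (z w : C) (t : R).

Let ReD (z w : C) : complex.Re (z + w) = complex.Re z + complex.Re w.
Proof. by case: z; case: w. Qed.
Let ImD (z w : C) : complex.Im (z + w) = complex.Im z + complex.Im w.
Proof. by case: z; case: w. Qed.
Let ReM (z w : C) : complex.Re (z * w) =
  complex.Re z * complex.Re w - complex.Im z * complex.Im w.
Proof. by case: z; case: w. Qed.
Let ImM (z w : C) : complex.Im (z * w) =
  complex.Re z * complex.Im w + complex.Im z * complex.Re w.
Proof. by case: z; case: w. Qed.

(** Continuity is asked only along the parametrised circle and by components, which is what the two
    real integrals in [cintegral] use. *)
Definition circ_continuous g :=
  continuous (fun t => complex.Re (g (cis t))) /\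
  continuous (fun t => complex.Im (g (cis t))).

Definition circle_mean g : C := ((2 * pi)^-1)%:C%C * cintegral 0 (2 * pi) (fun t => g (cis t)).

Lemma circ_cst (a : C) : circ_continuous (fun=> a).
Proof. by split=> x; exact: cvg_cst. Qed.

Lemma circD g h : circ_continuous g -> circ_continuous h ->
  circ_continuous (fun z => g z + h z).
Proof.
move=> [g1 g2] [h1 h2]; split.
- rewrite (_ : (fun t => _) = fun t => complex.Re (g (cis t)) + complex.Re (h (cis t))).
    by move=> t; apply: cvgD; [exact: g1|exact: h1].
  by apply/funext => t; rewrite ReD.
- rewrite (_ : (fun t => _) = fun t => complex.Im (g (cis t)) + complex.Im (h (cis t))).
    by move=> t; apply: cvgD; [exact: g2|exact: h2].
  by apply/funext => t; rewrite ImD.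
Qed.

Lemma circM g h : circ_continuous g -> circ_continuous h ->
  circ_continuous (fun z => g z * h z).
Proof.
move=> [g1 g2] [h1 h2]; split.
- rewrite (_ : (fun t => _) = fun t => complex.Re (g (cis t)) * complex.Re (h (cis t)) -
     complex.Im (g (cis t)) * complex.Im (h (cis t))).
    by move=> t; apply: cvgB; apply: cvgM; [exact: g1|exact: h1|exact: g2|exact: h2].
  by apply/funext => t; rewrite ReM.
- rewrite (_ : (fun t => _) = fun t => complex.Re (g (cis t)) * complex.Im (h (cis t)) +
     complex.Im (g (cis t)) * complex.Re (h (cis t))).
    by move=> t; apply: cvgD; apply: cvgM; [exact: g1|exact: h2|exact: g2|exact: h1].
  by apply/funext => t; rewrite ImM.
Qed.

Lemma circX g n : circ_continuous g -> circ_continuous (fun z => g z ^+ n).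
Proof.
move=> cg; elim: n => [|n IH]; first exact: circ_cst.
by under eq_fun => z do rewrite exprS; exact: circM.
Qed.

Lemma circ_sum (I : Type) (r : seq I) (F : I -> C -> C) :
  (forall i, circ_continuous (F i)) -> circ_continuous (fun z => \sum_(i <- r) F i z).
Proof.
move=> cF; elim: r => [|i r IH].
  by under eq_fun => z do rewrite big_nil; exact: circ_cst.
by under eq_fun => z do rewrite big_cons; exact: circD.
Qed.

Lemma circ_id : circ_continuous id.
Proof. by split; [exact: continuous_cos|exact: continuous_sin]. Qed.

Lemma cis_conj t : (cis t)^-1 = cis (- t) :> C.
Proof.
apply/eqP; rewrite eq_complex /= cosN sinN cos2Dsin2 divr1.
rewrite !divr1 !eqxx //.
Qed.

Lemma cn_cis t : cn (cis t : C) = 1.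
Proof. by apply: complexI; rewrite -cnE normc_def /= cos2Dsin2 sqrtr1. Qed.

Lemma cis_neq0 t : cis t != 0 :> C.
Proof. by rewrite -cn_gt0 cn_cis. Qed.

Lemma circ_inv : circ_continuous (fun z => z^-1).
Proof.
split.
- rewrite (_ : (fun t => _) = fun t => cos t); first exact: continuous_cos.
  by apply/funext => t; rewrite cis_conj /= cosN.
- rewrite (_ : (fun t => _) = fun t => - sin t).
    by move=> t; apply: cvgN; exact: continuous_sin.
  by apply/funext => t; rewrite cis_conj /= sinN.
Qed.

Lemma circ_uniform g : (forall e : R, 0 < e -> exists2 h, circ_continuous h &
  forall z, cn z = 1 -> cn (g z - h z) <= e) -> circ_continuous g.
Proof.
move=> H.
have key (p : C -> R) : (forall z w : C, p (z - w) = p z - p w) ->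
    (forall z, `|p z| <= cn z) ->
    (forall h, circ_continuous h -> continuous (fun t => p (h (cis t)))) ->
    continuous (fun t => p (g (cis t))).
  move=> pB pn ph t; apply/cvgrPdist_lt => e e0.
  have e3 : 0 < e / 3 by rewrite divr_gt0.
  have [h ch hg] := H _ e3.
  have /cvgrPdist_lt /(_ _ e3) := ph _ ch t; apply: filterS => s hs.
  have b1 : `|p (g (cis t)) - p (h (cis t))| <= e / 3.
    by rewrite -pB; apply: le_trans (pn _) _; apply: hg; rewrite cn_cis.
  have b2 : `|p (g (cis s)) - p (h (cis s))| <= e / 3.
    by rewrite -pB; apply: le_trans (pn _) _; apply: hg; rewrite cn_cis.
  move: b1 b2 hs; rewrite !ler_norml !ltr_norml => /andP[? ?] /andP[? ?] /andP[? ?].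
  by apply/andP; split; lra.
split; first by apply: key (@ReB R) (@Re_cn R) _ => h [].
by apply: key (@ImB R) (@Im_cn R) _ => h [].
Qed.

Lemma circle_meanE g : circle_mean g =
  (((2 * pi)^-1 * period_integral (fun t => complex.Re (g (cis t)))) +i*
   ((2 * pi)^-1 * period_integral (fun t => complex.Im (g (cis t)))))%C.
Proof. by rewrite /circle_mean /cintegral /= -!/(period_integral _); simpc. Qed.

Lemma circle_meanD g h : circ_continuous g -> circ_continuous h ->
  circle_mean (fun z => g z + h z) = circle_mean g + circle_mean h.
Proof.
move=> [g1 g2] [h1 h2]; rewrite !circle_meanE.
under [in X in period_integral X]eq_fun => t do rewrite ReD.
under [in X in (_ +i* (_ * period_integral X))%C]eq_fun => t do rewrite ImD.
by rewrite !period_integralD // !mulrDr.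
Qed.

Lemma circle_meanZ a g : circ_continuous g ->
  circle_mean (fun z => a * g z) = a * circle_mean g.
Proof.
move=> [g1 g2]; rewrite !circle_meanE.
have cZ (x : R) (p : R -> R) : continuous p -> continuous (fun t => x * p t).
  by move=> cp t; apply: cvgM; [exact: cvg_cst|exact: cp].
have -> : (fun t => complex.Re (a * g (cis t))) = (fun t =>
    complex.Re a * complex.Re (g (cis t)) + (- complex.Im a) * complex.Im (g (cis t))).
  by apply/funext => t; rewrite ReM mulNr.
have -> : (fun t => complex.Im (a * g (cis t))) = (fun t =>
    complex.Re a * complex.Im (g (cis t)) + complex.Im a * complex.Re (g (cis t))).
  by apply/funext => t; rewrite ImM.
rewrite !period_integralD ?period_integralZ //; try exact: cZ.
by case: a => x y /=; simpc; congr (_ +i* _)%C; ring.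
Qed.

Lemma cintegral_circle g :
  cintegral 0 (2 * pi) (fun t => g (cis t)) = (2 * pi)%:C%C * circle_mean g.
Proof.
have p0 : (2 * pi)%:C%C != 0 :> C.
  by rewrite -cn_eq0 cn_real normr_eq0 gt_eqF // period_gt0.
by rewrite /circle_mean mulrA fmorphV /= divff // mul1r.
Qed.

Lemma eq_circle_mean g h : (forall z, cn z = 1 -> g z = h z) ->
  circle_mean g = circle_mean h.
Proof.
move=> e; rewrite /circle_mean; congr (_ * cintegral _ _ _).
by apply/funext => t; rewrite e ?cn_cis.
Qed.

Lemma circle_mean_sum (I : Type) (r : seq I) (F : I -> C -> C) :
  (forall i, circ_continuous (F i)) ->
  circle_mean (fun z => \sum_(i <- r) F i z) = \sum_(i <- r) circle_mean (F i).
Proof.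
move=> cF; elim: r => [|i r IH].
  rewrite big_nil (eq_circle_mean (h := fun z => 0 * 0)) => [|z _].
    by rewrite circle_meanZ ?mul0r //; exact: circ_cst.
  by rewrite big_nil mul0r.
rewrite big_cons -IH -circle_meanD //; last exact: circ_sum.
by apply: eq_circle_mean => z _; rewrite big_cons.
Qed.

(** The factor 2 comes from bounding the real and imaginary parts separately. *)
Lemma circle_mean_le g e : circ_continuous g -> (forall z, cn z = 1 -> cn (g z) <= e) ->
  cn (circle_mean g) <= 2 * e.
Proof.
move=> [g1 g2] h; rewrite circle_meanE; apply: le_trans (cn_ReIm _) _ => /=.
have p0 := period_gt0 R; have pV : 0 <= (2 * pi : R)^-1 by rewrite invr_ge0 ltW.
rewrite !normrM (ger0_norm pV).
have b1 : `|period_integral (fun t => complex.Re (g (cis t)))| <= e * (2 * pi).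
  by apply: period_integral_le => // t; apply: le_trans (Re_cn _) _; rewrite h ?cn_cis.
have b2 : `|period_integral (fun t => complex.Im (g (cis t)))| <= e * (2 * pi).
  by apply: period_integral_le => // t; apply: le_trans (Im_cn _) _; rewrite h ?cn_cis.
rewrite -mulrDr ler_pdivrMl //; apply: le_trans (lerD b1 b2) _.
by rewrite le_eqVlt; apply/orP; left; apply/eqP; ring.
Qed.

Lemma circle_mean_cst (a : C) : circle_mean (fun=> a) = a.
Proof.
rewrite circle_meanE !period_integral_cst.
have p0 : 2 * pi != 0 :> R by rewrite gt_eqF // period_gt0.
by rewrite ![_^-1 * _]mulrC !mulfK //; case: a.
Qed.

Lemma cisX t n : cis t ^+ n = cis (n%:R * t) :> C.
Proof.
elim: n => [|n IH]; first by rewrite expr0 mul0r /cis cos0 sin0.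
rewrite exprS IH /cis -[n.+1%:R]natr1 mulrDl mul1r cosD sinD; simpc.
by congr (_ +i* _)%C; ring.
Qed.

Lemma circle_mean_exp n : circle_mean (fun z => z ^+ n) = (n == 0%N)%:R.
Proof.
case: n => [|n].
  by rewrite (eq_circle_mean (h := fun=> 1)) ?circle_mean_cst // => z _; rewrite expr0.
rewrite circle_meanE.
have -> : (fun t => complex.Re (cis t ^+ n.+1 : C)) = fun t => cos (n.+1%:R * t).
  by apply/funext => t; rewrite cisX.
have -> : (fun t => complex.Im (cis t ^+ n.+1 : C)) = fun t => sin (n.+1%:R * t).
  by apply/funext => t; rewrite cisX.
by rewrite period_integral_cos period_integral_sin !mulr0.
Qed.

Lemma circle_mean_expV n : circle_mean (fun z => z^-1 ^+ n) = (n == 0%N)%:R.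
Proof.
case: n => [|n].
  by rewrite (eq_circle_mean (h := fun=> 1)) ?circle_mean_cst // => z _; rewrite expr0.
rewrite circle_meanE.
have -> : (fun t => complex.Re ((cis t)^-1 ^+ n.+1 : C)) = fun t => cos (n.+1%:R * t).
  by apply/funext => t; rewrite cis_conj cisX /= mulrN cosN.
have -> : (fun t => complex.Im ((cis t)^-1 ^+ n.+1 : C)) = fun t => -1 * sin (n.+1%:R * t).
  by apply/funext => t; rewrite cis_conj cisX /= mulrN sinN mulN1r.
rewrite period_integralZ; last exact: continuous_sinM.
by rewrite period_integral_cos period_integral_sin !mulr0.
Qed.

Lemma circle_mean_cvg (G : nat -> C -> C) g : (forall n, circ_continuous (G n)) ->
  circ_continuous g ->
  (forall e : R, 0 < e -> exists N, forall n, (N <= n)%N -> forall z, cn z = 1 ->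
     cn (G n z - g z) <= e) ->
  (fun n => circle_mean (G n)) @ \oo --> circle_mean g.
Proof.
move=> cG cg H; apply/cvgC_P => e e0.
have e4 : 0 < e / 4 by rewrite divr_gt0.
have [N hN] := H _ e4; exists N => n /hN hn.
have cNg : circ_continuous (fun z => -1 * g z) by apply: circM => //; exact: circ_cst.
have -> : circle_mean (G n) - circle_mean g = circle_mean (fun z => G n z + -1 * g z).
  by rewrite circle_meanD ?circle_meanZ // mulN1r.
apply: (@le_lt_trans _ _ (2 * (e / 4))); last by lra.
by apply: circle_mean_le => [|z /hn]; [exact: circD|rewrite mulN1r].
Qed.

End Circle.

(** * Uniform limits of polynomials on the closed unit disc *)

Section DiscAlgebra.
Variable R : realType.
Local Notation C := (Cplx R).
Implicit Types (g h s : C -> C) (z w q : C) (e : R) (p : {poly C}).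

(** This is the form of holomorphy that is used: an identity of means checked on polynomials passes
    to such limits. *)
Definition disc_algebra g := forall e, 0 < e ->
  exists p, forall z, cn z <= 1 -> cn (g z - p.[z]) <= e.

Lemma poly_disc_bound p z : cn z <= 1 -> cn p.[z] <= \sum_(i < size p) cn p`_i.
Proof.
move=> z1; rewrite horner_coef; apply: le_trans (cn_sum _ _ _) _.
apply: ler_sum => i _; rewrite cnM cnX ler_piMr ?cn_ge0 //.
by rewrite exprn_ile1 ?cn_ge0.
Qed.

Lemma disc_bounded g : disc_algebra g ->
  exists2 M, 0 <= M & forall z, cn z <= 1 -> cn (g z) <= M.
Proof.
move=> /(_ 1 ltr01) [p hp]; exists (1 + \sum_(i < size p) cn p`_i).
  by rewrite addr_ge0 // sumr_ge0 // => i _; exact: cn_ge0.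
move=> z z1; rewrite -[g z](subrK p.[z]); apply: le_trans (cnD _ _) _.
by rewrite lerD ?hp ?poly_disc_bound.
Qed.

Lemma disc_poly p : disc_algebra (fun z => p.[z]).
Proof. by move=> e e0; exists p => z _; rewrite subrr cn0 ltW. Qed.

Lemma disc_ext g h : (forall z, cn z <= 1 -> g z = h z) -> disc_algebra g -> disc_algebra h.
Proof. by move=> gh dg e /dg[p hp]; exists p => z z1; rewrite -gh ?hp. Qed.

Lemma disc_cst w : disc_algebra (fun=> w).
Proof. by apply: disc_ext (disc_poly w%:P) => z _; rewrite hornerC. Qed.

Lemma disc_uniform g : (forall e, 0 < e -> exists2 h, disc_algebra h &
    forall z, cn z <= 1 -> cn (g z - h z) <= e) -> disc_algebra g.
Proof.
move=> H e e0; have e2 : 0 < e / 2 by rewrite divr_gt0.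
have [h dh hg] := H _ e2; have [p hp] := dh _ e2; exists p => z z1.
apply: le_trans (cn_dist _ _ (h z)) _; rewrite [e]splitr.
by apply: lerD; [exact: hg|exact: hp].
Qed.

Lemma disc_mul g h : disc_algebra g -> disc_algebra h -> disc_algebra (fun z => g z * h z).
Proof.
move=> dg dh e e0; have [M M0 hM] := disc_bounded dg; have [N N0 hN] := disc_bounded dh.
(* The minimum with 1 keeps [p] bounded by [M + 1] on the disc. *)
pose e1 := Num.min 1 (e / 2 / (N + 1)); pose e2 := e / 2 / (M + 1).
have e1_0 : 0 < e1 by rewrite lt_min ltr01 !divr_gt0 //; lra.
have e2_0 : 0 < e2 by rewrite !divr_gt0 //; lra.
have [p hp] := dg _ e1_0; have [r hr] := dh _ e2_0; exists (p * r) => z z1.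
have -> : g z * h z - (p * r).[z] = (g z - p.[z]) * h z + p.[z] * (h z - r.[z]).
  by rewrite hornerM; ring.
apply: le_trans (cnD _ _) _; rewrite !cnM [e]splitr; apply: lerD.
  apply: (@le_trans _ _ (e / 2 / (N + 1) * (N + 1))); last by rewrite divfK //; lra.
  apply: ler_pM; rewrite ?cn_ge0 //.
    by apply: le_trans (hp _ z1) _; rewrite /e1 ge_min lexx orbT.
  by apply: le_trans (hN _ z1) _; lra.
apply: (@le_trans _ _ ((M + 1) * (e / 2 / (M + 1)))); last by rewrite mulrC divfK //; lra.
apply: ler_pM; rewrite ?cn_ge0 //; last exact: hr.
rewrite -[p.[z]](subKr (g z)); apply: le_trans (cnB _ _) _; apply: lerD; first exact: hM.
by apply: le_trans (hp _ z1) _; rewrite /e1 ge_min lexx.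
Qed.

Lemma pow_small r e : 0 <= r -> r < 1 -> 0 < e -> exists n, forall m, (n <= m)%N -> r ^+ m < e.
Proof.
move=> r0 r1 e0; have r1' : `|r| < 1 by rewrite ger0_norm.
have /cvgrPdist_lt /(_ e e0) [n _ hn] := cvg_expr r1'; exists n => m /hn /=.
by rewrite sub0r normrN ger0_norm ?exprn_ge0.
Qed.

Lemma disc_geometric w : cn w < 1 -> disc_algebra (fun z => (1 - w * z)^-1).
Proof.
move=> w1 e e0; have w0 := cn_ge0 w; have w1' : 0 < 1 - cn w by lra.
have [n hn] := @pow_small (cn w) (e * (1 - cn w)) w0 w1 (mulr_gt0 e0 w1').
have {}hn := hn _ (leqnn n).
exists (\sum_(k < n) (w *: 'X) ^+ k) => z z1.
have hwz : cn (w * z) <= cn w by rewrite cnM ler_piMr.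
have nz : 1 - w * z != 0 by apply: one_sub_neq0; lra.
have -> : (1 - w * z)^-1 - (\sum_(k < n) (w *: 'X) ^+ k).[z] = (w * z) ^+ n / (1 - w * z).
  rewrite horner_sum; under eq_bigr => k _ do rewrite horner_exp hornerZ hornerX.
  apply: (mulIf nz); rewrite mulrBl mulVf // divfK //.
  have := subrX1 (w * z) n; set S := \sum_(_ < _) _ => h.
  have -> : (w * z) ^+ n = (w * z - 1) * S + 1 by rewrite -h subrK.
  by ring.
rewrite cnM cnX cnV ler_pdivrMr ?cn_gt0 //.
apply: (@le_trans _ _ (cn w ^+ n)).
  by apply: lerXn2r; rewrite ?nnegrE ?cn_ge0.
apply: le_trans (ltW hn) _; rewrite ler_pM2l //.
have := cnD (1 - w * z) (w * z); rewrite subrK cn1; lra.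
Qed.

Lemma disc_qpoch w q m n : disc_algebra (fun z => qpoch n (w * z ^+ m) q).
Proof.
elim: n => [|n IH].
  by apply: disc_ext (disc_cst 1) => z _; rewrite qpoch0.
apply: (@disc_ext (fun z => qpoch n (w * z ^+ m) q * (1 - w * q ^+ n *: 'X^m : {poly C}).[z])).
  by move=> z _; rewrite qpochSr !hornerE mulrAC.
by apply: disc_mul => //; exact: disc_poly.
Qed.

Lemma disc_qpochV w q n : cn w < 1 -> cn q < 1 -> disc_algebra (fun z => (qpoch n (w * z) q)^-1).
Proof.
move=> w1 q1; elim: n => [|n IH].
  by apply: disc_ext (disc_cst 1) => z _; rewrite qpoch0 invr1.
apply: (@disc_ext (fun z => (qpoch n (w * z) q)^-1 * (1 - w * q ^+ n * z)^-1)).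
  by move=> z _; rewrite qpochSr invfM mulrAC.
apply: disc_mul => //; apply: disc_geometric; rewrite cnM cnX.
apply: le_lt_trans w1; rewrite ler_piMr ?cn_ge0 //.
by rewrite exprn_ile1 ?cn_ge0 // ltW.
Qed.

Lemma qpoch_inf_uniform (s r e : R) : r < 1 -> 0 <= r -> 0 <= s -> 0 < e -> exists n,
  forall x q, cn x <= s -> cn q <= r -> cn (qpoch_inf x q - qpoch n x q) <= e.
Proof.
move=> r1 r0 s0 e0; pose K := qbound s r * s / (1 - r) + 1.
have K0 : 0 < K by rewrite ltr_wpDl // !mulr_ge0 ?invr_ge0 ?expR_ge0 //; lra.
have [n hn] := @pow_small r (e / K) r0 r1 (divr_gt0 e0 K0).
exists n => x q xs qr; have [_ h] := @qpoch_cvg_err _ x q s r xs qr r1.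
rewrite cn_sub; apply: le_trans (h n) _.
have := hn _ (leqnn n); rewrite ltr_pdivlMr // => /ltW; apply: le_trans.
rewrite mulrAC mulrC ler_wpM2l ?exprn_ge0 // /K; lra.
Qed.

Lemma disc_qpoch_inf w q m : cn q < 1 -> disc_algebra (fun z => qpoch_inf (w * z ^+ m) q).
Proof.
move=> q1; apply: disc_uniform => e e0.
have [n hn] := @qpoch_inf_uniform (cn w) (cn q) e q1 (cn_ge0 _) (cn_ge0 _) e0.
exists (fun z => qpoch n (w * z ^+ m) q); first exact: disc_qpoch.
move=> z z1; apply: hn => //; rewrite cnM cnX ler_piMr ?cn_ge0 //.
by rewrite exprn_ile1 ?cn_ge0.
Qed.

Lemma invB_bound (x y : C) (B : R) : x != 0 -> y != 0 -> cn x^-1 <= B -> cn y^-1 <= B ->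
  cn (x^-1 - y^-1) <= B ^+ 2 * cn (x - y).
Proof.
move=> x0 y0 xB yB; have -> : x^-1 - y^-1 = x^-1 * y^-1 * (y - x) by field; rewrite y0.
by rewrite !cnM [cn (y - x)]cn_sub ler_wpM2r ?cn_ge0 // expr2 ler_pM ?cn_ge0.
Qed.

Lemma disc_qpoch_infV w q : cn w < 1 -> cn q < 1 ->
  disc_algebra (fun z => (qpoch_inf (w * z) q)^-1).
Proof.
move=> w1 q1; apply: disc_uniform => e e0.
pose B := qbound_inv (cn w) (cn q); have B0 : 0 < B ^+ 2 by rewrite exprn_gt0 ?expR_gt0.
have [n hn] := @qpoch_inf_uniform (cn w) (cn q) (e / B ^+ 2) q1 (cn_ge0 _) (cn_ge0 _) (divr_gt0 e0 B0).
exists (fun z => (qpoch n (w * z) q)^-1); first exact: disc_qpochV.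
move=> z z1; have wz : cn (w * z) <= cn w by rewrite cnM ler_piMr ?cn_ge0.
have wz1 := le_lt_trans wz w1.
apply: (@le_trans _ _ (B ^+ 2 * cn (qpoch_inf (w * z) q - qpoch n (w * z) q))).
  apply: invB_bound; [exact: qpoch_inf_neq0|exact: qpoch_neq0| |].
  - exact: qpoch_inf_inv_bound.
  - exact: qpoch_inv_bound.
by rewrite mulrC -ler_pdivlMr //; exact: hn.
Qed.

Lemma circ_horner p s : circ_continuous s -> circ_continuous (fun z => p.[s z]).
Proof.
move=> cs; under eq_fun => z do rewrite horner_coef.
by apply: circ_sum => i; apply: circM; [exact: circ_cst|exact: circX].
Qed.

Lemma circ_disc g s : disc_algebra g -> circ_continuous s ->
  (forall z, cn z = 1 -> cn (s z) <= 1) -> circ_continuous (fun z => g (s z)).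
Proof.
move=> dg cs s1; apply: circ_uniform => e /dg[p hp].
by exists (fun z => p.[s z]); [exact: circ_horner|move=> z /s1; exact: hp].
Qed.

Section ShiftIdentity.
Variables (s : C -> C) (q : C).
Hypotheses (cs : circ_continuous s) (csV : circ_continuous (fun z => (s z)^-1)).
Hypothesis s1 : forall z, cn z = 1 -> cn (s z) = 1.
Hypothesis s_ortho : forall i j,
  circle_mean (fun z => s z ^+ i * (s z)^-1 ^+ j) = (i == j)%:R.
Hypothesis q1 : cn q <= 1.

Let cijM i j : circ_continuous (fun z => s z ^+ i * (s z)^-1 ^+ j).
Proof. by apply: circM; exact: circX. Qed.

(** The map [s] will be [z] or [z^-1]. In the sum over pairs of coefficients, the part with [s^-1]
    survives for [i = j + 1] with factor [q^i], the part with [- q s] for [j = i + 1] with factor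
    [q^(i + 1)]; exchanging the indices in the second sum shows that they cancel. *)
Lemma poly_shift_identity p :
  circle_mean (fun z => p.[q * s z] * p.[(s z)^-1] * ((s z)^-1 - q * s z)) = 0.
Proof.
pose n := size p.
pose F (i j : 'I_n) z := p`_i * q ^+ i * p`_j * (s z ^+ i * (s z)^-1 ^+ j.+1) +
   (- (p`_i * q ^+ i * p`_j * q)) * (s z ^+ i.+1 * (s z)^-1 ^+ j).
have cZ a i j : circ_continuous (fun z => a * (s z ^+ i * (s z)^-1 ^+ j)).
  by apply: circM; [exact: circ_cst|exact: cijM].
have cF i j : circ_continuous (F i j) by apply: circD; exact: cZ.
rewrite (eq_circle_mean (h := fun z => \sum_(i < n) \sum_(j < n) F i j z)) => [|z z1].
  rewrite circle_mean_sum; last by move=> i; apply: circ_sum => j.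
  pose c (i j : 'I_n) := p`_i * q ^+ i * p`_j.
  have E (i j : 'I_n) : circle_mean (F i j) =
      c i j * (i == j.+1 :> nat)%:R + - (c i j * q) * (i.+1 == j :> nat)%:R.
    by rewrite /F circle_meanD ?circle_meanZ // !s_ortho.
  transitivity (\sum_(i < n) \sum_(j < n) c i j * (i == j.+1 :> nat)%:R +
      \sum_(i < n) \sum_(j < n) - (c i j * q) * (i.+1 == j :> nat)%:R).
    rewrite -big_split; apply: eq_bigr => i _; rewrite circle_mean_sum // -big_split.
    by apply: eq_bigr => j _; rewrite E.
  rewrite [X in _ + X]exchange_big -big_split big1 // => i _.
  rewrite -big_split big1 // => j _ /=; rewrite [(j.+1 == _)]eq_sym /c.
  case: eqP => [->|_]; last by rewrite !mulr0 addr0.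
  by rewrite exprS; ring.
rewrite !horner_coef -/n mulr_suml mulr_suml; apply: eq_bigr => i _.
rewrite mulr_sumr mulr_suml; apply: eq_bigr => j _.
by rewrite /F !exprS exprMn; ring.
Qed.

Lemma disc_shift_identity g : disc_algebra g ->
  circle_mean (fun z => g (q * s z) * g (s z)^-1 * ((s z)^-1 - q * s z)) = 0.
Proof.
move=> dg; pose F z := g (q * s z) * g (s z)^-1 * ((s z)^-1 - q * s z); rewrite -/F; apply/eqP; rewrite -cn_eq0 eq_le cn_ge0 andbT.
have [M M0 hM] := disc_bounded dg.
have hz z : cn z = 1 -> cn (q * s z) <= 1 /\ cn (s z)^-1 <= 1.
  by move=> /s1 h; rewrite cnM cnV h invr1 mulr1.
have cq : circ_continuous (fun z => q * s z) by apply: circM => //; exact: circ_cst.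
have cD : circ_continuous (fun z => (s z)^-1 - q * s z).
  by under eq_fun => z do rewrite -mulNr; apply: circD => //; apply: circM => //; exact: circ_cst.
have cg : circ_continuous F.
  apply: circM => //; apply: circM; apply: circ_disc => // z /hz[] //.
apply/ler_addgt0Pl => e e0; rewrite addr0.
(* Replacing [g] by [p] changes the product of the two values by at most [(2 M + 1) e1]; the last
   factor is at most 2, and [circle_mean_le] adds another factor 2. *)
pose e1 := Num.min 1 (e / (4 * (2 * M + 1))).
have K0 : 0 < 4 * (2 * M + 1) by lra.
have e10 : 0 < e1 by rewrite lt_min ltr01 divr_gt0.
have [p hp] := dg _ e10.
pose G z := p.[q * s z] * p.[(s z)^-1] * ((s z)^-1 - q * s z).
have cp : circ_continuous G.
  by apply: circM => //; apply: circM; exact: circ_horner.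
have -> : circle_mean F = circle_mean (fun z => F z + -1 * G z).
  rewrite circle_meanD ?circle_meanZ ?poly_shift_identity ?mulr0 ?addr0 //.
  by apply: circM => //; exact: circ_cst.
apply: (@le_trans _ _ (2 * (e / 2))); last by lra.
apply: circle_mean_le.
  by apply: circD => //; apply: circM => //; exact: circ_cst.
move=> z z1; have [h1 h2] := hz _ z1.
have -> : F z + -1 * G z =
  ((g (q * s z) - p.[q * s z]) * g (s z)^-1 + p.[q * s z] * (g (s z)^-1 - p.[(s z)^-1])) *
  ((s z)^-1 - q * s z) by rewrite /F /G; ring.
rewrite cnM; apply: (@le_trans _ _ ((2 * M + 1) * e1 * 2)); last first.
  have : (2 * M + 1) * e1 <= e / 4.
    apply: (@le_trans _ _ ((2 * M + 1) * (e / (4 * (2 * M + 1))))).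
      by rewrite ler_wpM2l ?ge_min ?lexx ?orbT //; lra.
    by rewrite le_eqVlt; apply/orP; left; apply/eqP; field; apply/eqP; lra.
  lra.
apply: ler_pM; rewrite ?cn_ge0 //; last first.
  by apply: le_trans (cnB _ _) _; lra.
apply: le_trans (cnD _ _) _; rewrite !cnM.
have e11 : e1 <= 1 by rewrite ge_min lexx.
have A1 : cn (g (q * s z) - p.[q * s z]) * cn (g (s z)^-1) <= e1 * M.
  by apply: ler_pM; rewrite ?cn_ge0 ?hp ?hM.
have A2 : cn p.[q * s z] * cn (g (s z)^-1 - p.[(s z)^-1]) <= (M + 1) * e1.
  apply: ler_pM; rewrite ?cn_ge0 ?hp //.
  rewrite -[p.[_]](subKr (g (q * s z))); apply: le_trans (cnB _ _) _.
  by apply: lerD; [exact: hM|apply: le_trans (hp _ h1) _].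
lra.
Qed.

End ShiftIdentity.

Lemma circle_ortho i j : circle_mean (fun z => z ^+ i * z^-1 ^+ j) = (i == j)%:R :> C.
Proof.
have nz (z : C) : cn z = 1 -> z != 0 by rewrite -cn_gt0 => ->.
have [ij|ij] := leqP j i.
  rewrite (eq_circle_mean (h := fun z => z ^+ (i - j))) => [|z /nz z0].
    by rewrite circle_mean_exp subn_eq0 eqn_leq ij andbT.
  by rewrite exprVn expfB_cond // (negPf z0).
rewrite (eq_circle_mean (h := fun z => z^-1 ^+ (j - i))) => [|z /nz z0].
  by rewrite circle_mean_expV subn_eq0 eqn_leq [(j <= i)%N]leqNgt ij andbF.
have e : z ^+ (j - i) = z ^+ j / z ^+ i by rewrite expfB_cond // (negPf z0) ltnW.
by rewrite !exprVn e invfM invrK mulrC.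
Qed.

Lemma disc_shift_identity_id g q : disc_algebra g -> cn q <= 1 ->
  circle_mean (fun z => g (q * z) * g z^-1 * (z^-1 - q * z)) = 0.
Proof.
move=> dg q1; apply: (@disc_shift_identity id) => //; first exact: circ_id.
  exact: circ_inv.
exact: circle_ortho.
Qed.

Lemma disc_shift_identity_inv g q : disc_algebra g -> cn q <= 1 ->
  circle_mean (fun z => g (q * z^-1) * g z * (z - q * z^-1)) = 0.
Proof.
move=> dg q1; rewrite -[RHS](@disc_shift_identity (fun z => z^-1) q _ _ _ _ _ g) //.
- by apply: eq_circle_mean => z _; rewrite invrK.
- exact: circ_inv.
- by under eq_fun => z do rewrite invrK; exact: circ_id.
- by move=> z z1; rewrite cnV z1 invr1.
- move=> i j; rewrite eq_sym -circle_ortho.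
  by apply: eq_circle_mean => z _; rewrite invrK mulrC.
Qed.

End DiscAlgebra.

(** * The Askey-Wilson integral *)

Section HalfWeight.
Variable R : realType.
Local Notation C := (Cplx R).
Implicit Types (a b c d q z : C).

Definition half_weight a b c d q z : C :=
  qpoch_inf (z ^+ 2) q * ((qpoch_inf (a * z) q)^-1 * (qpoch_inf (b * z) q)^-1 *
    (qpoch_inf (c * z) q)^-1 * (qpoch_inf (d * z) q)^-1).

Definition full_weight a b c d q z := half_weight a b c d q z * half_weight a b c d q z^-1.

Definition weight_mass a b c d q := circle_mean (full_weight a b c d q).

Section Params.
Variables a b c d q : C.
Hypotheses (a1 : cn a < 1) (b1 : cn b < 1) (c1 : cn c < 1) (d1 : cn d < 1) (q1 : cn q < 1).

Lemma disc_half_weight : disc_algebra (half_weight a b c d q).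
Proof.
apply: disc_mul.
  apply: disc_ext (disc_qpoch_inf 1 2 q1) => z _; rewrite mul1r //.
apply: disc_mul; last exact: disc_qpoch_infV.
apply: disc_mul; last exact: disc_qpoch_infV.
by apply: disc_mul; exact: disc_qpoch_infV.
Qed.

Lemma circ_half_weight : circ_continuous (half_weight a b c d q).
Proof.
apply: (circ_disc disc_half_weight (@circ_id R)) => z z1.
by rewrite z1.
Qed.

Lemma circ_half_weightV : circ_continuous (fun z => half_weight a b c d q z^-1).
Proof.
apply: (circ_disc disc_half_weight (@circ_inv R)) => z z1.
by rewrite cnV z1 invr1.
Qed.

Lemma circ_full_weight : circ_continuous (full_weight a b c d q).
Proof. by apply: circM; [exact: circ_half_weight|exact: circ_half_weightV]. Qed.

Let circle_neq0 z : cn z = 1 -> z != 0.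
Proof. by rewrite -cn_gt0 => ->. Qed.

Let param_circle x z : cn x < 1 -> cn z = 1 -> cn (x * z) < 1.
Proof. by move=> x1 z1; rewrite cnM z1 mulr1. Qed.

Lemma qpoch_infVS y : cn y < 1 ->
  (qpoch_inf (y * q) q)^-1 = (qpoch_inf y q)^-1 * (1 - y).
Proof.
move=> y1; rewrite (qpoch_infS y q1) invfM mulrAC mulVf ?mul1r //.
by rewrite one_sub_neq0.
Qed.

Lemma half_weight_shift z : cn z = 1 ->
  half_weight a b c d q z * ((1 - a * z) * (1 - b * z) * (1 - c * z) * (1 - d * z)) =
  (1 - z ^+ 2) * (1 - z ^+ 2 * q) * half_weight a b c d q (q * z).
Proof.
move=> z1; rewrite /half_weight.
have E x : cn x < 1 ->
    (qpoch_inf (x * (q * z)) q)^-1 = (qpoch_inf (x * z) q)^-1 * (1 - x * z).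
  move=> x1; have -> : x * (q * z) = x * z * q by ring.
  by rewrite qpoch_infVS //; exact: param_circle.
rewrite (E a a1) (E b b1) (E c c1) (E d d1).
rewrite [in LHS](qpoch_infS (z ^+ 2) q1) (qpoch_infS (z ^+ 2 * q) q1).
have -> : (q * z) ^+ 2 = z ^+ 2 * q * q by ring.
move: (_^-1) (_^-1) (_^-1) (_^-1) (qpoch_inf _ _) => x1 x2 x3 x4 x5.
by ring.
Qed.

(** Solving [half_weight_shift] for [P(qz)] would divide by [(1 - z^2) (1 - q z^2)], which vanishes
    at [z = 1] and [z = -1]. Instead both sides are multiplied by the quartics [PA] and [PB], which
    have no zero on the circle; then [u * v] factors out and a rational identity in [z] remains. *)
Lemma full_weight_shift z : cn z = 1 ->
  half_weight a b c d q (q * z) * half_weight a b c d q z^-1 * (z^-1 - q * z) +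
  half_weight a b c d q (q * z^-1) * half_weight a b c d q z * (z - q * z^-1) =
  full_weight a b c d q z *
  ((1 - a * b * c * d) * (z + z^-1) - (a + b + c + d) +
   (a * b * c + a * b * d + a * c * d + b * c * d)).
Proof.
move=> z1; have zV1 : cn z^-1 = 1 by rewrite cnV z1 invr1.
have := half_weight_shift zV1; have := half_weight_shift z1.
rewrite /full_weight; set x := half_weight _ _ _ _ _ z; set y := half_weight _ _ _ _ _ z^-1.
set u := half_weight _ _ _ _ _ (q * z); set v := half_weight _ _ _ _ _ (q / z).
set PA := _ * (1 - d * z); set PB := _ * (1 - d * z^-1).
have nz x0 t : cn x0 < 1 -> cn t = 1 -> 1 - x0 * t != 0.
  by move=> x01 t1; apply: one_sub_neq0; rewrite cnM t1 mulr1.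
have PA0 : PA != 0 by rewrite /PA !mulf_neq0 // nz.
have PB0 : PB != 0 by rewrite /PB !mulf_neq0 // nz.
move=> e1 e2; apply: (mulIf (mulf_neq0 PA0 PB0)).
transitivity (u * PA * (y * PB) * (z^-1 - q * z) + v * PB * (x * PA) * (z - q * z^-1)).
  by ring.
rewrite e1 e2; set K := (1 - a * b * c * d) * _ - _ + _.
transitivity ((x * PA) * (y * PB) * K); last by ring.
rewrite e1 e2 /PA /PB /K; have z0 := circle_neq0 z1; clear e1 e2 PA0 PB0 PA PB K.
transitivity (u * v * ((1 - z^-1 ^+ 2) * (1 - z^-1 ^+ 2 * q) * (z^-1 - q * z) *
   ((1 - a * z) * (1 - b * z) * (1 - c * z) * (1 - d * z)) +
   (1 - z ^+ 2) * (1 - z ^+ 2 * q) * (z - q * z^-1) *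
   ((1 - a / z) * (1 - b / z) * (1 - c / z) * (1 - d / z)))); first by ring.
by field.
Qed.

Lemma first_moment : circle_mean (fun z => full_weight a b c d q z *
  ((1 - a * b * c * d) * (z + z^-1) - (a + b + c + d) +
   (a * b * c + a * b * d + a * c * d + b * c * d))) = 0.
Proof.
have q1' := ltW q1.
rewrite -(eq_circle_mean full_weight_shift) circle_meanD.
- rewrite (disc_shift_identity_id disc_half_weight q1').
  by rewrite (disc_shift_identity_inv disc_half_weight q1') addr0.
- apply: circM; first apply: circM.
  + apply: (circ_disc disc_half_weight (s := fun z => q * z)) => [|z z1].
      by apply: circM; [exact: circ_cst|exact: circ_id].
    by rewrite cnM z1 mulr1.
  + exact: circ_half_weightV.
  + under eq_fun => z do rewrite -mulNr; apply: circD; first exact: circ_inv.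
    by apply: circM; [exact: circ_cst|exact: circ_id].
- apply: circM; first apply: circM.
  + apply: (circ_disc disc_half_weight (s := fun z => q * z^-1)) => [|z z1].
      by apply: circM; [exact: circ_cst|exact: circ_inv].
    by rewrite cnM cnV z1 invr1 mulr1.
  + exact: circ_half_weight.
  + under eq_fun => z do rewrite -mulNr; apply: circD; first exact: circ_id.
    by apply: circM; [exact: circ_cst|exact: circ_inv].
Qed.

Lemma full_weight_mulq z : cn z = 1 ->
  full_weight (a * q) b c d q z = full_weight a b c d q z * ((1 - a * z) * (1 - a * z^-1)).
Proof.
have H w : cn w = 1 -> half_weight (a * q) b c d q w = half_weight a b c d q w * (1 - a * w).
  move=> w1; rewrite /half_weight; have -> : a * q * w = a * w * q by ring.
  rewrite qpoch_infVS; last exact: param_circle a1 w1.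
  move: (_^-1) (_^-1) (_^-1) (_^-1) (qpoch_inf _ _) => x1 x2 x3 x4 x5.
  by ring.
move=> z1; have zV1 : cn z^-1 = 1 by rewrite cnV z1 invr1.
rewrite /full_weight (H z z1) (H _ zV1).
by move: (half_weight _ _ _ _ _ _) (half_weight _ _ _ _ _ _) => x y; ring.
Qed.

(** Since [(1 - a z) (1 - a / z)] is linear in [z + z^-1], the first moment gives the mass at [a q].
    The product on the right is [(1 + a^2) (1 - e4) - a (e1 - e3)], with [e1], [e3], [e4] the
    elementary symmetric functions of the parameters. *)
Lemma weight_mass_shift :
  (1 - a * b * c * d) * weight_mass (a * q) b c d q =
  (1 - a * b) * (1 - a * c) * (1 - a * d) * weight_mass a b c d q.
Proof.
have cW := circ_full_weight.
have cx : circ_continuous (fun z : C => z + z^-1).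
  by apply: circD; [exact: circ_id|exact: circ_inv].
have cWx : circ_continuous (fun z => full_weight a b c d q z * (z + z^-1)) by exact: circM.
have := first_moment; set e4 := _ * d; set e1 := a + b + c + d; set e3 := _ + b * c * d => h.
have {}h : (1 - e4) * circle_mean (fun z => full_weight a b c d q z * (z + z^-1)) =
   (e1 - e3) * weight_mass a b c d q.
  apply/eqP; rewrite /weight_mass -subr_eq0 -h -[- (_ * circle_mean _)]mulNr -!circle_meanZ // -circle_meanD;
    try by apply: circM => //; exact: circ_cst.
  by apply/eqP/eq_circle_mean => z _; ring.
rewrite /weight_mass (eq_circle_mean (h := fun z => (1 + a ^+ 2) * full_weight a b c d q z +
   (- a) * (full_weight a b c d q z * (z + z^-1)))) => [|z z1]; last first.
  by rewrite full_weight_mulq //; field; exact: circle_neq0.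
rewrite circle_meanD ?circle_meanZ //; try by apply: circM => //; exact: circ_cst.
rewrite mulrDr [X in _ + X]mulrCA h /weight_mass /e1 /e3 /e4; ring.
Qed.

End Params.
End HalfWeight.

(** * Uniform convergence of the weights on the circle *)

Section UniformCvg.
Variable R : realType.
Local Notation C := (Cplx R).
Implicit Types (a b c d q z : C) (G H : nat -> C -> C) (g h : C -> C) (A Q : nat -> C).

(** Boundedness of the limit is included so that the notion is stable under products. *)
Definition circle_ucvg G g :=
  (exists M : R, forall z, cn z = 1 -> cn (g z) <= M) /\
  forall e : R, 0 < e -> exists N, forall n, (N <= n)%N -> forall z, cn z = 1 ->
    cn (G n z - g z) <= e.

Lemma ucvg_same g (M : R) : (forall z, cn z = 1 -> cn (g z) <= M) ->
  circle_ucvg (fun=> g) g.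
Proof.
move=> hM; split; first by exists M.
by move=> e e0; exists 0%N => n _ z _; rewrite subrr cn0 ltW.
Qed.

Lemma ucvg_cst A a : A @ \oo --> a -> circle_ucvg (fun n _ => A n) (fun=> a).
Proof.
move=> /cvgC_P h; split; first by exists (cn a) => z _.
by move=> e /h[N hN]; exists N => n /hN /ltW.
Qed.

Lemma ucvg_mul G g H h : circle_ucvg G g -> circle_ucvg H h ->
  circle_ucvg (fun n z => G n z * H n z) (fun z => g z * h z).
Proof.
move=> [[M0 hM0] cG] [[N0 hN0] cH].
have M00 : 0 <= M0 by exact: le_trans (cn_ge0 _) (hM0 _ (@cn1 R)).
have N00 : 0 <= N0 by exact: le_trans (cn_ge0 _) (hN0 _ (@cn1 R)).
split; first by exists (M0 * N0) => z z1; rewrite cnM; apply: ler_pM; rewrite ?cn_ge0 ?hM0 ?hN0.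
move=> e e0; have [n1 h1] := cH _ ltr01.
pose e3 := e / 2 / (N0 + 1 + 1); have e3_0 : 0 < e3 by rewrite !divr_gt0 //; lra.
have [n3 h3] := cG _ e3_0.
have e4_0 : 0 < e / 2 / (M0 + 1) by rewrite !divr_gt0 //; lra.
have [n4 h4] := cH _ e4_0.
exists (maxn n1 (maxn n3 n4)) => n; rewrite !geq_max => /andP[l1 /andP[l3 l4]] z z1.
have -> : G n z * H n z - g z * h z = (G n z - g z) * H n z + g z * (H n z - h z) by ring.
apply: le_trans (cnD _ _) _; rewrite !cnM [e]splitr; apply: lerD.
  apply: (@le_trans _ _ (e / 2 / (N0 + 1 + 1) * (N0 + 1 + 1))); last by rewrite divfK //; lra.
  apply: ler_pM; rewrite ?cn_ge0 //; first exact: h3 _ l3 _ z1.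
  rewrite -[H n z](subrK (h z)); apply: le_trans (cnD _ _) _.
  by have := h1 _ l1 _ z1; have := hN0 _ z1; lra.
apply: (@le_trans _ _ ((M0 + 1) * (e / 2 / (M0 + 1)))); last by rewrite mulrC divfK //; lra.
apply: ler_pM; rewrite ?cn_ge0 //; last exact: h4.
by apply: le_trans (hM0 _ z1) _; lra.
Qed.

Lemma ucvg_1sub G g : circle_ucvg G g -> circle_ucvg (fun n z => 1 - G n z) (fun z => 1 - g z).
Proof.
move=> [[M hM] cG]; split.
  by exists (1 + M) => z z1; apply: le_trans (cnB _ _) _; rewrite cn1 lerD2l hM.
move=> e /cG[N hN]; exists N => n /hN hn z z1.
have -> : 1 - G n z - (1 - g z) = - (G n z - g z) by ring.
by rewrite cnN hn.
Qed.

Lemma ucvg_qpoch m G g Q q : circle_ucvg G g -> Q @ \oo --> q ->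
  circle_ucvg (fun n z => qpoch m (G n z) (Q n)) (fun z => qpoch m (g z) q).
Proof.
move=> cG cQ.
have cQk k : circle_ucvg (fun n _ => Q n ^+ k) (fun=> q ^+ k).
  elim: k => [|k IH]; first exact: (ucvg_cst (cvg_cst (1 : C))).
  by under eq_fun => n do under eq_fun => z do rewrite exprS;
     under [X in circle_ucvg _ X]eq_fun => z do rewrite exprS;
     apply: ucvg_mul => //; exact: ucvg_cst.
elim: m => [|m IH].
  under eq_fun => n do under eq_fun => z do rewrite qpoch0.
  under [X in circle_ucvg _ X]eq_fun => z do rewrite qpoch0.
  exact: (ucvg_cst (cvg_cst (1 : C))).
under eq_fun => n do under eq_fun => z do rewrite qpochSr.
under [X in circle_ucvg _ X]eq_fun => z do rewrite qpochSr.
by apply: ucvg_mul => //; apply: ucvg_1sub; apply: ucvg_mul.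
Qed.

Section QLimits.
Variables (G : nat -> C -> C) (g : C -> C) (Q : nat -> C) (q : C) (s r : R).
Hypotheses (cG : circle_ucvg G g) (cQ : Q @ \oo --> q).
Hypotheses (Gs : forall n z, cn z = 1 -> cn (G n z) <= s).
Hypotheses (gs : forall z, cn z = 1 -> cn (g z) <= s).
Hypotheses (Qr : forall n, cn (Q n) <= r) (qr : cn q <= r) (r1 : r < 1).

Let s0 : 0 <= s := le_trans (cn_ge0 _) (gs (@cn1 R)).
Let r0 : 0 <= r := le_trans (cn_ge0 _) qr.

Lemma ucvg_qpoch_inf :
  circle_ucvg (fun n z => qpoch_inf (G n z) (Q n)) (fun z => qpoch_inf (g z) q).
Proof.
split; first by exists (qbound s r) => z z1; apply: qpoch_inf_bound => //; exact: gs.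
move=> e e0; have e3 : 0 < e / 3 by rewrite divr_gt0.
have [m hm] := qpoch_inf_uniform r1 r0 s0 e3.
have [_ /(_ _ e3)[N hN]] := ucvg_qpoch m cG cQ; exists N => n /hN hn z z1.
apply: le_trans (cn_dist _ _ (qpoch m (G n z) (Q n))) _.
have A1 := hm (G n z) (Q n) (Gs n z1) (Qr n).
have A2 := hm (g z) q (gs z1) qr; rewrite cn_sub in A2.
have A3 := cn_dist (qpoch m (G n z) (Q n)) (qpoch_inf (g z) q) (qpoch m (g z) q).
have A4 := hn z z1; lra.
Qed.

Lemma ucvg_qpoch_infV : s < 1 ->
  circle_ucvg (fun n z => (qpoch_inf (G n z) (Q n))^-1) (fun z => (qpoch_inf (g z) q)^-1).
Proof.
move=> s1; split.
  by exists (qbound_inv s r) => z z1; apply: qpoch_inf_inv_bound => //; exact: gs.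
move=> e e0; pose B := qbound_inv s r; have B0 : 0 < B ^+ 2 by rewrite exprn_gt0 ?expR_gt0.
have [_ /(_ _ (divr_gt0 e0 B0))[N hN]] := ucvg_qpoch_inf; exists N => n /hN hn z z1.
have q1 := le_lt_trans qr r1.
apply: (@le_trans _ _ (B ^+ 2 * cn (qpoch_inf (G n z) (Q n) - qpoch_inf (g z) q))).
  apply: invB_bound.
  - by apply: qpoch_inf_neq0; [exact: le_lt_trans (Gs n z1) s1|exact: le_lt_trans (Qr n) r1].
  - by apply: qpoch_inf_neq0; [exact: le_lt_trans (gs z1) s1|].
  - by apply: qpoch_inf_inv_bound => //; exact: Gs.
  - by apply: qpoch_inf_inv_bound => //; exact: gs.
by rewrite mulrC -ler_pdivlMr //; exact: hn.
Qed.

End QLimits.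

Section Weights.
Variables (A Q : nat -> C) (a b c d q : C) (s r : R).
Hypotheses (cA : A @ \oo --> a) (cQ : Q @ \oo --> q).
Hypotheses (As : forall n, cn (A n) <= s) (as_ : cn a <= s).
Hypotheses (bs : cn b <= s) (cs : cn c <= s) (ds : cn d <= s) (s1 : s < 1).
Hypotheses (Qr : forall n, cn (Q n) <= r) (qr : cn q <= r) (r1 : r < 1).

Lemma ucvg_half_weight (u : C -> C) : (forall z, cn z = 1 -> cn (u z) = 1) ->
  circle_ucvg (fun n z => half_weight (A n) b c d (Q n) (u z))
    (fun z => half_weight a b c d q (u z)).
Proof.
move=> u1; rewrite /half_weight.
have cu : circle_ucvg (fun=> u) u by apply: (@ucvg_same u 1) => z /u1 ->.
have E (X : nat -> C) x : X @ \oo --> x -> (forall n, cn (X n) <= s) -> cn x <= s ->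
  circle_ucvg (fun n z => (qpoch_inf (X n * u z) (Q n))^-1) (fun z => (qpoch_inf (x * u z) q)^-1).
  move=> cX Xs xs; apply: (@ucvg_qpoch_infV _ _ _ _ s r) => //.
  - by apply: ucvg_mul => //; exact: ucvg_cst.
  - by move=> n z z1; rewrite cnM u1 // mulr1.
  - by move=> z z1; rewrite cnM u1 // mulr1.
apply: ucvg_mul.
  apply: (@ucvg_qpoch_inf _ _ _ _ 1 r) => //.
  - by apply: (@ucvg_same _ 1) => z z1; rewrite cnX u1 // expr1n.
  - by move=> n z z1; rewrite cnX u1 // expr1n.
  - by move=> z z1; rewrite cnX u1 // expr1n.
have Ec (x : C) (xs : cn x <= s) := E (fun=> x) x (cvg_cst x) (fun=> xs) xs.
apply: ucvg_mul; last exact: Ec.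
apply: ucvg_mul; last exact: Ec.
by apply: ucvg_mul; [exact: (E A a cA As as_)|exact: Ec].
Qed.

Lemma ucvg_full_weight :
  circle_ucvg (fun n => full_weight (A n) b c d (Q n)) (full_weight a b c d q).
Proof.
apply: ucvg_mul; first by apply: (@ucvg_half_weight id).
by apply: ucvg_half_weight => z z1; rewrite cnV z1 invr1.
Qed.

Lemma cvg_mean_full_weight (p : C -> C) : circ_continuous p ->
  (exists M : R, forall z, cn z = 1 -> cn (p z) <= M) ->
  (fun n => circle_mean (fun z => full_weight (A n) b c d (Q n) z * p z)) @ \oo -->
  circle_mean (fun z => full_weight a b c d q z * p z).
Proof.
move=> cp [M hM]; have lt x : cn x <= s -> cn x < 1 by move=> h; exact: le_lt_trans h s1.
apply: circle_mean_cvg.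
- move=> n; apply: circM => //; apply: circ_full_weight; try by apply: lt.
  exact: le_lt_trans (Qr n) r1.
- apply: circM => //; apply: circ_full_weight; try by apply: lt.
  exact: le_lt_trans qr r1.
- by have [_ ] := ucvg_mul ucvg_full_weight (ucvg_same hM).
Qed.

End Weights.
End UniformCvg.

Local Opaque qpoch_inf circle_mean.

Section AskeyWilsonIntegral.
Variable R : realType.
Local Notation C := (Cplx R).
Implicit Types (a b c d q s z : C).

Lemma cvg_expC q : cn q < 1 -> (fun n => q ^+ n) @ \oo --> (0 : C).
Proof.
move=> q1; apply/cvgC_P => e e0.
have [N hN] := pow_small (cn_ge0 q) q1 e0; exists N => n /hN.
by rewrite subr0 cnX.
Qed.

Lemma cn_expq_le q n : cn q < 1 -> cn (q ^+ n) <= 1.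
Proof. by move=> q1; rewrite cnX exprn_ile1 ?cn_ge0 // ltW. Qed.

Lemma cn_mul_lt1 a b : cn a < 1 -> cn b < 1 -> cn (a * b) < 1.
Proof. by move=> a1 b1; rewrite cnM mulr_ilt1 ?cn_ge0. Qed.

Lemma cn_mul_expq_lt1 a q n : cn a < 1 -> cn q < 1 -> cn (a * q ^+ n) < 1.
Proof.
move=> a1 q1; rewrite cnM; apply: le_lt_trans a1.
by rewrite ler_piMr ?cn_ge0 ?cn_expq_le.
Qed.

Lemma weight_mass_perm a b c d q :
  [/\ weight_mass a b c d q = weight_mass b a c d q,
      weight_mass a b c d q = weight_mass c b a d q &
      weight_mass a b c d q = weight_mass d b c a q].
Proof.
have H z : [/\ half_weight a b c d q z = half_weight b a c d q z,
    half_weight a b c d q z = half_weight c b a d q z &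
    half_weight a b c d q z = half_weight d b c a q z].
  rewrite /half_weight; move: (qpoch_inf (a * z) q)^-1 (qpoch_inf (b * z) q)^-1
    (qpoch_inf (c * z) q)^-1 (qpoch_inf (d * z) q)^-1 => x y w t.
  by split; ring.
by split; apply: eq_circle_mean => z _; rewrite /full_weight;
  have [e1 e2 e3] := H z; have [f1 f2 f3] := H z^-1; congr (_ * _).
Qed.

Section Params.
Variable q : C.
Hypothesis q1 : cn q < 1.
Local Notation Qi x := (qpoch_inf x q).

Lemma weight_mass_iter a b c d n :
  cn a < 1 -> cn b < 1 -> cn c < 1 -> cn d < 1 ->
  qpoch n (a * b * c * d) q * weight_mass (a * q ^+ n) b c d q =
  qpoch n (a * b) q * qpoch n (a * c) q * qpoch n (a * d) q * weight_mass a b c d q.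
Proof.
move=> a1 b1 c1 d1; elim: n => [|n IH]; first by rewrite !qpoch0 expr0 !mulr1 !mul1r.
have := weight_mass_shift (cn_mul_expq_lt1 n a1 q1) b1 c1 d1 q1.
rewrite !qpochSr exprSr [a * (q ^+ n * q)]mulrA => h.
transitivity (qpoch n (a * b * c * d) q * ((1 - a * q ^+ n * b * c * d) * weight_mass (a * q ^+ n * q) b c d q)).
  by ring.
rewrite h; transitivity ((1 - a * q ^+ n * b) * (1 - a * q ^+ n * c) * (1 - a * q ^+ n * d) *
  (qpoch n (a * b * c * d) q * weight_mass (a * q ^+ n) b c d q)); first by ring.
by rewrite IH; ring.
Qed.

(** The limit of [weight_mass_iter]. A common bound [s < 1] on the parameters makes the weights
    converge uniformly, so the limit passes under the mean. *)
Lemma weight_mass_elim a b c d : cn a < 1 -> cn b < 1 -> cn c < 1 -> cn d < 1 ->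
  Qi (a * b * c * d) * weight_mass 0 b c d q =
  Qi (a * b) * Qi (a * c) * Qi (a * d) * weight_mass a b c d q.
Proof.
move=> a1 b1 c1 d1.
pose s := Num.max (cn a) (Num.max (cn b) (Num.max (cn c) (cn d))).
have s1 : s < 1 by rewrite !gt_max a1 b1 c1 d1.
have as_ : cn a <= s by rewrite !le_max lexx.
have bs : cn b <= s by rewrite !le_max lexx !orbT.
have cs : cn c <= s by rewrite !le_max lexx !orbT.
have ds : cn d <= s by rewrite !le_max lexx !orbT.
have cA : (fun n => a * q ^+ n) @ \oo --> (0 : C).
  by rewrite -[0](mulr0 a); apply: cvgM; [exact: cvg_cst|exact: cvg_expC].
have As n : cn (a * q ^+ n) <= s.
  by rewrite cnM; apply: le_trans as_; rewrite ler_piMr ?cn_ge0 ?cn_expq_le.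
have s0 : cn (0 : C) <= s by rewrite cn0; exact: le_trans (cn_ge0 a) as_.
have cm : (fun n => weight_mass (a * q ^+ n) b c d q) @ \oo --> weight_mass 0 b c d q.
  have M1 : exists M : R, forall z, cn z = 1 -> cn (1 : C) <= M by exists 1 => z _; rewrite cn1.
  have h := @cvg_mean_full_weight R _ (fun=> q) 0 b c d q s (cn q) cA (cvg_cst q) As s0 bs cs ds s1
    (fun=> lexx _) (lexx _) q1 (fun=> 1) (circ_cst 1) M1.
  have e x : weight_mass x b c d q = circle_mean (fun z => full_weight x b c d q z * 1).
    by apply: eq_circle_mean => z _; rewrite mulr1.
  by rewrite (e 0); apply: cvgC_ext (h _) => n; rewrite -e.
have l1 : (fun n => qpoch n (a * b * c * d) q * weight_mass (a * q ^+ n) b c d q) @ \oo -->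
   Qi (a * b * c * d) * weight_mass 0 b c d q by apply: cvgM; [exact: qpoch_cvg|exact: cm].
apply: (cvgC_unique l1).
apply: (cvgC_ext (fun n => esym (weight_mass_iter n a1 b1 c1 d1))).
apply: cvgM; last exact: cvg_cst.
apply: cvgM; last exact: qpoch_cvg.
by apply: cvgM; exact: qpoch_cvg.
Qed.

(** The mass is symmetric, so the four parameters can be sent to 0 in turn; a product containing a
    parameter that is already 0 contributes [qpoch_inf 0 q = 1]. *)
Lemma weight_mass_reduce a b c d : cn a < 1 -> cn b < 1 -> cn c < 1 -> cn d < 1 ->
  weight_mass a b c d q * (Qi (a * b) * Qi (a * c) * Qi (a * d) * Qi (b * c) * Qi (b * d) * Qi (c * d)) =
  Qi (a * b * c * d) * weight_mass 0 0 0 0 q.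
Proof.
move=> a1 b1 c1 d1; have z1 : cn (0 : C) < 1 by rewrite cn0.
have h1 := weight_mass_elim a1 b1 c1 d1.
have h2 := weight_mass_elim b1 z1 c1 d1.
have h3 := weight_mass_elim c1 z1 z1 d1.
have h4 := weight_mass_elim d1 z1 z1 z1.
have Q0 := qpoch_inf0 q1.
have m0 (x : C) : x * 0 = 0 by exact: mulr0.
have m1 (x : C) : 0 * x = 0 by exact: mul0r.
have m2 : b * 0 * c * d = 0 by rewrite m0 ?m1 ?m1 ?m1.
have m3 : c * 0 * 0 * d = 0 by rewrite m0 ?m1 ?m1 ?m1.
have m4 : d * 0 * 0 * 0 = 0 by rewrite m0 ?m1 ?m1 ?m1.
rewrite m2 (m0 b) Q0 mul1r mul1r in h2.
rewrite m3 (m0 c) Q0 mul1r mul1r mul1r in h3.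
rewrite m4 (m0 d) Q0 mul1r mul1r mul1r mul1r in h4.
have [e2 _ _] := weight_mass_perm b 0 c d q.
have [_ e3 _] := weight_mass_perm c 0 0 d q.
have [_ _ e4] := weight_mass_perm d 0 0 0 q.
rewrite e2 in h2; rewrite e3 in h3; rewrite e4 in h4.
set W := weight_mass 0 0 0 0 q in h4 *.
transitivity ((Qi (a * b) * Qi (a * c) * Qi (a * d) * weight_mass a b c d q) *
  (Qi (b * c) * Qi (b * d)) * Qi (c * d)); first by ring.
rewrite -h1; transitivity (Qi (a * b * c * d) *
  ((Qi (b * c) * Qi (b * d) * weight_mass 0 b c d q) * Qi (c * d))); first by ring.
by rewrite -h2 h4 h3; ring.
Qed.

End Params.
End AskeyWilsonIntegral.

(** * The total mass in closed form *)

Section Normalisation.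
Variable R : realType.
Local Notation C := (Cplx R).
Implicit Types (a b c d q s z : C).

(** Opposite arguments combine to squares: the pair with [q z] gives the factors [1 - q^(2j+2) z^2],
    the pair with [s z] the factors [1 - q^(2j+1) z^2]. *)
Lemma qpoch_duplication n s q z : s ^+ 2 = q ->
  qpoch n (q * z) q * qpoch n (- q * z) q * (qpoch n (s * z) q * qpoch n (- s * z) q) =
  qpoch n.*2 (q * z ^+ 2) q.
Proof.
move=> sq; elim: n => [|n IH]; first by rewrite !qpoch0 !mulr1.
rewrite doubleS !qpochSr -IH -addnn [q ^+ _.+1]exprS exprD.
move: (q ^+ n) (qpoch _ _ _) (qpoch _ _ _) (qpoch _ _ _) (qpoch _ _ _) => Q x y w t.
by rewrite -sq; ring.
Qed.

Section Params.
Variables (q s : C).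
Hypotheses (q1 : cn q < 1) (sq : s ^+ 2 = q).
Local Notation Qi x := (qpoch_inf x q).

Lemma cn_sqrt_lt1 : cn s < 1.
Proof.
rewrite ltNge; apply/negP => h; move: q1; rewrite -sq cnX ltNge => /negP; apply.
by rewrite -[1](expr1n _ 2) lerXn2r // nnegrE // cn_ge0.
Qed.

Lemma qpoch_inf_duplication z :
  Qi (q * z) * Qi (- q * z) * (Qi (s * z) * Qi (- s * z)) = Qi (q * z ^+ 2).
Proof.
have l1 : (fun n => qpoch n (q * z) q * qpoch n (- q * z) q *
    (qpoch n (s * z) q * qpoch n (- s * z) q)) @ \oo -->
    Qi (q * z) * Qi (- q * z) * (Qi (s * z) * Qi (- s * z)).
  by apply: cvgM; apply: cvgM; exact: qpoch_cvg.
apply: (cvgC_unique l1); apply: (cvgC_ext (fun n => esym (qpoch_duplication n z sq))).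
have /cvgC_P h := @qpoch_cvg R (q * z ^+ 2) q q1; apply/cvgC_P => x /h[N hN].
by exists N => n Nn; apply: hN; rewrite -addnn; exact: leq_trans Nn (leq_addr _ _).
Qed.

(** Euler's product identity: duplication at [z = 1] has the nonzero factor [(q; q)_oo] on both
    sides. *)
Lemma euler_qpoch_inf : Qi (- q) * (Qi s * Qi (- s)) = 1.
Proof.
have := qpoch_inf_duplication 1; rewrite expr1n !mulr1 => h.
have n0 : Qi q != 0 by exact: qpoch_inf_neq0.
by apply: (mulfI n0); rewrite mulr1 -[RHS]h; ring.
Qed.

Lemma special_half_weight z : cn z = 1 -> half_weight q (- q) s (- s) q z = 1 - z ^+ 2.
Proof.
move=> z1; rewrite /half_weight.
have s1 := cn_sqrt_lt1.
have n1 x : cn x < 1 -> Qi (x * z) != 0.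
  by move=> x1; apply: qpoch_inf_neq0 => //; rewrite cnM z1 mulr1.
have h := qpoch_inf_duplication z.
have hq := n1 q q1; have hs := n1 s s1.
have hNq : Qi (- q * z) != 0 by apply: n1; rewrite cnN.
have hNs : Qi (- s * z) != 0 by apply: n1; rewrite cnN.
rewrite (qpoch_infS (z ^+ 2) q1).
have -> : z ^+ 2 * q = q * z ^+ 2 by ring.
rewrite -h; move: (Qi (q * z)) (Qi (- q * z)) (Qi (s * z)) (Qi (- s * z)) hq hNq hs hNs
  => x y w t x0 y0 w0 t0.
by field; rewrite x0 y0 w0 t0.
Qed.

Lemma special_weight_mass : weight_mass q (- q) s (- s) q = 2.
Proof.
rewrite /weight_mass (eq_circle_mean (h := fun z => 2 + (-1 * z ^+ 2 + -1 * z^-1 ^+ 2))) => [|z z1].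
  have c1 : circ_continuous (fun z : C => -1 * z ^+ 2).
    by apply: circM; [exact: circ_cst|apply: circX; exact: circ_id].
  have c2 : circ_continuous (fun z : C => -1 * z^-1 ^+ 2).
    by apply: circM; [exact: circ_cst|apply: circX; exact: circ_inv].
  rewrite circle_meanD; [|exact: circ_cst|exact: circD].
  rewrite circle_mean_cst circle_meanD // circle_meanZ; last by apply: circX; exact: circ_id.
  rewrite circle_meanZ; last by apply: circX; exact: circ_inv.
  by rewrite circle_mean_exp circle_mean_expV !mulr0 !addr0.
have z0 : z != 0 by rewrite -cn_gt0 z1.
have zV1 : cn z^-1 = 1 by rewrite cnV z1 invr1.
rewrite /full_weight (special_half_weight z1) (special_half_weight zV1).
by field.
Qed.

Lemma weight_mass0 : weight_mass 0 0 0 0 q * Qi q = 2.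
Proof.
have s1 := cn_sqrt_lt1.
have Nq1 : cn (- q) < 1 by rewrite cnN.
have Ns1 : cn (- s) < 1 by rewrite cnN.
have := weight_mass_reduce q1 q1 Nq1 s1 Ns1; rewrite special_weight_mass.
have -> : q * - q = - q * q by ring.
have -> : q * - s = - s * q by ring.
have -> : - q * s = - s * q by ring.
have -> : - q * - s = s * q by ring.
have -> : q * s = s * q by ring.
have -> : s * - s = - q by rewrite -sq; ring.
have -> : - q * q * s * - s = q * q * q by rewrite -[in RHS]sq -[in LHS]sq; ring.
have e1 := qpoch_infS q q1; have e2 := qpoch_infS (q * q) q1.
have e3 := qpoch_infS (- q) q1.
have e4 := qpoch_infS s q1; have e5 := qpoch_infS (- s) q1.
have E := euler_qpoch_inf.
rewrite e1 e2; rewrite e4 e5 in E.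
move: (Qi (q * q * q)) (Qi (s * q)) (Qi (- s * q)) (Qi (- q)) (Qi (- q * q))
  (weight_mass 0 0 0 0 q) e3 E => x u v N y W e3 E h.
(* Euler's identity with the first factors of the products at [s] and [- s] split off, as
   [(1 - s) (1 + s) = 1 - q]. *)
have E' : N * u * v * (1 - q) = 1 by rewrite -[RHS]E -sq; ring.
transitivity ((1 - q) * (1 - q * q) * (x * W)); first by ring.
rewrite -h; transitivity (2 * (N * u * v * (1 - q)) * ((1 - - q) * y * u * v * (1 - q))).
  by ring.
by rewrite -e3 E' !mulr1.
Qed.

End Params.

Section Moments.
Variables (a b c d q : C).
Hypotheses (a1 : cn a < 1) (b1 : cn b < 1) (c1 : cn c < 1) (d1 : cn d < 1) (q1 : cn q < 1).
Local Notation Qi x := (qpoch_inf x q).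

Lemma aw_h0E : aw_h0 a b c d q = Qi (a * b * c * d) /
  (Qi q * (Qi (a * b) * Qi (a * c) * Qi (a * d) * Qi (b * c) * Qi (b * d) * Qi (c * d))).
Proof.
rewrite /aw_h0 /qpochs_inf !big_cons big_nil mulr1.
by congr (_ / _); rewrite !mulrA.
Qed.

(** The factor 2 is compensated by [4 pi i], instead of [2 pi i], in the contour integral. *)
Lemma weight_mass_h0 : weight_mass a b c d q = 2 * aw_h0 a b c d q.
Proof.
have [s sq] : exists s : C, s ^+ 2 = q by exists (sqrtC q); rewrite sqrtCK.
rewrite aw_h0E; have h := weight_mass_reduce q1 a1 b1 c1 d1.
have h0 := weight_mass0 q1 sq.
have n (x : C) : cn x < 1 -> Qi x != 0 by move=> x1; exact: qpoch_inf_neq0.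
have n1 := n _ q1.
have n2 : Qi (a * b) * Qi (a * c) * Qi (a * d) * Qi (b * c) * Qi (b * d) * Qi (c * d) != 0.
  by rewrite !mulf_neq0 // n // cn_mul_lt1.
move: (Qi (a * b) * _ * _ * _ * _ * _) (Qi (a * b * c * d)) (Qi q)
  (weight_mass 0 0 0 0 q) h h0 n1 n2 => x y t W h h0 n1 n2.
apply: (mulIf n2); rewrite h -h0; field.
by rewrite n1 n2.
Qed.

Lemma aw_h0_neq0 : aw_h0 a b c d q != 0.
Proof.
have n (x : C) : cn x < 1 -> Qi x != 0 by move=> x1; exact: qpoch_inf_neq0.
rewrite aw_h0E mulf_neq0 ?invr_neq0 //.
  by apply: n; do 3?apply: cn_mul_lt1.
by rewrite !mulf_neq0 // n // cn_mul_lt1.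
Qed.

Lemma aw_wE z : aw_w a b c d q z = full_weight a b c d q z / aw_h0 a b c d q.
Proof.
rewrite /aw_w /full_weight /half_weight /qpochs_inf !big_cons !big_nil !mulr1 -exprVn !invfM.
move: (Qi (z ^+ 2)) (Qi (z^-1 ^+ 2)) (aw_h0 a b c d q)^-1
  (Qi (a * z))^-1 (Qi (b * z))^-1 (Qi (c * z))^-1
  (Qi (d * z))^-1 (Qi (a / z))^-1 (Qi (b / z))^-1
  (Qi (c / z))^-1 (Qi (d / z))^-1 => x1 x2 x3 x4 x5 x6 x7 x8 x9 x10 x11.
by ring.
Qed.

Lemma circ_jouk n : circ_continuous (fun z : C => ((z + z^-1) / 2) ^+ n).
Proof.
apply: circX; apply: circM; last exact: circ_cst.
by apply: circD; [exact: circ_id|exact: circ_inv].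
Qed.

Lemma aw_momentE n : aw_moment_integral n a b c d q =
  (2 * aw_h0 a b c d q)^-1 *
  circle_mean (fun z => full_weight a b c d q z * ((z + z^-1) / 2) ^+ n).
Proof.
have cF : circ_continuous (fun z => full_weight a b c d q z * ((z + z^-1) / 2) ^+ n).
  by apply: circM; [exact: circ_full_weight|exact: circ_jouk].
have p0 : pi%:C%C != 0 :> C by rewrite -cn_eq0 cn_real normr_eq0 gt_eqF // pi_gt0.
have h0 := aw_h0_neq0.
have i0 : ('i : C) != 0 by exact: neq0Ci.
rewrite /aw_moment_integral /unit_circle_integral.
have -> : (fun t : R => (4 * pi%:C%C * 'i * cis t)^-1 * aw_w a b c d q (cis t) *
    ((cis t + (cis t)^-1) / 2) ^+ n * ('i * cis t)) =
  (fun t : R => (fun z => (4 * pi%:C%C * aw_h0 a b c d q)^-1 *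
    (full_weight a b c d q z * ((z + z^-1) / 2) ^+ n)) (cis t)).
  apply/funext => t; rewrite aw_wE; have z0 : cis t != 0 :> C := cis_neq0 t.
  move: (cis t) (full_weight a b c d q (cis t)) (_ ^+ n) (pi%:C%C : C) ('i : C)
    p0 i0 z0 => z x y p i p0 i0 z0.
  by field; rewrite z0 p0 i0 h0.
rewrite (@cintegral_circle R (fun z => (4 * pi%:C%C * aw_h0 a b c d q)^-1 *
    (full_weight a b c d q z * ((z + z^-1) / 2) ^+ n))) circle_meanZ //.
have -> : (2 * pi)%:C%C = 2 * pi%:C%C :> C by rewrite rmorphM rmorph_nat.
move: (circle_mean _) (pi%:C%C : C) p0 => x p p0.
by field; rewrite p0 h0.
Qed.

End Moments.
End Normalisation.

(** * The moments on the polydisc *)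

Section TableauFormula.
Variable R : realType.
Local Notation C := (Cplx R).
Implicit Types (a b c d q s z : C).

Definition tableau_formula n a b c d q : C :=
  let al := (1 - q) / (1 - a * c + a * 'i + c * 'i) in
  let be := (1 - q) / (1 - b * d - b * 'i - d * 'i) in
  let ga := (1 - q) * a * c / (1 - a * c + a * 'i + c * 'i) in
  let de := (1 - q) * b * d / (1 - b * d - b * 'i - d * 'i) in
  (1 - q) ^+ n / (2 ^+ n * 'i ^+ n * \prod_(j < n) (al * be - ga * de * q ^+ j)) *
    Z n (-1) al be ga de q.

Lemma cn_Ci : cn ('i : C) = 1.
Proof. by rewrite /cn normCi. Qed.

(** The factors are [1 + a i] and [1 + c i], which do not vanish for [a] and [c] in the open
    disc. *)
Lemma denomA a c : 1 - a * c + a * 'i + c * 'i = (1 - a * - 'i) * (1 - c * - 'i) :> C.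
Proof.
transitivity (1 + a * c * 'i ^+ 2 + a * 'i + c * 'i : C); last by ring.
by rewrite sqrCi; ring.
Qed.

Lemma denomB b d : 1 - b * d - b * 'i - d * 'i = (1 - b * 'i) * (1 - d * 'i) :> C.
Proof.
transitivity (1 + b * d * 'i ^+ 2 - b * 'i - d * 'i : C); last by ring.
by rewrite sqrCi; ring.
Qed.

Section Params.
Variables (a b c d q : C).
Hypotheses (a1 : cn a < 1) (b1 : cn b < 1) (c1 : cn c < 1) (d1 : cn d < 1) (q1 : cn q < 1).

Lemma denomA_neq0 : 1 - a * c + a * 'i + c * 'i != 0.
Proof. by rewrite denomA mulf_neq0 // one_sub_neq0 // cnM cnN cn_Ci mulr1. Qed.

Lemma denomB_neq0 : 1 - b * d - b * 'i - d * 'i != 0.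
Proof. by rewrite denomB mulf_neq0 // one_sub_neq0 // cnM cn_Ci mulr1. Qed.

Lemma abcd_neq0 j : 1 - a * b * c * d * q ^+ j != 0.
Proof. by apply: one_sub_neq0; apply: cn_mul_expq_lt1 => //; do 3?apply: cn_mul_lt1. Qed.

Lemma full_weight_basis n z : cn z = 1 ->
  full_weight a b c d q z * (aw_basis a q n).[(z + z^-1) / 2] =
  full_weight (a * q ^+ n) b c d q z.
Proof.
move=> z1; have z0 : z != 0 by rewrite -cn_gt0 z1.
elim: n => [|n IH].
  by rewrite /aw_basis big_ord0 hornerE mulr1 expr0 mulr1.
rewrite /aw_basis big_ord_recr /= -/(aw_basis a q n) hornerM mulrA IH [q ^+ n.+1]exprSr [a * (_ * q)]mulrA.
rewrite (full_weight_mulq b c d (cn_mul_expq_lt1 n a1 q1) q1 z1).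
move: (full_weight (a * q ^+ n) b c d q z) => x; congr (x * _).
rewrite hornerD hornerN hornerC hornerZ hornerX -addnn exprD; move: (q ^+ n) => y.
by field.
Qed.

Lemma moment_functionalE (p : {poly C}) :
  moment_functional (fun i => aw_moment_integral i a b c d q) p =
  (2 * aw_h0 a b c d q)^-1 *
  circle_mean (fun z => full_weight a b c d q z * p.[(z + z^-1) / 2]).
Proof.
have cF i : circ_continuous (fun z => full_weight a b c d q z * ((z + z^-1) / 2) ^+ i).
  by apply: circM; [exact: circ_full_weight|exact: circ_jouk].
rewrite /moment_functional.
rewrite (eq_circle_mean (h := fun z => \sum_(i < size p)
    p`_i * (full_weight a b c d q z * ((z + z^-1) / 2) ^+ i))) => [|z _]; last first.
  by rewrite horner_coef mulr_sumr; apply: eq_bigr => i _; rewrite mulrCA.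
rewrite circle_mean_sum; last first.
  by move=> i; apply: circM; [exact: circ_cst|exact: cF].
rewrite mulr_sumr; apply: eq_bigr => i _.
rewrite (aw_momentE a1 b1 c1 d1 q1) circle_meanZ; last exact: cF.
by move: (circle_mean _) (_^-1) => x y; rewrite mulrCA.
Qed.

Lemma aw_moment_basis n :
  moment_functional (fun i => aw_moment_integral i a b c d q) (aw_basis a q n) *
    \prod_(j < n) (1 - a * b * c * d * q ^+ j) =
  \prod_(j < n) ((1 - a * b * q ^+ j) * (1 - a * c * q ^+ j) * (1 - a * d * q ^+ j)).
Proof.
rewrite moment_functionalE (eq_circle_mean (full_weight_basis n)).
rewrite -/(weight_mass (a * q ^+ n) b c d q) -/(qpoch n (a * b * c * d) q).
transitivity ((2 * aw_h0 a b c d q)^-1 *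
  (qpoch n (a * b * c * d) q * weight_mass (a * q ^+ n) b c d q)); first by rewrite [RHS]mulrA [RHS]mulrAC.
rewrite (weight_mass_iter q1 n a1 b1 c1 d1).
rewrite (weight_mass_h0 a1 b1 c1 d1 q1).
rewrite !big_split -/(qpoch n (a * b) q) -/(qpoch n (a * c) q) -/(qpoch n (a * d) q).
have h0 := aw_h0_neq0 a1 b1 c1 d1 q1.
move: (aw_h0 a b c d q) (qpoch n (a * b) q) (qpoch n (a * c) q) (qpoch n (a * d) q) h0
  => h x y t h0.
by rewrite /=; field.
Qed.

(** Both sides give functionals with the same values on [aw_basis], which has one polynomial in each
    degree because [a] and [q] are nonzero. *)
Lemma generic_moment n : a != 0 -> q != 0 ->
  aw_moment_integral n a b c d q = tableau_formula n a b c d q.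
Proof.
move=> a0 q0; have two : (2 : C) != 0 by rewrite pnatr_eq0.
apply: (@moment_functional_basis_inj _ (aw_basis a q) (fun i => aw_moment_integral i a b c d q)
  (fun i => tableau_formula i a b c d q)) => m; first exact: size_aw_basis.
have nz : \prod_(j < m) (1 - a * b * c * d * q ^+ j) != 0.
  by apply/prodf_neq0 => j _; exact: abcd_neq0.
apply: (mulIf nz); rewrite aw_moment_basis.
have q1' : 1 - q != 0 by exact: one_sub_neq0.
rewrite -(words_moment_basis (sqrCi C) two denomA_neq0 denomB_neq0 q1' abcd_neq0).
congr (_ * _); rewrite /moment_functional; apply: eq_bigr => i _.
by rewrite /tableau_formula tableaux_words.
Qed.

End Params.

Lemma cvgC_prod (I : Type) (r : seq I) (P : pred I) (F : I -> nat -> C) (f : I -> C) :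
  (forall i, P i -> F i @ \oo --> f i) ->
  (fun n => \prod_(i <- r | P i) F i n) @ \oo --> \prod_(i <- r | P i) f i.
Proof. exact: (cvg_big (@mul_continuous C)). Qed.

Lemma cvgC_sum (I : Type) (r : seq I) (P : pred I) (F : I -> nat -> C) (f : I -> C) :
  (forall i, P i -> F i @ \oo --> f i) ->
  (fun n => \sum_(i <- r | P i) F i n) @ \oo --> \sum_(i <- r | P i) f i.
Proof. exact: (cvg_big (@add_continuous C)). Qed.

Lemma cvgC_exp (u : nat -> C) (l : C) n : u @ \oo --> l -> (fun k => u k ^+ n) @ \oo --> l ^+ n.
Proof.
move=> h; elim: n => [|n IH].
  by rewrite expr0; under eq_fun => k do rewrite expr0; exact: cvg_cst.
have -> : (fun k => u k ^+ n.+1) = (fun k => u k * u k ^+ n).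
  by apply/funext => k; rewrite exprS.
by rewrite exprS; apply: cvgM; [exact: h|exact: IH].
Qed.

Section Continuity.
Variables (A Q : nat -> C) (a b c d q : C) (s r : R).
Hypotheses (cA : A @ \oo --> a) (cQ : Q @ \oo --> q).
Hypotheses (As : forall n, cn (A n) <= s) (as_ : cn a <= s) (s1 : s < 1).
Hypotheses (b1 : cn b < 1) (c1 : cn c < 1) (d1 : cn d < 1).
Hypotheses (Qr : forall n, cn (Q n) <= r) (qr : cn q <= r) (r1 : r < 1).

Lemma cvg_tableau_formula n :
  (fun k => tableau_formula n (A k) b c d (Q k)) @ \oo --> tableau_formula n a b c d q.
Proof.
have a1 : cn a < 1 := le_lt_trans as_ s1.
have q1 : cn q < 1 := le_lt_trans qr r1.
have cst (x : C) : (fun=> x) @ \oo --> x by exact: cvg_cst.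
have c1Q : (fun k => 1 - Q k) @ \oo --> 1 - q by apply: cvgB; [exact: cst|exact: cQ].
pose dA x : C := 1 - x * c + x * 'i + c * 'i.
pose dB : C := 1 - b * d - b * 'i - d * 'i.
have cdA : (fun k => (dA (A k))^-1) @ \oo --> (dA a)^-1.
  apply: cvgV; first exact: denomA_neq0.
  apply: cvgD; last exact: cst.
  apply: cvgD; last by apply: cvgM; [exact: cA|exact: cst].
  by apply: cvgB; [exact: cst|apply: cvgM; [exact: cA|exact: cst]].
pose al x t := (1 - t) / dA x; pose be t := (1 - t) / dB.
pose ga x t := (1 - t) * x * c / dA x; pose de t := (1 - t) * b * d / dB.
have cal : (fun k => al (A k) (Q k)) @ \oo --> al a q.
  by apply: cvgM; [exact: c1Q|exact: cdA].
have cbe : (fun k => be (Q k)) @ \oo --> be q.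
  by apply: cvgM; [exact: c1Q|exact: cst].
have cga : (fun k => ga (A k) (Q k)) @ \oo --> ga a q.
  apply: cvgM; last exact: cdA.
  by apply: cvgM; [apply: cvgM; [exact: c1Q|exact: cA]|exact: cst].
have cde : (fun k => de (Q k)) @ \oo --> de q.
  by do 2!(apply: cvgM; last exact: cst); apply: cvgM; [exact: c1Q|exact: cst].
have cP : (fun k => \prod_(j < n) (al (A k) (Q k) * be (Q k) -
    ga (A k) (Q k) * de (Q k) * Q k ^+ j)) @ \oo -->
    \prod_(j < n) (al a q * be q - ga a q * de q * q ^+ j).
  apply: cvgC_prod => j _; apply: cvgB; first by apply: cvgM; [exact: cal|exact: cbe].
  apply: cvgM; last exact: cvgC_exp.
  by apply: cvgM; [exact: cga|exact: cde].
have cZ : (fun k => Z n (-1) (al (A k) (Q k)) (be (Q k)) (ga (A k) (Q k)) (de (Q k)) (Q k))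
   @ \oo --> Z n (-1) (al a q) (be q) (ga a q) (de q) q.
  apply: cvgC_sum => T _; apply: cvgM; last exact: cst.
  apply: cvgC_prod => x _; case: (T x) => [[]|].
  - exact: cal.
  - exact: cbe.
  - exact: cga.
  - exact: cde.
  - by case: (assigned_q T x); [exact: cQ|exact: cst].
apply: cvgM; last exact: cZ.
apply: cvgM; first by apply: cvgC_exp; exact: c1Q.
apply: cvgV; last by apply: cvgM; [exact: cst|exact: cP].
rewrite !mulf_neq0 ?expf_neq0 ?pnatr_eq0 ?neq0Ci //.
apply/prodf_neq0 => j _.
have q1' : 1 - q != 0 by exact: one_sub_neq0.
exact: (lam_neq0 (denomA_neq0 a1 c1) (denomB_neq0 b1 d1) q1' (abcd_neq0 a1 b1 c1 d1 q1)).
Qed.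

Lemma cvg_qpoch_inf (X : nat -> C) x (t : R) : X @ \oo --> x ->
  (forall n, cn (X n) <= t) -> cn x <= t ->
  (fun k => qpoch_inf (X k) (Q k)) @ \oo --> qpoch_inf x q.
Proof.
move=> cX Xt xt.
have [_ H] := @ucvg_qpoch_inf R (fun n _ => X n) (fun=> x) Q q t r (ucvg_cst cX) cQ
  (fun n z _ => Xt n) (fun z _ => xt) Qr qr r1.
apply/cvgC_P => e e0; have e2 : 0 < e / 2 by rewrite divr_gt0.
have [N hN] := H _ e2; exists N => n Nn.
by have := hN n Nn 1 (@cn1 R); lra.
Qed.

Lemma cvg_aw_moment_integral n :
  (fun k => aw_moment_integral n (A k) b c d (Q k)) @ \oo --> aw_moment_integral n a b c d q.
Proof.
have a1 : cn a < 1 := le_lt_trans as_ s1.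
have q1 : cn q < 1 := le_lt_trans qr r1.
have A1 k : cn (A k) < 1 := le_lt_trans (As k) s1.
have Q1 k : cn (Q k) < 1 := le_lt_trans (Qr k) r1.
apply: (cvgC_ext (fun k => esym (aw_momentE (A1 k) b1 c1 d1 (Q1 k) n))).
rewrite (aw_momentE a1 b1 c1 d1 q1).
have cst (x : C) : (fun=> x) @ \oo --> x by exact: cvg_cst.
apply: cvgM.
  apply: cvgV; first by rewrite mulf_neq0 ?pnatr_eq0 // aw_h0_neq0.
  apply: cvgM; first exact: cst.
  rewrite aw_h0E; apply: (cvgC_ext (fun k => esym (aw_h0E (A k) b c d (Q k)))).
  have n0 (x : C) : cn x < 1 -> qpoch_inf x q != 0 by move=> x1; exact: qpoch_inf_neq0.
  have lt1 (x : C) : cn x < 1 -> cn x <= 1 by exact: ltW.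
  have cAx (x : C) : cn x < 1 -> (fun k => qpoch_inf (A k * x) (Q k)) @ \oo --> qpoch_inf (a * x) q.
    move=> x1; apply: (@cvg_qpoch_inf _ _ 1); first by apply: cvgM; [exact: cA|exact: cst].
      by move=> k; apply: ltW; exact: cn_mul_lt1.
    by apply: ltW; exact: cn_mul_lt1.
  have cxy (x y : C) : cn x < 1 -> cn y < 1 ->
      (fun k => qpoch_inf (x * y) (Q k)) @ \oo --> qpoch_inf (x * y) q.
    move=> x1 y1; apply: (@cvg_qpoch_inf _ _ 1) => [|k|]; first exact: cst.
      by apply: ltW; exact: cn_mul_lt1.
    by apply: ltW; exact: cn_mul_lt1.
  apply: cvgM.
    apply: (@cvg_qpoch_inf _ _ 1).
    - do 2!(apply: cvgM; last exact: cst).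
      by apply: cvgM; [exact: cA|exact: cst].
    - by move=> k; apply: ltW; do 3?apply: cn_mul_lt1.
    - by apply: ltW; do 3?apply: cn_mul_lt1.
  apply: cvgV.
    by rewrite !mulf_neq0 // n0 // cn_mul_lt1.
  apply: cvgM; first by apply: (@cvg_qpoch_inf _ _ 1) => // [k|]; apply: ltW.
  do 3!(apply: cvgM; last exact: cxy).
  by do 2!(apply: cvgM; last exact: cAx); exact: cAx.
pose t := Num.max s (Num.max (cn b) (Num.max (cn c) (cn d))).
have bt : cn b <= t by rewrite !le_max lexx !orbT.
have ct : cn c <= t by rewrite !le_max lexx !orbT.
have dt : cn d <= t by rewrite !le_max lexx !orbT.
have t1 : t < 1 by rewrite !gt_max s1 b1 c1 d1.
have At k : cn (A k) <= t by apply: le_trans (As k) _; rewrite le_max lexx.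
have at_ : cn a <= t by apply: le_trans as_ _; rewrite le_max lexx.
suff M1 : exists M : R, forall z, cn z = 1 -> cn (((z + z^-1) / 2) ^+ n) <= M.
  exact: (cvg_mean_full_weight cA cQ At at_ bt ct dt t1 Qr qr r1 (circ_jouk R n) M1).
exists 1 => z z1; rewrite cnX exprn_ile1 ?cn_ge0 //.
rewrite cnM cnV; have := cnD z z^-1; rewrite cnV z1 invr1 => h.
have -> : cn (2 : C) = 2.
  by rewrite (_ : (2 : C) = (2 : R)%:C%C) ?cn_real ?ger0_norm // rmorph_nat.
lra.
Qed.

End Continuity.

(** Reaches [a = 0] and [q = 0] from generic values; the uniform estimates require the common bound
    [s < 1]. *)
Lemma nonzero_approx (x : C) : cn x < 1 -> exists (X : nat -> C) (s : R),
  [/\ X @ \oo --> x, (forall k, X k != 0), (forall k, cn (X k) <= s), cn x <= s & s < 1].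
Proof.
move=> x1; have [->|x0] := eqVneq x 0; last first.
  by exists (fun=> x), (cn x); split=> //; exact: cvg_cst.
exists (fun k => (2^-1 : R)%:C%C ^+ k.+1), (2^-1).
have h : `|2^-1 : R| = 2^-1 by rewrite ger0_norm // invr_ge0.
split.
- apply/cvgC_P => e e0; have [||N hN] := @pow_small R 2^-1 e _ _ e0.
  + by rewrite invr_ge0.
  + by rewrite invf_lt1 // ltr1n.
  exists N => n Nn; rewrite subr0 cnX cn_real h; apply: hN; exact: leqW.
- by move=> k; rewrite expf_neq0 // -cn_eq0 cn_real h invr_eq0 pnatr_eq0.
- move=> k; rewrite cnX cn_real h exprS ler_piMr ?invr_ge0 // exprn_ile1 ?invr_ge0 //.
  by rewrite invf_le1 // ler1n.
- by rewrite cn0 invr_ge0.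
- by rewrite invf_lt1 // ltr1n.
Qed.

Theorem disc_moment n a b c d q :
  cn a < 1 -> cn b < 1 -> cn c < 1 -> cn d < 1 -> cn q < 1 ->
  aw_moment_integral n a b c d q = tableau_formula n a b c d q.
Proof.
move=> a1 b1 c1 d1 q1.
have [A [s [cA A0 As as_ s1]]] := nonzero_approx a1.
have [Q [r [cQ Q0 Qr qr r1]]] := nonzero_approx q1.
have h := cvg_aw_moment_integral (n := n) cA cQ As as_ s1 b1 c1 d1 Qr qr r1.
have h' := cvg_tableau_formula (n := n) cA cQ as_ s1 b1 c1 d1 qr r1.
apply: (cvgC_unique h); apply: cvgC_ext h' => k; apply/esym/generic_moment => //.
- exact: le_lt_trans (As k) s1.
- exact: le_lt_trans (Qr k) r1.
Qed.

End TableauFormula.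

(** * Analyticity of quotients of polynomial functions *)

Section PolynomialFunctions.
Variables (R : realType) (k : nat).
Local Notation C := (Cplx R).
Local Notation mono := {ffun 'I_k -> nat}.
Implicit Types (f g : 'rV[C]_k -> C) (p h : 'rV[C]_k) (m : mono).

(** An inductive class, because the facts needed (restriction to a line, expansion at a point,
    continuity) go by induction on the construction. *)
Inductive polyfun : ('rV[C]_k -> C) -> Prop :=
| polyfun_cst x : polyfun (fun=> x)
| polyfun_coord i : polyfun (fun p => p 0 i)
| polyfun_add f g : polyfun f -> polyfun g -> polyfun (fun p => f p + g p)
| polyfun_mul f g : polyfun f -> polyfun g -> polyfun (fun p => f p * g p).

Lemma polyfun_ext f g : f =1 g -> polyfun f -> polyfun g.
Proof. by move=> /funext ->. Qed.

Lemma polyfun_opp f : polyfun f -> polyfun (fun p => - f p).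
Proof.
move=> pf; apply: (polyfun_ext _ (polyfun_mul (polyfun_cst (-1)) pf)) => p.
by rewrite mulN1r.
Qed.

Lemma polyfun_sub f g : polyfun f -> polyfun g -> polyfun (fun p => f p - g p).
Proof. by move=> pf pg; apply: polyfun_add => //; exact: polyfun_opp. Qed.

Lemma polyfun_prod (I : Type) (r : seq I) (F : I -> 'rV[C]_k -> C) :
  (forall i, polyfun (F i)) -> polyfun (fun p => \prod_(i <- r) F i p).
Proof.
move=> pF; elim: r => [|i r IH].
  by apply: (polyfun_ext _ (polyfun_cst 1)) => p; rewrite big_nil.
by apply: (polyfun_ext _ (polyfun_mul (pF i) IH)) => p; rewrite big_cons.
Qed.

Lemma polyfun_exp f n : polyfun f -> polyfun (fun p => f p ^+ n).
Proof.
move=> pf; elim: n => [|n IH]; first by apply: (polyfun_ext _ (polyfun_cst 1)) => p.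
by apply: (polyfun_ext _ (polyfun_mul pf IH)) => p; rewrite exprS.
Qed.

Lemma polyfun_line f : polyfun f -> forall p h : 'rV[C]_k,
  exists P : {poly C}, forall t, f (p + t *: h) = P.[t].
Proof.
move=> pf p h; elim: pf => [x|i|{}f g _ [P hP] _ [Q hQ]|{}f g _ [P hP] _ [Q hQ]].
- by exists x%:P => t; rewrite hornerC.
- by exists ((p 0 i)%:P + h 0 i *: 'X) => t; rewrite !mxE !hornerE mulrC.
- by exists (P + Q) => t; rewrite hornerD hP hQ.
- by exists (P * Q) => t; rewrite hornerM hP hQ.
Qed.

Lemma polyfun_continuous f : polyfun f -> continuous f.
Proof.
elim=> [x|i|{}f g _ cf _ cg|{}f g _ cf _ cg] p.
- exact: (@cst_continuous _ C x p).
- exact: (@coord_continuous C 1 k 0 i p).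
- by apply: (@cvgD C C _ (nbhs p) _ f g _ _ (cf p) (cg p)).
- by apply: (@cvgM C _ (nbhs p) _ f g _ _ (cf p) (cg p)).
Qed.

Definition mdegree m := (\sum_i m i)%N.

(* A finite formal sum of monomials, possibly with repetitions, so that the
   l1-norm below is exactly multiplicative. *)
Definition formal_sum := seq (C * mono).
Implicit Types l : formal_sum.

Definition fs_eval l h : C := \sum_(x <- l) x.1 * monomial h x.2.

Definition fs_norm l (s : R) : R := \sum_(x <- l) cn x.1 * s ^+ mdegree x.2.

Definition fs_scale (y : C) l : formal_sum := [seq (y * x.1, x.2) | x <- l].

Definition mono_mul m m' : mono := [ffun i => (m i + m' i)%N].

Definition fs_mul l l' : formal_sum :=
  [seq (x.1 * y.1, mono_mul x.2 y.2) | x <- l, y <- l'].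

Definition fs_coef l m : C := \sum_(x <- l | x.2 == m) x.1.

Definition mono0 : mono := [ffun=> 0%N].

Lemma mdegree_mul m m' : mdegree (mono_mul m m') = (mdegree m + mdegree m')%N.
Proof. by rewrite /mdegree -big_split; apply: eq_bigr => i _; rewrite ffunE. Qed.

Lemma monomial_mul h m m' : monomial h (mono_mul m m') = monomial h m * monomial h m'.
Proof.
by rewrite /monomial -big_split; apply: eq_bigr => i _; rewrite ffunE exprD.
Qed.

Lemma monomial0 h : monomial h mono0 = 1.
Proof. by rewrite /monomial big1 // => i _; rewrite ffunE expr0. Qed.

Lemma mdegree0 : mdegree mono0 = 0%N.
Proof. by rewrite /mdegree big1 // => i _; rewrite ffunE. Qed.

Lemma fs_eval_cat l l' h : fs_eval (l ++ l') h = fs_eval l h + fs_eval l' h.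
Proof. exact: big_cat. Qed.

Lemma fs_eval_scale y l h : fs_eval (fs_scale y l) h = y * fs_eval l h.
Proof. by rewrite /fs_eval big_map mulr_sumr; apply: eq_bigr => x _; rewrite mulrA. Qed.

Lemma fs_eval_mul l l' h : fs_eval (fs_mul l l') h = fs_eval l h * fs_eval l' h.
Proof.
rewrite /fs_eval big_allpairs_dep mulr_suml; apply: eq_bigr => x _.
rewrite mulr_sumr; apply: eq_bigr => y _ /=.
by rewrite monomial_mul mulrACA.
Qed.

Lemma fs_norm_mul l l' s : fs_norm (fs_mul l l') s = fs_norm l s * fs_norm l' s.
Proof.
rewrite /fs_norm big_allpairs_dep mulr_suml; apply: eq_bigr => x _.
rewrite mulr_sumr; apply: eq_bigr => y _ /=.
by rewrite mdegree_mul exprD cnM mulrACA.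
Qed.

Lemma fs_norm_ge0 l (s : R) : 0 <= s -> 0 <= fs_norm l s.
Proof. by move=> s0; apply: sumr_ge0 => x _; rewrite mulr_ge0 ?cn_ge0 ?exprn_ge0. Qed.

Lemma cn_monomial_le h m (s : R) : (forall i, cn (h 0 i) <= s) ->
  cn (monomial h m) <= s ^+ mdegree m.
Proof.
move=> hs; rewrite /monomial cn_prod /mdegree -prodrXr.
apply: ler_prod => i _; rewrite cn_ge0 /= cnX.
by apply: lerXn2r; rewrite ?nnegrE ?cn_ge0 ?(le_trans _ (hs i)) ?cn_ge0.
Qed.

Lemma fs_eval_le l h (s : R) : (forall i, cn (h 0 i) <= s) -> cn (fs_eval l h) <= fs_norm l s.
Proof.
move=> hs; apply: le_trans (cn_sum _ _ _) _; apply: ler_sum => x _.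
by rewrite cnM ler_wpM2l ?cn_ge0 ?cn_monomial_le.
Qed.

(** No constant term: the norm is then small for a small radius, and an [n]th power has only
    monomials of degree at least [n]. *)
Definition fs_pos l := all (fun x => 0 < mdegree x.2)%N l.

Lemma fs_pos_mul l l' : fs_pos l -> fs_pos (fs_mul l l').
Proof.
move=> pl; apply/allP => x /allpairsP[[y z] [/= hy _ ->]] /=.
by rewrite mdegree_mul addn_gt0 (allP pl _ hy).
Qed.

Lemma polyfun_expand f p : polyfun f ->
  exists2 l, fs_pos l & forall h, f (p + h) = f p + fs_eval l h.
Proof.
elim=> [x|i|{}f g _ [l pl hl] _ [l' pl' hl']|{}f g _ [l pl hl] _ [l' pl' hl']].
- by exists [::] => // h; rewrite /fs_eval big_nil addr0.
- exists [:: (1, [ffun j => nat_of_bool (j == i)])] => [|h].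
    rewrite /fs_pos /= andbT /mdegree (bigD1 i) //= ffunE eqxx; lia.
  rewrite /fs_eval big_seq1 /= mul1r mxE; congr (_ + _).
  rewrite /monomial (bigD1 i) //= ffunE eqxx expr1 big1 ?mulr1 // => j /negPf ji.
  by rewrite ffunE ji expr0.
- exists (l ++ l') => [|h]; first by rewrite /fs_pos all_cat; apply/andP; split.
  by rewrite fs_eval_cat hl hl' addrACA.
- exists (fs_scale (f p) l' ++ fs_scale (g p) l ++ fs_mul l l') => [|h].
    rewrite /fs_pos !all_cat; apply/and3P; split; last exact: fs_pos_mul.
      by rewrite all_map.
    by rewrite all_map.
  by rewrite !fs_eval_cat !fs_eval_scale fs_eval_mul hl hl'; ring.
Qed.

Fixpoint fs_pow l n : formal_sum :=
  if n is n'.+1 then fs_mul l (fs_pow l n') else [:: (1, mono0)].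

Lemma fs_eval_pow l n h : fs_eval (fs_pow l n) h = fs_eval l h ^+ n.
Proof.
elim: n => [|n IH] /=; first by rewrite /fs_eval big_seq1 monomial0 mulr1.
by rewrite fs_eval_mul IH exprS.
Qed.

Lemma fs_norm_pow l n s : fs_norm (fs_pow l n) s = fs_norm l s ^+ n.
Proof.
elim: n => [|n IH] /=; first by rewrite /fs_norm big_seq1 mdegree0 mulr1 cn1.
by rewrite fs_norm_mul IH exprS.
Qed.

Lemma fs_pow_degree l n x : fs_pos l -> x \in fs_pow l n -> (n <= mdegree x.2)%N.
Proof.
move=> pl; elim: n x => [|n IH] x //= /allpairsP[[y z] [/= hy hz ->]] /=.
by rewrite mdegree_mul -add1n; apply: leq_add; [exact: (allP pl _ hy)|exact: IH].
Qed.

Lemma fs_norm_pos_le l (s : R) : fs_pos l -> 0 <= s -> s <= 1 -> fs_norm l s <= s * fs_norm l 1.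
Proof.
move=> pl s0 s1; rewrite /fs_norm mulr_sumr !big_seq; apply: ler_sum => x /(allP pl) hx.
rewrite expr1n mulr1 mulrC ler_wpM2r ?cn_ge0 //.
by case: (mdegree _) hx => // n _; rewrite exprS ler_piMr // exprn_ile1.
Qed.

End PolynomialFunctions.

Section Cubes.
Variables (R : realType) (k : nat).
Local Notation C := (Cplx R).
Local Notation mono := {ffun 'I_k -> nat}.
Implicit Types (m : mono) (l : formal_sum R k).

Definition cube_sum (V : nmodType) (G : mono -> V) N : V :=
  \sum_(m : {ffun 'I_k -> 'I_N}) G (multi_index m).

Lemma multi_index_inj N : injective (@multi_index k N).
Proof.
move=> m m' e; apply/ffunP => i; apply: val_inj.
by have := congr1 (fun f : mono => f i) e; rewrite !ffunE.
Qed.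

Lemma cube_fs_coef_le l N (s : R) : 0 <= s ->
  cube_sum (fun m => cn (fs_coef l m) * s ^+ mdegree m) N <= fs_norm l s.
Proof.
move=> s0; rewrite /cube_sum /fs_norm.
apply: (@le_trans _ _ (\sum_(m : {ffun 'I_k -> 'I_N}) \sum_(x <- l | x.2 == multi_index m)
   cn x.1 * s ^+ mdegree x.2)).
  apply: ler_sum => m _; rewrite /fs_coef.
  apply: (@le_trans _ _ ((\sum_(x <- l | x.2 == multi_index m) cn x.1) * s ^+ mdegree (multi_index m))).
    by rewrite ler_wpM2r ?exprn_ge0 // cn_sum.
  by rewrite mulr_suml; apply: ler_sum => x /eqP ->.
rewrite (exchange_big_dep predT) //=; apply: ler_sum => x _.
case: (pickP (fun m : {ffun 'I_k -> 'I_N} => x.2 == multi_index m)) => [m0 hm0|h0].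
  rewrite (bigD1 m0) //= big1 ?addr0 // => m /andP[/eqP h1 /eqP h2].
  by case: h2; apply: multi_index_inj; rewrite -h1 (eqP hm0).
by rewrite big_pred0 // mulr_ge0 ?cn_ge0 ?exprn_ge0.
Qed.

Lemma cube_fs_eval l N (h : 'rV[C]_k) :
  (forall x, x \in l -> forall i, (x.2 i < N)%N) ->
  cube_sum (fun m => fs_coef l m * monomial h m) N = fs_eval l h.
Proof.
move=> hl; rewrite /cube_sum /fs_eval.
transitivity (\sum_(m : {ffun 'I_k -> 'I_N}) \sum_(x <- l | x.2 == multi_index m)
   x.1 * monomial h x.2).
  by apply: eq_bigr => m _; rewrite /fs_coef mulr_suml; apply: eq_bigr => x /eqP ->.
rewrite (exchange_big_dep predT) //= big_seq [RHS]big_seq; apply: eq_bigr => x /hl hx.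
pose m0 : {ffun 'I_k -> 'I_N} := [ffun i => Ordinal (hx i)].
have e0 : x.2 = multi_index m0 by apply/ffunP => i; rewrite !ffunE.
rewrite (bigD1 m0) /=; last by rewrite -e0.
rewrite big1 ?addr0 // => m /andP[/eqP h1 /eqP h2].
by case: h2; apply: multi_index_inj; rewrite -h1.
Qed.

Lemma cube_sum_le (G : mono -> R) N : (forall m, 0 <= G m) ->
  cube_sum G N.+1 <= cube_sum G N.+2.
Proof.
move=> G0; rewrite /cube_sum.
pose up (m : {ffun 'I_k -> 'I_N.+1}) : {ffun 'I_k -> 'I_N.+2} := [ffun i => widen_ord (leqnSn _) (m i)].
(* [inord] needs a nonempty ordinal, hence the comparison from side 1 on. *)
pose down (m : {ffun 'I_k -> 'I_N.+2}) : {ffun 'I_k -> 'I_N.+1} := [ffun i => inord (m i)].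
have upK (m : {ffun 'I_k -> 'I_N.+1}) : down (up m) = m.
  by apply/ffunP => i; rewrite !ffunE; apply: val_inj; rewrite /= inordK.
rewrite [leRHS](bigID (fun x => up (down x) == x)) /=.
rewrite -[leLHS]addr0; apply: lerD; last by apply: sumr_ge0.
rewrite (reindex_onto up down) /=; last by move=> m /eqP.
rewrite [leRHS](eq_bigl predT) => [|m]; last by rewrite upK !eqxx.
apply: ler_sum => m _; rewrite le_eqVlt; apply/orP; left; apply/eqP; congr G.
by apply/ffunP => i; rewrite !ffunE.
Qed.

Lemma mdegree_cube N (m : {ffun 'I_k -> 'I_N}) : (mdegree (multi_index m) <= k * N)%N.
Proof.
rewrite /mdegree -[X in (X * _)%N]card_ord -sum_nat_const; apply: leq_sum => i _.
by rewrite ffunE ltnW.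
Qed.

End Cubes.

Section NormallyConvergent.
Variables (R : realType) (k : nat).
Local Notation C := (Cplx R).
Local Notation mono := {ffun 'I_k -> nat}.
Variables (f : 'rV[C]_k -> C) (p : 'rV[C]_k) (L : nat -> formal_sum R k) (s A : R).
Hypotheses (s0 : 0 < s).
Hypothesis Ldeg : forall n x, x \in L n -> (n <= mdegree x.2)%N.
Hypothesis Lnorm : forall n, fs_norm (L n) s <= A * 2^-1 ^+ n.
Hypothesis Lsum : forall h : 'rV[C]_k, (forall i, cn (h 0 i) < s) ->
  forall n, cn (f (p + h) - \sum_(j < n) fs_eval (L j) h) <= A * 2^-1 ^+ n.

Let A0 : 0 <= A.
Proof. by have := Lnorm 0; rewrite expr0 mulr1; apply: le_trans; exact/fs_norm_ge0/ltW. Qed.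

(** By [Ldeg] a monomial of degree [d] occurs in [L n] only for [n <= d], so the coefficient of the
    infinite sum is a finite sum. *)
Let coef (m : mono) : C := \sum_(n < (mdegree m).+1) fs_coef (L n) m.

Let fs_coef_deg n m : (mdegree m < n)%N -> fs_coef (L n) m = 0.
Proof.
move=> h; rewrite /fs_coef big_seq_cond big1 // => x /andP[/Ldeg hx /eqP e].
by move: hx; rewrite e leqNgt h.
Qed.

Let coefE m M : (mdegree m < M)%N -> coef m = \sum_(n < M) fs_coef (L n) m.
Proof.
move=> h; rewrite /coef (big_ord_widen M (fun n => fs_coef (L n) m) h) big_mkcond.
apply: eq_bigr => n _; case: ifP => // /negbT; rewrite -leqNgt => hn.
by rewrite fs_coef_deg.
Qed.

Let sum_half n M : \sum_(n <= j < n + M) (2^-1 : R) ^+ j <= 2 * 2^-1 ^+ n.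
Proof.
rewrite -{1}[n]add0n big_addn addnC addnK big_mkord.
under eq_bigr => j _ do rewrite exprD.
rewrite -mulr_suml ler_wpM2r ?exprn_ge0 ?invr_ge0 //.
have -> : \sum_(i < M) (2^-1 : R) ^+ i = 2 * (1 - 2^-1 ^+ M).
  have := subrX1 (2^-1 : R) M; set S := \sum_(_ < _) _ => e.
  have -> : (2^-1 : R) ^+ M = (2^-1 - 1) * S + 1 by rewrite -e subrK.
  by field.
have : 0 <= (2^-1 : R) ^+ M by rewrite exprn_ge0 ?invr_ge0.
lra.
Qed.

(** At [K = 0] this is the absolute convergence of the power series; for large [K] it compares the
    power series with the first [K] formal sums. *)
Let tail_bound (h : 'rV[C]_k) K N : (forall i, cn (h 0 i) < s) ->
  cube_sum (fun m => cn ((coef m - \sum_(n < K) fs_coef (L n) m) * monomial h m)) N <=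
  A * (2 * 2^-1 ^+ K).
Proof.
move=> hs; pose M := (k * N).+1.
apply: (@le_trans _ _ (\sum_(K <= n < K + M) A * 2^-1 ^+ n)); last first.
  by rewrite -mulr_sumr ler_wpM2l // sum_half.
apply: (@le_trans _ _ (\sum_(K <= n < K + M)
    cube_sum (fun m => cn (fs_coef (L n) m) * s ^+ mdegree m) N)); last first.
  apply: ler_sum => n _; apply: le_trans (Lnorm n).
  by apply: cube_fs_coef_le; exact: ltW.
rewrite /cube_sum exchange_big /=; apply: ler_sum => m _.
have hm : (mdegree (multi_index m) < K + M)%N.
  by rewrite /M addnS ltnS; apply: leq_trans (mdegree_cube m) (leq_addl _ _).
rewrite (coefE hm) -mulr_suml cnM; apply: ler_pM; rewrite ?cn_ge0 //; last first.
  by apply: cn_monomial_le => i; exact: ltW.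
rewrite -!(big_mkord predT (fun n => fs_coef (L n) (multi_index m))).
rewrite (big_cat_nat _ (n := K)) ?leq_addr //= [X in cn X]addrAC subrr add0r.
exact: cn_sum.
Qed.

Lemma normally_convergent_analytic : analytic_at f p.
Proof.
exists coef, (s%:C%C : C); split.
  by rewrite -[0]/((0 : R)%:C%C) ltcR.
move=> h hs; have {}hs i : cn (h 0 i) < s by have := hs i; rewrite cnE ltcR.
move=> term; split.
  pose u N := cube_sum (fun m => cn (term m)) N.
  have eu : (fun N => \sum_(m : {ffun 'I_k -> 'I_N}) `|term (multi_index m)|) =
     (fun N => (u N)%:C%C : C).
    apply/funext => N; rewrite /u /cube_sum rmorph_sum; apply: eq_bigr => m _.
    by rewrite cnE.
  have ub N : u N <= A * (2 * 2^-1 ^+ 0).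
    have := tail_bound 0 N hs; apply: le_trans; apply: ler_sum => m _.
    by rewrite big_ord0 subr0.
  have /cvg_ex [l hl] : cvgn (fun N => u N.+1).
    apply: nondecreasing_is_cvgn.
      apply/nondecreasing_seqP => N; apply: cube_sum_le => m; exact: cn_ge0.
    by exists (A * (2 * 2^-1 ^+ 0)) => _ [N _ <-].
  rewrite eu; apply/cvg_ex; exists (l%:C%C : C).
  rewrite -cvg_shiftS; apply/cvgC_P => e e0.
  have /cvgrPdist_lt /(_ e e0) [N0 _ hN0] := hl; exists N0 => n /hN0 /= h1.
  by rewrite -rmorphB cn_real distrC.
apply/cvgC_P => e e0.
have A1 : 0 < A + 1 by have := A0; lra.
have e6 : 0 < e / (6 * (A + 1)) by rewrite divr_gt0 //; lra.
have [||K hK] := @pow_small R 2^-1 (e / (6 * (A + 1))) _ _ e6.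
- by rewrite invr_ge0.
- by rewrite invf_lt1 // ltr1n.
have {}hK := hK _ (leqnn K).
(* Larger than every exponent in the first [K] formal sums, so that the cube of side [N] contains
   all their monomials. *)
pose N0 := (\sum_(j < K) \sum_(x <- L j) (mdegree x.2).+1)%N.
exists N0 => N hN.
have hin j x : (j < K)%N -> x \in L j -> forall i, (x.2 i < N)%N.
  move=> jK xj i; apply: leq_trans hN; rewrite /N0.
  rewrite (bigD1 (Ordinal jK)) //= (big_rem x) //= -!addnA addSn ltnS.
  apply: leq_trans (leq_addr _ _).
  by rewrite /mdegree (bigD1 i) //= leq_addr.
have eT : \sum_(j < K) fs_eval (L j) h =
   cube_sum (fun m => (\sum_(j < K) fs_coef (L j) m) * monomial h m) N.
  rewrite /cube_sum; under [RHS]eq_bigr => m _ do rewrite mulr_suml.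
  rewrite exchange_big /=; apply: eq_bigr => j _.
  by rewrite -(@cube_fs_eval _ _ _ N) // => x; exact: hin.
apply: le_lt_trans (cn_dist _ _ (\sum_(j < K) fs_eval (L j) h)) _.
have B1 := Lsum hs K; rewrite cn_sub in B1.
have B2 : cn (\sum_(m : {ffun 'I_k -> 'I_N}) term (multi_index m) -
    \sum_(j < K) fs_eval (L j) h) <= A * (2 * 2^-1 ^+ K).
  rewrite eT /cube_sum -sumrB; apply: le_trans (cn_sum _ _ _) _.
  apply: le_trans (tail_bound K N hs); apply: ler_sum => m _.
  by rewrite /term mulrBl.
have B3 : (A + 1) * 2^-1 ^+ K < e / 6.
  move: hK; rewrite -(ltr_pM2l A1) => hK; apply: lt_le_trans hK _.
  rewrite le_eqVlt; apply/orP; left; apply/eqP; field.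
  by rewrite gt_eqF //; lra.
have B4 : 0 <= (2^-1 : R) ^+ K by rewrite exprn_ge0 ?invr_ge0.
nra.
Qed.

End NormallyConvergent.

Section Ratio.
Variables (R : realType) (k : nat).
Local Notation C := (Cplx R).

(** A geometric series: with [D (p + h) = D p (1 - l(h))] and [N (p + h) = D p l'(h)] the quotient
    is the sum of [l(h)^n l'(h)]. The radius [s] makes the norm of [l] at most 1/2, whence the rate
    [2^-n], and [1 - l(h)] has modulus at least 1/2, whence the constant [2 * A]. *)
Lemma ratio_analytic (N D : 'rV[C]_k -> C) p : polyfun N -> polyfun D -> D p != 0 ->
  analytic_at (fun x => N x / D x) p.
Proof.
move=> pN pD D0.
have [lN _ hN] := polyfun_expand p pN; have [lD posD hD] := polyfun_expand p pD.
pose l : formal_sum R k := fs_scale (- (D p)^-1) lD.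
pose l' : formal_sum R k := fs_scale (D p)^-1 ((N p, mono0 k) :: lN).
have posl : fs_pos l by rewrite /fs_pos all_map.
pose T := fs_norm l 1; have T0 : 0 <= T by exact: fs_norm_ge0.
pose s := (2 * (1 + T))^-1.
have K0 : 0 < 2 * (1 + T) by lra.
have s0 : 0 < s by rewrite invr_gt0.
have s1 : s <= 1 by rewrite invf_le1 //; lra.
have sT : fs_norm l s <= 2^-1.
  apply: le_trans (fs_norm_pos_le posl (ltW s0) s1) _; rewrite -/T /s.
  rewrite mulrC ler_pdivrMr //; lra.
pose A := fs_norm l' s.
have A0 : 0 <= A by apply: fs_norm_ge0; exact: ltW.
pose L n := fs_mul (fs_pow l n) l'.
have nl := fs_norm_ge0 l (ltW s0).
apply: (@normally_convergent_analytic R k _ p L s (2 * A)) => //.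
- move=> n x /allpairsP[[y z] [/= hy hz ->]] /=.
  by rewrite mdegree_mul; apply: leq_trans (fs_pow_degree posl hy) (leq_addr _ _).
- move=> n; rewrite /L fs_norm_mul fs_norm_pow mulrC -mulrA.
  have h1 : fs_norm l s ^+ n <= 2^-1 ^+ n by apply: lerXn2r; rewrite ?nnegrE // invr_ge0.
  have h2 : 0 <= (2^-1 : R) ^+ n by rewrite exprn_ge0 ?invr_ge0.
  rewrite -/A; nra.
move=> h hs n.
have hs' i : cn (h 0 i) <= s by exact: ltW.
have el : D (p + h) = D p * (1 - fs_eval l h).
  by rewrite hD fs_eval_scale; field.
have el' : N (p + h) = D p * fs_eval l' h.
  rewrite hN fs_eval_scale [fs_eval (_ :: _) _]/fs_eval big_cons monomial0 -/(fs_eval _ _) /=.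
  by field.
set x := fs_eval l h in el; set y := fs_eval l' h in el'.
have x1 : cn x <= 2^-1 by apply: le_trans (fs_eval_le _ hs') _.
have y1 : cn y <= A by exact: fs_eval_le.
have lo : 2^-1 <= cn (1 - x) by have := cnD (1 - x) x; rewrite subrK cn1; lra.
have nx : 1 - x != 0 by rewrite -cn_gt0; apply: lt_le_trans lo; rewrite invr_gt0.
have -> : N (p + h) / D (p + h) - \sum_(j < n) fs_eval (L j) h = x ^+ n * y / (1 - x).
  under eq_bigr => j _ do rewrite /L fs_eval_mul fs_eval_pow -/x -/y.
  rewrite -mulr_suml el el'; have := subrX1 x n; set S := \sum_(_ < _) _ => e.
  have -> : x ^+ n = (x - 1) * S + 1 by rewrite -e subrK.
  by field; rewrite nx D0.
rewrite cnM cnV ler_pdivrMr ?cn_gt0 // cnM cnX.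
have h1 : cn x ^+ n <= 2^-1 ^+ n by apply: lerXn2r; rewrite ?nnegrE ?cn_ge0 // invr_ge0.
have h2 : 0 <= cn x ^+ n by rewrite exprn_ge0 ?cn_ge0.
have h3 : cn x ^+ n * cn y <= 2^-1 ^+ n * A by apply: ler_pM; rewrite ?cn_ge0.
have h4 : 0 <= (2^-1 : R) ^+ n * A by rewrite mulr_ge0 ?exprn_ge0 ?invr_ge0.
apply: le_trans h3 _; move: h4; rewrite -mulrA [A * _]mulrC; move: (2^-1 ^+ n * A) => w h4.
nra.
Qed.

End Ratio.

(** * Uniqueness of the continuation *)

Section Majorant.
Variable R : realType.
Local Notation C := (Cplx R).
Implicit Types (p r : {poly C}) (P Q : {poly R}).

(** Coefficientwise domination bounds the absolute coefficient sum of a product of linear forms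
    without expanding it. *)
Definition majorant p P := forall i, cn p`_i <= P`_i.

Lemma majorantD p P r Q : majorant p P -> majorant r Q -> majorant (p + r) (P + Q).
Proof. by move=> h h' i; rewrite !coefD; apply: le_trans (cnD _ _) (lerD (h i) (h' i)). Qed.

Lemma majorantN p P : majorant p P -> majorant (- p) P.
Proof. by move=> h i; rewrite coefN cnN. Qed.

Lemma majorantM p P r Q : majorant p P -> majorant r Q -> majorant (p * r) (P * Q).
Proof.
move=> h h' i; rewrite !coefM; apply: le_trans (cn_sum _ _ _) _.
by apply: ler_sum => j _; rewrite cnM; apply: ler_pM; rewrite ?cn_ge0.
Qed.

Lemma majorantC (x : C) : majorant x%:P (cn x)%:P.
Proof. by move=> i; rewrite !coefC; case: (i == 0%N); rewrite ?cn0. Qed.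

Lemma majorantX : majorant 'X 'X.
Proof. by move=> i; rewrite !coefX; case: (i == 1%N); rewrite ?cn0 ?cn1. Qed.

Lemma majorant1 : majorant 1 1.
Proof. by move=> i; rewrite !coef1; case: (i == 0%N); rewrite ?cn0 ?cn1. Qed.

Lemma majorant_exp p P n : majorant p P -> majorant (p ^+ n) (P ^+ n).
Proof.
move=> h; elim: n => [|n IH]; last by rewrite !exprS; exact: majorantM.
by rewrite !expr0; exact: majorant1.
Qed.

Lemma majorant_prod (I : Type) (s : seq I) (F : I -> {poly C}) (G : I -> {poly R}) :
  (forall i, majorant (F i) (G i)) -> majorant (\prod_(i <- s) F i) (\prod_(i <- s) G i).
Proof.
move=> h; elim: s => [|i s IH]; last by rewrite !big_cons; exact: majorantM.
by rewrite !big_nil; exact: majorant1.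
Qed.

Lemma majorant_sum (I : Type) (s : seq I) (F : I -> {poly C}) (G : I -> {poly R}) :
  (forall i, majorant (F i) (G i)) -> majorant (\sum_(i <- s) F i) (\sum_(i <- s) G i).
Proof.
move=> h; elim: s => [|i s IH]; last by rewrite !big_cons; exact: majorantD.
by rewrite !big_nil => j; rewrite !coef0 cn0.
Qed.

Lemma majorant_self p : majorant p (\poly_(i < size p) cn p`_i).
Proof.
move=> i; rewrite coef_poly; case: ltnP => // h.
by rewrite nth_default // cn0.
Qed.

Lemma majorant_le p P n (t : R) : 0 <= t -> majorant p P ->
  \sum_(i < n) cn p`_i * t ^+ i <= P.[t].
Proof.
move=> t0 h; have P0 i : 0 <= P`_i by apply: le_trans (h i); exact: cn_ge0.
pose m := maxn n (size P).
apply: (@le_trans _ _ (\sum_(i < m) cn p`_i * t ^+ i)).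
  rewrite (big_ord_widen m (fun i => cn p`_i * t ^+ i)) ?leq_maxl // big_mkcond /=.
  apply: ler_sum => i _; case: ifP => // _.
  by rewrite mulr_ge0 ?cn_ge0 ?exprn_ge0.
rewrite (horner_coef_wide t (leq_maxr n (size P))); apply: ler_sum => i _.
by rewrite ler_wpM2r ?exprn_ge0.
Qed.

End Majorant.

Section Vanishing.
Variable R : realType.
Local Notation C := (Cplx R).
Variables (g : nat -> {poly C}) (M t0 e0 : R).
Hypotheses (t01 : 1 < t0) (e00 : 0 < e0).
Hypothesis gM : forall N n, \sum_(i < n) cn (g N)`_i * t0 ^+ i <= M.
Hypothesis g0 : forall t : C, cn t < e0 -> (fun N => (g N).[t]) @ \oo --> (0 : C).

Let M0 : 0 <= M.
Proof. by have := gM 0 0; rewrite big_ord0. Qed.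

Let tail_le N J n (t : R) : 0 <= t -> t <= t0 ->
  \sum_(i < n | (J <= i)%N) cn (g N)`_i * t ^+ i <= (t / t0) ^+ J * M.
Proof.
move=> t_0 tt0; have t00 : 0 < t0 := lt_trans ltr01 t01.
have r0 : 0 <= t / t0 by rewrite divr_ge0 // ltW.
have r1 : t / t0 <= 1 by rewrite ler_pdivrMr // mul1r.
apply: le_trans (_ : (t / t0) ^+ J * \sum_(i < n) cn (g N)`_i * t0 ^+ i <= _); last first.
  by rewrite ler_wpM2l ?exprn_ge0.
rewrite mulr_sumr big_mkcond; apply: ler_sum => i _; case: ifP => hJ; last first.
  by rewrite !mulr_ge0 ?exprn_ge0 ?cn_ge0 // ltW.
rewrite mulrCA ler_wpM2l ?cn_ge0 //.
have -> : t ^+ i = (t / t0) ^+ i * t0 ^+ i by rewrite -exprMn divfK // gt_eqF.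
rewrite ler_wpM2r ?exprn_ge0 ?(ltW t00) //.
by rewrite -(subnK hJ) exprD ler_piMl ?exprn_ge0 // exprn_ile1.
Qed.

Let horner_split N J n (t : C) : (size (g N) <= n)%N -> (J <= n)%N ->
  (g N).[t] = \sum_(i < J) (g N)`_i * t ^+ i + \sum_(i < n | (J <= i)%N) (g N)`_i * t ^+ i.
Proof.
move=> hn hJ; rewrite (horner_coef_wide t hn).
rewrite (big_ord_widen n (fun i => (g N)`_i * t ^+ i) hJ).
rewrite (bigID (fun i : 'I_n => (i < J)%N)) /=; congr (_ + _).
by apply: eq_bigl => i; rewrite -leqNgt.
Qed.

Let low_small J : (forall i, (i < J)%N -> forall e, 0 < e -> exists N0, forall N,
    (N0 <= N)%N -> cn (g N)`_i <= e) ->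
  forall e, 0 < e -> exists N0, forall N, (N0 <= N)%N -> \sum_(i < J) cn (g N)`_i <= e.
Proof.
elim: J => [|J IH] h e ep; first by exists 0%N => N _; rewrite big_ord0 ltW.
have e2 : 0 < e / 2 by rewrite divr_gt0.
have [i iJ|N1 h1] := IH _ _ e2; first by apply: h; exact: ltnW.
have [N2 h2] := h J (leqnn _) _ e2; exists (maxn N1 N2) => N.
rewrite geq_max => /andP[/h1 l1 /h2 l2]; rewrite big_ord_recr /= [e]splitr.
exact: lerD.
Qed.

(** At a small real [t > 0] the term of degree [J] is isolated: the lower terms are small by
    induction, the higher ones are at most [t^(J+1) M], and [t] is chosen with [t M <= e / 2]. *)
Let coef_small J e : 0 < e -> exists N0, forall N, (N0 <= N)%N -> cn (g N)`_J <= e.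
Proof.
elim/ltn_ind: J e => J IH e ep.
have low := low_small IH.
have t00 : 0 < t0 := lt_trans ltr01 t01; have E00 := e00; have T01 := t01.
pose w := Num.min 1 (e0 / 2) ; pose t := Num.min w (e / (2 * (M + 1))).
have MM := M0.
have w0 : 0 < w by rewrite lt_min ltr01 divr_gt0.
have t_0 : 0 < t by rewrite lt_min w0 divr_gt0 //; lra.
have t1 : t <= 1 by rewrite ge_min /w ge_min lexx.
have te : t < e0.
  apply: (@le_lt_trans _ _ (e0 / 2)); last by lra.
  by rewrite /t /w !ge_min lexx ?orbT.
have tM : t * M <= e / 2.
  apply: (@le_trans _ _ (e / (2 * (M + 1)) * M)).
    by rewrite ler_wpM2r // /t ge_min lexx orbT.
  rewrite mulrAC ler_pdivrMr; last by lra.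
  nra.
have tJ : 0 < t ^+ J by rewrite exprn_gt0.
have eJ : 0 < t ^+ J * e / 4 by rewrite !mulr_gt0.
have [N1 h1] := low _ eJ.
have ct : cn (t%:C%C : C) = t by rewrite cn_real ger0_norm // ltW.
have /cvgC_P /(_ _ eJ) [N2 h2] : (fun N => (g N).[(t%:C%C : C)]) @ \oo --> (0 : C).
  by apply: g0; rewrite ct.
exists (maxn N1 N2) => N; rewrite geq_max => /andP[/h1 l1 /h2 l2]; rewrite subr0 in l2.
pose n := maxn (size (g N)) J.+1.
have hs := horner_split t%:C%C (leq_maxl (size (g N)) J.+1) (leq_maxr (size (g N)) J.+1).
rewrite big_ord_recr /= in hs.
rewrite -(ler_pM2r tJ) -[X in _ * X ^+ _]ct -cnX -cnM.
have -> : (g N)`_J * t%:C%C ^+ J = (g N).[t%:C%C] - (\sum_(i < J) (g N)`_i * t%:C%C ^+ i +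
   \sum_(i < n | (J.+1 <= i)%N) (g N)`_i * t%:C%C ^+ i).
  by rewrite hs -/n; ring.
apply: le_trans (cnB _ _) _.
have b1 : cn (\sum_(i < J) (g N)`_i * t%:C%C ^+ i) <= t ^+ J * e / 4.
  apply: le_trans l1; apply: le_trans (cn_sum _ _ _) _; apply: ler_sum => i _.
  by rewrite cnM cnX ct ler_piMr ?cn_ge0 // exprn_ile1 // ltW.
have b2 : cn (\sum_(i < n | (J.+1 <= i)%N) (g N)`_i * t%:C%C ^+ i) <= t ^+ J * (e / 2).
  apply: le_trans (cn_sum _ _ _) _.
  under eq_bigr => i _ do rewrite cnM cnX ct.
  apply: le_trans (tail_le N J.+1 n (ltW t_0) (le_trans t1 (ltW t01))) _.
  have : (t / t0) ^+ J.+1 <= t ^+ J.+1.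
    apply: lerXn2r; rewrite ?nnegrE ?divr_ge0 ?(ltW t_0) ?(ltW t00) //.
    by rewrite ler_pdivrMr // ler_peMr ?(ltW t_0) ?(ltW t01).
  move=> hh; apply: le_trans (ler_wpM2r MM hh) _.
  by rewrite exprSr -mulrA ler_wpM2l ?(ltW tJ).
have := cnD (\sum_(i < J) (g N)`_i * t%:C%C ^+ i) (\sum_(i < n | (J.+1 <= i)%N) (g N)`_i * t%:C%C ^+ i).
move: l2 b1 b2; move: (t ^+ J) => x; lra.
Qed.

(** An identity theorem for sequences of polynomials: each coefficient tends to 0, and the bound at
    [t0 > 1] makes the tails at 1 uniformly small. *)
Lemma bounded_vanishing : (fun N => (g N).[1]) @ \oo --> (0 : C).
Proof.
apply/cvgC_P => e ep; have t00 : 0 < t0 := lt_trans ltr01 t01.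
have MM := M0; have M1 : 0 < M + 1 by lra.
have r1 : t0^-1 < 1 by rewrite invf_lt1.
have r0 : 0 <= t0^-1 by rewrite invr_ge0 ltW.
have e3 : 0 < e / 3 by rewrite divr_gt0.
have [J hJ] := pow_small r0 r1 (divr_gt0 e3 M1); have {}hJ := hJ _ (leqnn J).
have [i _|N0 h0] := @low_small J _ _ e3; first exact: coef_small.
exists N0 => N /h0 l; rewrite subr0.
rewrite (horner_split 1 (leq_maxl (size (g N)) J) (leq_maxr (size (g N)) J)).
set n := maxn _ _.
have b1 : cn (\sum_(i < J) (g N)`_i * 1 ^+ i) <= e / 3.
  apply: le_trans l; apply: le_trans (cn_sum _ _ _) _; apply: ler_sum => i _.
  by rewrite expr1n mulr1.
have b2 : cn (\sum_(i < n | (J <= i)%N) (g N)`_i * 1 ^+ i) <= e / 3.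
  apply: le_trans (cn_sum _ _ _) _.
  under eq_bigr => i _ do rewrite cnM cnX cn1.
  apply: le_trans (tail_le N J n ler01 (ltW t01)) _.
  rewrite div1r; move: hJ; rewrite ltr_pdivlMr // => hJ.
  have : 0 <= t0^-1 ^+ J by rewrite exprn_ge0.
  nra.
apply: le_lt_trans (cnD _ _) _; lra.
Qed.

End Vanishing.

Lemma cvgC_bounded (R : realType) (u : nat -> Cplx R) (l : Cplx R) : u @ \oo --> l ->
  exists B : R, forall n, cn (u n) <= B.
Proof.
move=> /cvgC_P /(_ 1 ltr01) [N hN]; exists (cn l + 1 + \sum_(i < N) cn (u i)) => n.
have S0 : 0 <= \sum_(i < N) cn (u i) by apply: sumr_ge0 => i _; exact: cn_ge0.
have l0 := cn_ge0 l.
have [nN|Nn] := ltnP n N; last first.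
  have := cnD (u n - l) l; rewrite subrK; have := hN n Nn; lra.
rewrite (bigD1 (Ordinal nN)) //=.
have : 0 <= \sum_(i < N | i != Ordinal nN) cn (u i) by apply: sumr_ge0 => i _; exact: cn_ge0.
lra.
Qed.

Section Identity.
Variables (R : realType) (k : nat).
Local Notation C := (Cplx R).
Local Notation mono := {ffun 'I_k -> nat}.
Variables (f D N : 'rV[C]_k -> C).
Hypotheses (pD : polyfun D) (pN : polyfun N).

(** What vanishes is [D f - N]. *)
Definition vanishes_near (p : 'rV[C]_k) := exists2 e : R, 0 < e &
  forall h : 'rV[C]_k, (forall i, cn (h 0 i) < e) -> D (p + h) * f (p + h) = N (p + h).

(** On the complex line through [p + h0] and [p + h] the difference [D f - N] is a limit of
    polynomials in [t]. It vanishes for [t] near 0, and [bounded_vanishing] transports this to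
    [t = 1]. The radius does not depend on [h0], as the closedness argument in [vanishing_extends]
    requires. *)
Lemma analytic_identity p : analytic_at f p -> exists2 r : R, 0 < r &
  forall h0 : 'rV[C]_k, (forall i, cn (h0 0 i) < r) -> vanishes_near (p + h0) ->
  vanishes_near p.
Proof.
move=> [coef [rC [rC0 hf]]]; pose r : R := complex.Re rC.
have rCE : rC = r%:C%C by rewrite /r RRe_real // gtr0_real.
have r0 : 0 < r by rewrite -ltcR -rCE.
have ltr (x : C) : (`|x| < rC) = (cn x < r) by rewrite cnE rCE ltcR.
exists (r / 4); first by rewrite divr_gt0.
move=> h0 hh0 [e e0 he]; exists (r / 4); first by rewrite divr_gt0.
move=> h hh.
pose v := h - h0.
have [PD hPD] := polyfun_line pD (p + h0) v; have [PN hPN] := polyfun_line pN (p + h0) v.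
pose lin i : {poly C} := v 0 i *: 'X + (h0 0 i)%:P.
pose pN_ n : {poly C} := \sum_(m : {ffun 'I_k -> 'I_n})
  (coef (multi_index m))%:P * \prod_(i < k) lin i ^+ multi_index m i.
have evN n t : (pN_ n).[t] = \sum_(m : {ffun 'I_k -> 'I_n})
    coef (multi_index m) * monomial (h0 + t *: v) (multi_index m).
  rewrite /pN_ horner_sum; apply: eq_bigr => m _.
  rewrite hornerM hornerC /monomial horner_prod; congr (_ * _); apply: eq_bigr => i _.
  by rewrite horner_exp hornerD hornerZ hornerX hornerC !mxE; congr (_ ^+ _); ring.
(* The coordinates of [h0] are below [r / 4] and those of [v] below [r / 2], so for [cn t <= t0] the
   line stays within [7 r / 8], inside the polydisc of convergence. *)
pose t0 : R := 5 / 4.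
have cv i : cn (v 0 i) < r / 2.
  rewrite /v !mxE; apply: le_lt_trans (cnB _ _) _; have := hh i; have := hh0 i; lra.
have small (t : C) : cn t <= t0 -> forall i, cn ((h0 + t *: v) 0 i) < r.
  move=> ht i; rewrite !mxE; apply: le_lt_trans (cnD _ _) _; rewrite cnM.
  have := cv i; have := hh0 i; have := cn_ge0 (v 0 i); have := cn_ge0 t.
  rewrite /v !mxE; rewrite /t0 in ht; nra.
have cvf (t : C) : cn t <= t0 -> (fun n => (pN_ n).[t]) @ \oo --> f (p + h0 + t *: v).
  move=> ht; have [|_ H] := hf (h0 + t *: v); first by move=> i; rewrite ltr small.
  by under eq_fun => n do rewrite evN; rewrite -addrA.
(* Absolute convergence at this single point bounds the majorants of all partial sums at [t0]. *)
pose hs : 'rV[C]_k := \row_i ((cn (v 0 i) * t0 + cn (h0 0 i))%:C%C).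
have hsr i : cn (hs 0 i) < r.
  rewrite mxE cn_real ger0_norm; last by rewrite addr_ge0 ?mulr_ge0 ?cn_ge0 //; rewrite /t0; lra.
  have := cv i; have := hh0 i; rewrite /t0; lra.
have [B hB] : exists B : R, forall n, \sum_(m : {ffun 'I_k -> 'I_n})
    cn (coef (multi_index m) * monomial hs (multi_index m)) <= B.
  have [|/cvg_ex [l hl] _] := hf hs; first by move=> i; rewrite ltr hsr.
  have [B hB] := cvgC_bounded hl; exists B => n; apply: le_trans (hB n).
  under [X in cn X]eq_bigr => m _ do rewrite cnE.
  by rewrite -rmorph_sum cn_real ler_norm.
pose g n := PD * pN_ n - PN.
pose PL i : {poly R} := cn (v 0 i) *: 'X + (cn (h0 0 i))%:P.
have majlin i : majorant (lin i) (PL i).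
  rewrite /lin /PL -!mul_polyC; apply: majorantD; last exact: majorantC.
  by apply: majorantM; [exact: majorantC|exact: majorantX].
pose P_ n : {poly R} := \sum_(m : {ffun 'I_k -> 'I_n})
  (cn (coef (multi_index m)))%:P * \prod_(i < k) PL i ^+ multi_index m i.
have maj n : majorant (pN_ n) (P_ n).
  apply: majorant_sum => m; apply: majorantM; first exact: majorantC.
  by apply: majorant_prod => i; exact: majorant_exp.
have P_B n : (P_ n).[t0] <= B.
  apply: le_trans (hB n); rewrite /P_ horner_sum; apply: ler_sum => m _.
  rewrite hornerM hornerC horner_prod cnM /monomial cn_prod le_eqVlt; apply/orP; left.
  apply/eqP; congr (_ * _); apply: eq_bigr => i _.
  rewrite horner_exp cnX /PL hornerD hornerZ hornerX hornerC [hs 0 i]mxE cn_real ger0_norm //.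
  by rewrite addr_ge0 ?mulr_ge0 ?cn_ge0 //; rewrite /t0; lra.
pose QD : {poly R} := \poly_(i < size PD) cn PD`_i.
pose QN : {poly R} := \poly_(i < size PN) cn PN`_i.
have t0_0 : 0 <= t0 by rewrite /t0; lra.
have QD0 : 0 <= QD.[t0].
  have := majorant_le 0 t0_0 (@majorant_self R PD); rewrite big_ord0 //.
have gM n m : \sum_(i < m) cn (g n)`_i * t0 ^+ i <= QD.[t0] * B + QN.[t0].
  have mg : majorant (g n) (QD * P_ n + QN).
    apply: majorantD; last by apply: majorantN; exact: majorant_self.
    by apply: majorantM; [exact: majorant_self|exact: maj].
  apply: le_trans (majorant_le m t0_0 mg) _.
  by rewrite hornerD hornerM lerD2r ler_wpM2l.
have cvg_g (t : C) : cn t <= t0 -> (fun n => (g n).[t]) @ \oo -->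
    D (p + h0 + t *: v) * f (p + h0 + t *: v) - N (p + h0 + t *: v).
  move=> ht; have e1 : (fun n => (g n).[t]) = (fun n => PD.[t] * (pN_ n).[t] - PN.[t]).
    by apply/funext => n; rewrite /g hornerD hornerN hornerM.
  rewrite e1 hPD hPN; apply: cvgB; last exact: cvg_cst.
  by apply: cvgM; [exact: cvg_cst|exact: cvf].
pose S : R := 1 + \sum_i cn (v 0 i).
have S0 : 0 < S by rewrite ltr_wpDr // sumr_ge0 // => i _; exact: cn_ge0.
pose e1 := Num.min 1 (e / S).
have e10 : 0 < e1 by rewrite lt_min ltr01 divr_gt0.
have g0 (t : C) : cn t < e1 -> (fun n => (g n).[t]) @ \oo --> (0 : C).
  move=> ht; have tt0 : cn t <= t0.
    apply: le_trans (ltW ht) _; apply: (@le_trans _ _ 1); first by rewrite ge_min lexx.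
    by rewrite /t0; lra.
  have -> : (0 : C) = D (p + h0 + t *: v) * f (p + h0 + t *: v) - N (p + h0 + t *: v).
    rewrite he ?subrr // => i; rewrite mxE cnM.
    have vS : cn (v 0 i) <= S.
      rewrite /S (bigD1 i) //=.
      have : 0 <= \sum_(j | j != i) cn (v 0 j) by apply: sumr_ge0 => j _; exact: cn_ge0.
      by have := cn_ge0 (v 0 i); lra.
    have : cn t < e / S by apply: lt_le_trans ht _; rewrite ge_min lexx orbT.
    rewrite ltr_pdivlMr // => hh1; apply: le_lt_trans hh1.
    by rewrite ler_wpM2l ?cn_ge0.
  exact: cvg_g.
have t01 : 1 < t0 by rewrite /t0; lra.
have l1 := bounded_vanishing t01 e10 gM g0.
have l2 := cvg_g 1; rewrite cn1 in l2; have {}l2 := l2 (ltW t01).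
have := cvgC_unique l2 l1.
have -> : p + h0 + 1 *: v = p + h by rewrite scale1r /v addrA addrAC addrK addrC.
by move/eqP; rewrite subr_eq0 => /eqP.
Qed.

(** The points of [U] near which [D f = N] form a nonempty, open and relatively closed subset. For
    closedness, a limit point [p] has a point of the set within the radius that [analytic_identity]
    provides at [p]. *)
Lemma vanishing_extends (U : set 'rV[C]_k) (p0 p1 : 'rV[C]_k) :
  connected U -> open U -> (forall p, U p -> analytic_at f p) ->
  U p0 -> vanishes_near p0 -> U p1 -> D p1 * f p1 = N p1.
Proof.
move=> cU oU aU Up0 vp0 Up1.
have ball_nbhs (p : 'rV[C]_k) (e : R) : 0 < e -> nbhs p [set p' | forall i, cn (p' 0 i - p 0 i) < e].
  move=> e0; apply/nbhs_ballP; exists (e%:C%C : C) => /=.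
    by rewrite -[0]/((0 : R)%:C%C) ltcR.
  move=> p' [_ hp'] i; have := hp' 0 i; rewrite /ball /= cnE ltcR.
  by rewrite -cnN opprB.
pose V := U `&` [set p | vanishes_near p].
suff VU : V = U.
  have : V p1 by rewrite VU.
  move=> [_ [e e0 /(_ 0)]]; rewrite addr0; apply=> i.
  by rewrite mxE cn0.
apply: cU; first by exists p0.
- exists (interior [set p | vanishes_near p]); first exact: open_interior.
  rewrite /V; apply/seteqP; split=> p [Up vp]; split=> //; last exact: interior_subset.
  have [e e0 he] := vp; have e2 : 0 < e / 2 by rewrite divr_gt0.
  apply: filterS (ball_nbhs p _ e2) => p' /= hp'; exists (e / 2) => // h hh.
  have -> : p' + h = p + (p' - p + h) by rewrite addrA subrKC.
  apply: he => i; rewrite !mxE; apply: le_lt_trans (cnD _ _) _.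
  by have := hp' i; have := hh i; lra.
- exists (closure [set p | vanishes_near p]); first exact: closed_closure.
  rewrite /V; apply/seteqP; split=> p [Up vp]; split=> //; first exact: subset_closure.
  have [r r0 hr] := analytic_identity (aU p Up).
  have [p' [vp' hp']] := vp _ (ball_nbhs p _ r0).
  apply: (hr (p' - p)) => [i|]; first by rewrite !mxE; exact: hp'.
  by rewrite subrKC.
Qed.

End Identity.

(** * Connectedness of the complement of the zero set *)

Section NonvanishingSet.
Variable R : realType.
Local Notation C := (Cplx R).

Lemma continuous_real_complex : continuous (fun x : R => (x%:C%C : C)).
Proof.
move=> x; apply/cvgrPdist_lt => e e0.
have e'0 : 0 < complex.Re e by rewrite -ltcR RRe_real // gtr0_real.
pose e' := complex.Re e; near=> y.
rewrite cn_lt_real // -rmorphB cn_real.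
near: y; exact: (nbhsx_ballx x e').
Unshelve. all: by end_near. Qed.

(** Parabolas from 0 to 1. An inner point [z] determines [s] as [Im z / (Re z (1 - Re z))], so two
    of them meet only at the end points. *)
Definition arc (s t : R) : C := t%:C%C + 'i * (s * (t * (1 - t)))%:C%C.

Lemma arc0 s : arc s 0 = 0.
Proof. by rewrite /arc mul0r mulr0 -[0%:C%C]/(0 : C) mulr0 addr0. Qed.

Lemma arc1 s : arc s 1 = 1.
Proof. by rewrite /arc subrr mulr0 mulr0 -[0%:C%C]/(0 : C) mulr0 addr0. Qed.

Lemma continuous_arc s : continuous (arc s).
Proof.
move=> t; have real_comp (f : R -> R) : f x @[x --> t] --> f t ->
    (f x)%:C%C @[x --> t] --> ((f t)%:C%C : C).
  by move=> cf; exact: (cvg_comp f (fun x => (x%:C%C : C)) cf (@continuous_real_complex (f t))).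
apply: cvgD; first exact: (real_comp id cvg_id).
apply: cvgM; first exact: cvg_cst.
apply: (real_comp (fun t => s * (t * (1 - t)))).
apply: cvgM; first exact: cvg_cst.
by apply: cvgM; [exact: cvg_id|apply: cvgB; [exact: cvg_cst|exact: cvg_id]].
Qed.

Lemma arc_avoids_roots (P : {poly C}) : P.[0] != 0 -> P.[1] != 0 ->
  exists s, forall t, P.[arc s t] != 0.
Proof.
move=> P0 P1; have [r Pr] := closed_field_poly_normal P.
have root_in z : P.[z] = 0 -> z \in r.
  move=> Pz; have : root P z by apply/eqP.
  rewrite Pr rootZ ?root_prod_XsubC // lead_coef_eq0.
  by apply: contraNneq P0 => ->; rewrite horner0.
pose bad (z : C) : R := complex.Im z / (complex.Re z * (1 - complex.Re z)).
(* This parameter exceeds [bad] at every root, so no inner point of the arc is a root. *)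
exists (1 + \sum_(z <- r) `|bad z|) => t; apply/eqP => Pt.
set s := 1 + _ in Pt.
have ReA : complex.Re (arc s t) = t by rewrite /arc -complexiE /=; ring.
have ImA : complex.Im (arc s t) = s * (t * (1 - t)) by rewrite /arc -complexiE /=; ring.
have t0 : t != 0 by apply: contraNneq P0 => t0; apply/eqP; rewrite -[RHS]Pt t0 arc0.
have t1 : 1 - t != 0.
  by rewrite subr_eq0; apply: contraNneq P1 => t1; apply/eqP; rewrite -[RHS]Pt -t1 arc1.
have bs : bad (arc s t) = s by rewrite /bad ReA ImA; field; rewrite t0 t1.
have : `|s| <= \sum_(z <- r) `|bad z|.
  rewrite (big_rem _ (root_in _ Pt)) /= bs lerDl; exact: sumr_ge0.
apply/negP; rewrite -ltNge; apply: lt_le_trans (ler_norm _).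
by rewrite /s ltrDr.
Qed.

Variable k : nat.
Variable D : 'rV[C]_k -> C.
Hypotheses (pD : polyfun D) (D0 : D 0 != 0).

Lemma open_nonvanishing : open [set p | D p != 0].
Proof.
have -> : [set p | D p != 0] = D @^-1` (~` [set 0]).
  by apply/seteqP; split=> p /= /eqP.
apply: open_comp; first by move=> p _; exact: polyfun_continuous.
by apply: closed_openC; apply: accessible_closed_set1; apply: hausdorff_accessible; exact: norm_hausdorff.
Qed.

Lemma connected_nonvanishing : connected [set p | D p != 0].
Proof.
pose A (ps : 'rV[C]_k * R) : set 'rV[C]_k := [set arc ps.2 t *: ps.1 | t in `[0, 1]].
pose ok (ps : 'rV[C]_k * R) := A ps `<=` [set p | D p != 0].
have -> : [set p | D p != 0] = \bigcup_(ps in ok) A ps.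
  apply/seteqP; split=> p; last by move=> [ps hps Ap]; exact: hps.
  move=> /= Dp; have [P hP] := polyfun_line pD 0 p.
  have [||s hs] := @arc_avoids_roots P.
  - by rewrite -hP scale0r addr0.
  - by rewrite -hP scale1r add0r.
  exists (p, s); first by move=> _ [t _ <-] /=; rewrite -[_ *: p]add0r hP.
  exists 1; last by rewrite arc1 scale1r.
  by rewrite /= in_itv /= ler01 lexx.
apply: bigcup_connected.
  exists 0 => ps _; exists 0; last by rewrite arc0 scale0r.
  by rewrite /= in_itv /= ler01 lexx.
move=> ps _; apply: connected_continuous_connected; first exact: segment_connected.
apply: continuous_subspaceT => t; apply: cvgZr_tmp.
exact: continuous_arc.
Qed.

End NonvanishingSet.

(** * Quotients by powers of a polynomial function *)

Section Localization.
Variables (R : realType) (k : nat).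
Local Notation C := (Cplx R).
Variable D : 'rV[C]_k -> C.
Hypothesis pD : polyfun D.

(* Membership in the localization of the polynomial functions at [D], up to
   the values on the zero set of [D]. *)
Definition localized (g : 'rV[C]_k -> C) := exists m N, polyfun N /\
  forall p, D p != 0 -> g p = N p / D p ^+ m.

Lemma localized_polyfun g : polyfun g -> localized g.
Proof. by move=> pg; exists 0%N, g; split=> // p _; rewrite expr0 divr1. Qed.

Lemma localized_ext g h : (forall p, D p != 0 -> g p = h p) -> localized g -> localized h.
Proof.
by move=> gh [m [N [pN hN]]]; exists m, N; split=> // p Dp; rewrite -gh // hN.
Qed.

Lemma localizedM g h : localized g -> localized h -> localized (fun p => g p * h p).
Proof.
move=> [m [N [pN hN]]] [m' [N' [pN' hN']]]; exists (m + m')%N, (fun p => N p * N' p).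
split=> [|p Dp]; first exact: polyfun_mul.
by rewrite hN // hN' // exprD invfM mulrACA.
Qed.

Lemma localizedD g h : localized g -> localized h -> localized (fun p => g p + h p).
Proof.
move=> [m [N [pN hN]]] [m' [N' [pN' hN']]].
exists (m + m')%N, (fun p => N p * D p ^+ m' + N' p * D p ^+ m).
split=> [|p Dp]; first by apply: polyfun_add; apply: polyfun_mul => //; exact: polyfun_exp.
rewrite hN // hN' // exprD.
have := expf_neq0 m Dp; have := expf_neq0 m' Dp.
move: (D p ^+ m) (D p ^+ m') (N p) (N' p) => x y z t y0 x0.
by field; rewrite x0 y0.
Qed.

Lemma localized_prod (I : Type) (r : seq I) (F : I -> 'rV[C]_k -> C) :
  (forall i, localized (F i)) -> localized (fun p => \prod_(i <- r) F i p).
Proof.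
move=> h; elim: r => [|i r IH].
  by apply: (localized_ext _ (localized_polyfun (polyfun_cst _ 1))) => p _; rewrite big_nil.
by apply: (localized_ext _ (localizedM (h i) IH)) => p _; rewrite big_cons.
Qed.

Lemma localized_sum (I : Type) (r : seq I) (P : pred I) (F : I -> 'rV[C]_k -> C) :
  (forall i, localized (F i)) -> localized (fun p => \sum_(i <- r | P i) F i p).
Proof.
move=> h; elim: r => [|i r IH].
  by apply: (localized_ext _ (localized_polyfun (polyfun_cst _ 0))) => p _; rewrite big_nil.
case Pi: (P i).
  by apply: (localized_ext _ (localizedD (h i) IH)) => p _; rewrite big_cons Pi.
by apply: (localized_ext _ IH) => p _; rewrite big_cons Pi.
Qed.

(** A factor of [D] becomes invertible, with its cofactor over [D] as inverse. *)
Lemma localized_inv F G : (forall p, D p = F p * G p) -> polyfun G ->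
  localized (fun p => (F p)^-1).
Proof.
move=> DFG pG; exists 1%N, G; split=> // p Dp; rewrite expr1 DFG.
move: Dp; rewrite DFG mulf_eq0 negb_or => /andP[F0 G0].
by move: (F p) (G p) F0 G0 => x y x0 y0; field; rewrite x0 y0.
Qed.

End Localization.

(** * The formula for all admissible parameters *)

Section Continuation.
Variables (R : realType) (n : nat).
Local Notation C := (Cplx R).
Implicit Types p : 'rV[C]_5.

Let pa p : C := p 0 (@Ordinal 5 0 isT).
Let pb p : C := p 0 (@Ordinal 5 1 isT).
Let pc p : C := p 0 (@Ordinal 5 2 isT).
Let pd p : C := p 0 (@Ordinal 5 3 isT).
Let pq p : C := p 0 (@Ordinal 5 4 isT).

Let paramsE p : p = aw_params (pa p) (pb p) (pc p) (pd p) (pq p).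
Proof.
apply/rowP => i; rewrite mxE; case: i => [[|[|[|[|[|//]]]]]] hi /=;
  by congr (p _ _); apply: val_inj.
Qed.

Let params_coord a b c d q : let p := aw_params a b c d q : 'rV[C]_5 in
  [/\ pa p = a, pb p = b, pc p = c, pd p = d & pq p = q].
Proof. by split; rewrite /= /pa /pb /pc /pd /pq mxE. Qed.

Let dA p : C := 1 - pa p * pc p + pa p * 'i + pc p * 'i.
Let dB p : C := 1 - pb p * pd p - pb p * 'i - pd p * 'i.
Let dE p j : C := 1 - pa p * pb p * pc p * pd p * pq p ^+ j.
(** The factor [1 - q] stands inside the product: for [n = 0] the point [q = 1] is admissible and
    [D] must not vanish there. *)
Let D p : C := dA p * dB p * \prod_(j < n) ((1 - pq p) * dE p j).
Let value p : C := tableau_formula n (pa p) (pb p) (pc p) (pd p) (pq p).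

Let pcoord i : polyfun (fun p : 'rV[C]_5 => p 0 i). Proof. exact: polyfun_coord. Qed.
Let pcst (x : C) : polyfun (fun=> x : C) := polyfun_cst 5 x.
Let p1q : polyfun (fun p => 1 - pq p).
Proof. by apply: polyfun_sub; [exact: pcst|exact: pcoord]. Qed.
Let pdA : polyfun dA.
Proof.
apply: polyfun_add; last by apply: polyfun_mul; [exact: pcoord|exact: pcst].
apply: polyfun_add; last by apply: polyfun_mul; [exact: pcoord|exact: pcst].
by apply: polyfun_sub; [exact: pcst|apply: polyfun_mul; exact: pcoord].
Qed.
Let pdB : polyfun dB.
Proof.
apply: polyfun_sub; last by apply: polyfun_mul; [exact: pcoord|exact: pcst].
apply: polyfun_sub; last by apply: polyfun_mul; [exact: pcoord|exact: pcst].
by apply: polyfun_sub; [exact: pcst|apply: polyfun_mul; exact: pcoord].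
Qed.
Let pdE j : polyfun (fun p => dE p j).
Proof.
apply: polyfun_sub; first exact: pcst.
apply: polyfun_mul; last by apply: polyfun_exp; exact: pcoord.
by do 3?[apply: polyfun_mul; last exact: pcoord]; exact: pcoord.
Qed.
Let pP (s : pred 'I_n) : polyfun (fun p => \prod_(j < n | s j) ((1 - pq p) * dE p j)).
Proof.
apply: polyfun_ext (_ : polyfun (fun p => \prod_(j < n) if s j then (1 - pq p) * dE p j else 1)).
  by move=> p; rewrite [RHS]big_mkcond.
apply: polyfun_prod => j; case: (s j); last exact: pcst.
exact: polyfun_mul.
Qed.
Let pD : polyfun D.
Proof. by apply: polyfun_mul; [exact: polyfun_mul|exact: (pP predT)]. Qed.

Let D_factors p : D p != 0 -> [/\ dA p != 0, dB p != 0 &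
  forall j, (j < n)%N -> 1 - pq p != 0 /\ dE p j != 0].
Proof.
rewrite /D !mulf_eq0 !negb_or => /andP[/andP[A0 B0] /prodf_neq0 h]; split=> // j jn.
by have := h (Ordinal jn) isT; rewrite mulf_eq0 negb_or => /andP.
Qed.

Let localized_value : localized D value.
Proof.
have lpol g : polyfun g -> localized D g by exact: localized_polyfun.
have lcst (x : C) : localized D (fun=> x) by apply: lpol; exact: pcst.
have l1q : localized D (fun p => 1 - pq p) by exact: lpol.
have lA : localized D (fun p => (dA p)^-1).
  apply: (@localized_inv _ _ D dA (fun p => dB p * \prod_(j < n) ((1 - pq p) * dE p j))).
    by move=> p; rewrite mulrA.
  by apply: polyfun_mul; [|exact: (pP predT)].
have lB : localized D (fun p => (dB p)^-1).
  apply: (@localized_inv _ _ D dB (fun p => dA p * \prod_(j < n) ((1 - pq p) * dE p j))).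
    by move=> p; rewrite mulrCA mulrA.
  by apply: polyfun_mul; [|exact: (pP predT)].
have lqE (j : 'I_n) : localized D (fun p => ((1 - pq p) * dE p j)^-1).
  apply: (@localized_inv _ _ D (fun p => (1 - pq p) * dE p j)
    (fun p => dA p * dB p * \prod_(i < n | i != j) ((1 - pq p) * dE p i))).
    by move=> p; rewrite /D (bigD1 j) //= mulrCA.
  by apply: polyfun_mul; [exact: polyfun_mul|exact: pP].
have lq (j : 'I_n) : localized D (fun p => (1 - pq p)^-1).
  apply: (localized_ext _ (localizedM (lpol _ (pdE j)) (lqE j))) => p /D_factors[_ _ /(_ _ (ltn_ord j))[q0 e0]].
  by move: (1 - pq p) (dE p j) q0 e0 => x y x0 y0; field; rewrite x0 y0.
pose al p := (1 - pq p) / dA p; pose be p := (1 - pq p) / dB p.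
pose ga p := (1 - pq p) * pa p * pc p / dA p; pose de p := (1 - pq p) * pb p * pd p / dB p.
have lal : localized D al by exact: localizedM.
have lbe : localized D be by exact: localizedM.
have lga : localized D ga.
  by do 2?[apply: localizedM; last exact: lpol]; apply: localizedM => //; apply: lpol;
    do 2?[apply: polyfun_mul; last exact: pcoord].
have lde : localized D de.
  by do 2?[apply: localizedM; last exact: lpol]; apply: localizedM => //; apply: lpol;
    do 2?[apply: polyfun_mul; last exact: pcoord].
have llam (j : 'I_n) : localized D (fun p => (al p * be p - ga p * de p * pq p ^+ j)^-1).
  have pAB : polyfun (fun p => dA p * dB p) by exact: polyfun_mul.
  apply: (localized_ext _ (localizedM (lpol _ pAB) (localizedM (lq j) (lqE j)))) => p Dp.
  have [A0 B0 /(_ _ (ltn_ord j))[q0 e0]] := D_factors Dp.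
  have -> : al p * be p - ga p * de p * pq p ^+ j =
    (1 - pq p) ^+ 2 * dE p j / (dA p * dB p) := lamE (pq p) A0 B0 j.
  move: (1 - pq p) (dE p j) (dA p) (dB p) q0 e0 A0 B0 => x y z t x0 y0 z0 t0.
  by field; rewrite x0 y0 z0 t0.
have lZ : localized D (fun p => Z n (-1) (al p) (be p) (ga p) (de p) (pq p)).
  apply: localized_sum; first exact: pD.
  move=> T; apply: localizedM; last exact: lcst.
  apply: localized_prod => x; case: (T x) => [[]|] //.
  by case: (assigned_q T x); [apply: lpol; exact: pcoord|exact: lcst].
have lnum : localized D (fun p => (1 - pq p) ^+ n) by apply: lpol; exact: polyfun_exp.
have lden := localizedM (lcst ((2 ^+ n * 'i ^+ n)^-1))
  (localized_prod (index_enum 'I_n) llam).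
apply: localized_ext (localizedM (localizedM lnum lden) lZ) => p _.
by rewrite prodfV -invfM.
Qed.

Let polydisc_cn p : @polydisc R 5 p -> [/\ cn (pa p) < 1, cn (pb p) < 1, cn (pc p) < 1,
  cn (pd p) < 1 & cn (pq p) < 1].
Proof.
have lt1 (x : C) : `|x| < 1 -> cn x < 1 by rewrite cnE -[1]/((1 : R)%:C%C) ltcR.
by move=> hp; split; apply: lt1; exact: hp.
Qed.

Let D_polydisc p : @polydisc R 5 p -> D p != 0.
Proof.
move=> /polydisc_cn[a1 b1 c1 d1 q1].
rewrite /D !mulf_neq0 ?denomA_neq0 ?denomB_neq0 //.
apply/prodf_neq0 => j _; apply: mulf_neq0; first exact: one_sub_neq0.
exact: (abcd_neq0 a1 b1 c1 d1 q1).
Qed.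

Let polydisc0 : @polydisc R 5 0.
Proof. by move=> i; rewrite mxE normr0. Qed.

(** At 0 the identity [D^m f = N] holds on the whole polydisc by [disc_moment]; [vanishing_extends]
    carries it through [U], and [D p != 0] allows the division at [p]. *)
Lemma continuation_value U f p : aw_moment_continuation n U f -> U p -> D p != 0 ->
  f p = value p.
Proof.
move=> [oU cU dU aU hU] Up Dp; have [m [N [pN hN]]] := localized_value.
have pDm : polyfun (fun p => D p ^+ m) by exact: polyfun_exp.
have v0 : vanishes_near f (fun p => D p ^+ m) N 0.
  exists 1 => // h hh; rewrite add0r; have hd : @polydisc R 5 h.
    by move=> i; rewrite cnE -[1]/((1 : R)%:C%C) ltcR.
  have Dh := D_polydisc hd; have [a1 b1 c1 d1 q1] := polydisc_cn hd.
  have -> : f h = N h / D h ^+ m.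
    rewrite -hN // [in LHS](paramsE h) hU; last by rewrite -paramsE.
    exact: disc_moment.
  by rewrite mulrCA mulfV ?mulr1 // expf_neq0.
have := vanishing_extends pDm pN cU oU aU (dU _ polydisc0) v0 Up.
move=> E; rewrite hN // -E mulrAC mulfV ?mul1r // expf_neq0 //.
Qed.

Lemma continuation_exists :
  exists f, aw_moment_continuation n [set p | D p != 0] f.
Proof.
have [m [N [pN hN]]] := localized_value.
exists (fun p => N p / D p ^+ m); split.
- exact: open_nonvanishing.
- by apply: connected_nonvanishing => //; exact: D_polydisc.
- by move=> p; exact: D_polydisc.
- move=> p Dp; apply: (ratio_analytic pN (polyfun_exp m pD)); exact: expf_neq0.
- move=> a b c d q hp; rewrite -hN; last exact: D_polydisc.
  have [ea eb ec ed eq] := params_coord a b c d q.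
  have [] := polydisc_cn hp; rewrite ea eb ec ed eq => a1 b1 c1 d1 q1.
  by rewrite /value ea eb ec ed eq (disc_moment n a1 b1 c1 d1 q1).
Qed.

(** [continuation_exists] rules out the default of [xget], and [continuation_value] identifies
    whichever value it selects. *)
Lemma aw_moment_formula (a b c d q : C) :
  1 - a * c + a * 'i + c * 'i != 0 -> 1 - b * d - b * 'i - d * 'i != 0 ->
  (forall j, (j < n)%N -> 1 - q != 0 /\ 1 - a * b * c * d * q ^+ j != 0) ->
  aw_moment n a b c d q = tableau_formula n a b c d q.
Proof.
move=> A0 B0 E0; have [ea eb ec ed eq] := params_coord a b c d q.
have Dp : D (aw_params a b c d q) != 0.
  rewrite /D /dA /dB /dE ea eb ec ed eq; apply: mulf_neq0; first exact: mulf_neq0.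
  by apply/prodf_neq0 => j _; have [] := E0 j (ltn_ord j); exact: mulf_neq0.
have valE : value (aw_params a b c d q) = tableau_formula n a b c d q.
  by rewrite /value ea eb ec ed eq.
have [f hf] := continuation_exists.
rewrite /aw_moment; case: xgetP => [v _ [U [g [hg Ug <-]]]|/(_ (value (aw_params a b c d q))) []].
  by rewrite (continuation_value hg Ug Dp).
exists [set p | D p != 0], f; split; first exact: hf.
  exact: Dp.
exact: (continuation_value hf Dp Dp).
Qed.

End Continuation.

Theorem theorem1p11 (R : realType) (n : nat) (a b c d q : Cplx R) :
  let al := (1 - q) / (1 - a * c + a * 'i + c * 'i) in
  let be := (1 - q) / (1 - b * d - b * 'i - d * 'i) in
  let ga := (1 - q) * a * c / (1 - a * c + a * 'i + c * 'i) in
  let de := (1 - q) * b * d / (1 - b * d - b * 'i - d * 'i) in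
  1 - a * c + a * 'i + c * 'i != 0 ->
  1 - b * d - b * 'i - d * 'i != 0 ->
  (forall j : nat, (j < n)%N -> al * be - ga * de * q ^+ j != 0) ->
  aw_moment n a b c d q =
    (1 - q) ^+ n /
      (2 ^+ n * 'i ^+ n * \prod_(j < n) (al * be - ga * de * q ^+ j)) *
    Z n (-1) al be ga de q.
Proof.
move=> al be ga de A0 B0 lam0.
apply: aw_moment_formula => // j jn.
have := lam0 j jn.
(* In this factored form, nonvanishing of the scalar gives both [1 - q != 0] and
   [1 - a b c d q^j != 0]. *)
have -> : al * be - ga * de * q ^+ j = (1 - q) ^+ 2 * (1 - a * b * c * d * q ^+ j) /
  ((1 - a * c + a * 'i + c * 'i) * (1 - b * d - b * 'i - d * 'i)) := lamE q A0 B0 j.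
by rewrite mulf_eq0 mulf_eq0 sqrf_eq0 !negb_or => /andP[/andP[q0 e0] _]; split.
Qed.
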